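(* Let $0<Z<Z_c$, and let $b_{l,s}$ be the partial-wave Brown--Ravenhall operators in $L^2(0,\infty)$, for $l\in\{0,1,2,\dots\}$, $s\in\{\tfrac12,-\tfrac12\}$, $(l,s)\ne(0,-\tfrac12)$. (i) For $(l,s)\neq(1,-\tfrac12)$, the operator $b_{l,s}$ has no eigenvalues in $[mc^2,\infty)$. (ii) For $(l,s)=(1,-\tfrac12)$, the operator $b_{1,-1/2}$ has no eigenvalues in $[\max\{1,\,2\alpha Z-\tfrac12\}\,mc^2,\infty)$; in particular, $b_{1,-1/2}$ has no eigenvalues in $[mc^2,\infty)$ if $Z\le Z_c'=\frac{3}{4\alpha}$.
   Context: Constants: $m>0$ (mass), $c>0$ (speed of light), $\alpha>0$ (fine structure constant), $Z>0$ (nuclear charge, real); $Z_c=\frac{2}{(\frac{\pi}{2}+\frac{2}{\pi})\alpha}$ (note $\frac{3}{4\alpha}<Z_c$). For $p\ge 0$ put $e(p)=\sqrt{c^2p^2+m^2c^4}$ (so $e(0)=mc^2$) and $n(p)=[2e(p)(e(p)+e(0))]^{1/2}$. $Q_l$ denotes the Legendre function of the second kind, $Q_l(t)=\frac12\int_{-1}^1\frac{P_l(x)}{t-x}\,dx$ for $t>1$, with $P_l$ the Legendre polynomials. For $l\in\{0,1,2,\dots\}$ and $s=\pm\frac12$ with $(l,s)\neq(0,-\frac12)$ (the pairs for which the corresponding spherical spinors in the partial wave decomposition do not vanish), define for $p,p'>0$ $$k_{l,s}(p',p)=\frac{[e(p')+e(0)]\,Q_l\!\left(\tfrac12\left[\tfrac{p'}{p}+\tfrac{p}{p'}\right]\right)[e(p)+e(0)]+c^2p'\,Q_{l+2s}\!\left(\tfrac12\left[\tfrac{p'}{p}+\tfrac{p}{p'}\right]\right)p}{n(p')\,n(p)}$$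 and, on the domain $L^2(0,\infty;\sqrt{1+p^2}\,dp)$ (the $L^2$ space with weight $\sqrt{1+p^2}$), the form $$\beta_{l,s}[\phi,\psi]=\int_0^\infty e(p)\,\overline{\phi(p)}\,\psi(p)\,dp-\frac{\alpha cZ}{\pi}\int_0^\infty\!\!\int_0^\infty\overline{\phi(p')}\,k_{l,s}(p',p)\,\psi(p)\,dp'\,dp.$$ For $Z<Z_c$ these forms are closed and positive in $L^2(0,\infty)$, and $b_{l,s}$ denotes the self-adjoint operator in $L^2(0,\infty)$ associated with $\beta_{l,s}$, i.e. $(\phi,b_{l,s}\psi)=\beta_{l,s}[\phi,\psi]$ for $\psi\in\mathcal{D}(b_{l,s})$ and $\phi$ in the form domain (inner product linear in the second argument). *)

(* Defs.v *)
From HB Require Import structures.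
From mathcomp Require Import all_boot all_order all_algebra.
From mathcomp Require Import all_classical all_reals all_analysis.
From mathcomp Require Export complex.

Set Implicit Arguments.
Unset Strict Implicit.
Unset Printing Implicit Defensive.

Import Order.TTheory GRing.Theory Num.Theory.
Import numFieldNormedType.Exports.

Local Open Scope classical_set_scope.
Local Open Scope ring_scope.
Local Open Scope complex_scope.

(* The library has no measurable structure or integral for complex-valued
   functions; both are taken componentwise. *)
Section ComplexIntegral.
Context d (T : measurableType d) (R : realType).

Definition cmeasurable_fun (D : set T) (f : T -> R[i]) : Prop :=
  measurable_fun D (fun x => complex.Re (f x)) /\
  measurable_fun D (fun x => complex.Im (f x)).

Definition cintegral (mu : {measure set T -> \bar R}) (D : set T)
    (f : T -> R[i]) : R[i] :=
  Rintegral mu D (fun x => complex.Re (f x)) +i*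
  Rintegral mu D (fun x => complex.Im (f x)).

End ComplexIntegral.

Section HalfLine.
Context (R : realType).

Notation leb := (@lebesgue_measure R).

Definition halfline : set R := `]0, +oo[%classic.

(* Elements of the L^2 spaces are represented by functions; equality of
   elements is [ae_eq_halfline]. *)
Definition ae_eq_halfline (f g : R -> R[i]) : Prop :=
  {ae leb, forall p, halfline p -> f p = g p}.

Definition L2w (w : R -> R) : set (R -> R[i]) :=
  [set f | cmeasurable_fun halfline f /\
     (\int[leb]_(p in halfline) (w p * Normc.normc (f p) ^+ 2)%:E < +oo)%E].

Definition L2 : set (R -> R[i]) := L2w (fun=> 1).

Definition inner (f g : R -> R[i]) : R[i] :=
  cintegral leb halfline (fun p => (f p)^* * g p).

(* Graph of the operator in L2 associated with the sesquilinear form [b] with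
   form domain [V]: psi is in its domain, with image eta. *)
Definition form_operator (V : set (R -> R[i]))
    (b : (R -> R[i]) -> (R -> R[i]) -> R[i]) (psi eta : R -> R[i]) : Prop :=
  [/\ V psi, L2 eta & forall phi, V phi -> inner phi eta = b phi psi].

Definition eigenvalue_of (A : (R -> R[i]) -> (R -> R[i]) -> Prop) (z : R[i]) :
    Prop :=
  exists psi eta : R -> R[i],
    [/\ A psi eta, ~ ae_eq_halfline psi (fun=> 0) &
        ae_eq_halfline eta (fun p => z * psi p)].

End HalfLine.

Section Legendre.
Context (R : realType).

(* Rodrigues' formula *)
Definition legendreP (l : nat) : {poly R} :=
  (2 ^+ l * (l`!)%:R)^-1 *: (('X ^+ 2 - 1) ^+ l)^`(l).

Definition legendreQ (l : nat) (t : R) : R :=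
  2^-1 * Rintegral (@lebesgue_measure R) `[-1, 1]%classic
           (fun x => (legendreP l).[x] / (t - x)).

End Legendre.

(* s = 1/2 or s = -1/2 *)
Variant spin := spin_up | spin_down.

(* l + 2s; the truncation of 0.-1 only concerns the excluded pair (0, -1/2). *)
Definition add_2s (l : nat) (s : spin) : nat :=
  match s with spin_up => l.+1 | spin_down => l.-1 end.

Section BrownRavenhall.
Context (R : realType) (m c alpha Z : R).

Definition Z_crit : R := 2 / ((pi / 2 + 2 / pi) * alpha).

Definition energy (p : R) : R := Num.sqrt (c ^+ 2 * p ^+ 2 + m ^+ 2 * c ^+ 4).

Definition nfactor (p : R) : R :=
  Num.sqrt (2 * energy p * (energy p + energy 0)).

Definition kernel_ls (l : nat) (s : spin) (p' p : R) : R :=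
  let t := 2^-1 * (p' / p + p / p') in
  ((energy p' + energy 0) * legendreQ l t * (energy p + energy 0)
   + c ^+ 2 * p' * legendreQ (add_2s l s) t * p)
  / (nfactor p' * nfactor p).

Definition form_domain : set (R -> R[i]) :=
  L2w (fun p => Num.sqrt (1 + p ^+ 2)).

Definition beta_form (l : nat) (s : spin) (phi psi : R -> R[i]) : R[i] :=
  cintegral (@lebesgue_measure R) (@halfline R)
    (fun p => (energy p)%:C * (phi p)^* * psi p)
  - (alpha * c * Z / pi)%:C *
    cintegral (@lebesgue_measure R \x @lebesgue_measure R)%E
      (@halfline R `*` @halfline R)
      (fun q => (phi q.1)^* * (kernel_ls l s q.1 q.2)%:C * psi q.2).

Definition b_ls (l : nat) (s : spin) :
    (R -> R[i]) -> (R -> R[i]) -> Prop :=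
  form_operator form_domain (beta_form l s).

End BrownRavenhall.

(* Main.v *)
Require Import Defs.
From mathcomp Require Import all_boot all_order all_algebra.
From mathcomp Require Import all_classical all_reals all_analysis.
From mathcomp Require Import measurable_realfun.
From mathcomp Require Import ring lra.
Set Implicit Arguments.
Unset Strict Implicit.
Unset Printing Implicit Defensive.
Import Order.TTheory GRing.Theory Num.Theory.
Import numFieldNormedType.Exports.
Local Open Scope classical_set_scope.
Local Open Scope ring_scope.

(** Let psi be an eigenfunction with eigenvalue E, put e0 = m c^2, and write
    x = e0 / e(p), which lies between 0 and 1. In terms of x the kernel is
    k = a G G' + b H H' with G = sqrt ((1 + x) / 2), H = sqrt ((1 - x) / 2), and with
    a and b the Legendre functions Q_l and Q_(l+2s) of (p'/p + p/p') / 2, which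
    depend only on the ratio of the momenta. Everything is real, so psi may be
    replaced by its real or imaginary part f.

    A dilation of the momentum is the same as a change of the rest energy. Testing
    the eigenvalue equation with dilates of f, dividing by the change of the rest
    energy and passing to the limit yields a virial identity (virial_difference,
    virial). It is combined with the equation tested with x f and with x^2 f. The
    contribution of a cancels, and what remains (virial_combined) is

      int [E (1 - x + x^2) - e0 (2 x - 1)] f^2
        = K int int (x + x') b H H' f f',    K = alpha c Z / pi.

    The right-hand side is estimated by a Schur test with weight sqrt (p / p')
    (schur_energy): the map u |-> u / e(p u) lies below its tangent at u = 1
    (en_tangent), so only moments of Q_(l+2s) against u^(-1/2) and u^(-3/2) occur.
    They are at most 2 pi for Q_0 and 4 pi / 3 for every other Q_L
    (ratioQ_moment_le); this follows from Rodrigues' formula, which after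
    integration by parts exhibits Q_L as an integral with a positive kernel
    (legendreQ_rodrigues). Writing A = alpha Z and kappa = 2 A or 4 A / 3
    accordingly, the conclusion is

      int [E (1 - x + x^2) - e0 (2 x - 1)
             - kappa e0 sqrt (1 - x^2) (1 - x)] f^2 <= 0.

    It remains to see that the bracket is positive for 0 < x < 1, for then f = 0
    (eigenfunction_ae0). Below the critical charge A < 1. If E >= e0, the first two
    terms are at least e0 (1 - x) (2 - x), and kappa <= 3 / 2 is enough: this is the
    case for 4 A / 3, and for 2 A when A <= 3 / 4. The index l + 2 s = 0 occurs only
    in the channel (1, -1/2); there, for A >= 3 / 4, the bound E >= (2 A - 1/2) e0
    makes the bracket positive (virial_gap_strong). *)

(** * Integral bounds from a primitive on an exhausting sequence *)
Section calc.
Context {R : realType}.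
Notation mu := (@lebesgue_measure R).

(** An improper integral of a nonnegative function is the limit of the integrals
    over compact intervals, each of which is an increment of the primitive; a
    uniform bound on the increments is all that is needed, and no limit of the
    primitive at the endpoints has to be computed. *)
Lemma ge0_integral_le_FTC (I : set R) (a b : nat -> R) (f F : R -> R) (C : R) :
  I = \bigcup_n `[a n, b n]%classic ->
  (forall n, a n < b n) ->
  nonincreasing_seq a -> nondecreasing_seq b ->
  (forall x, I x -> 0 <= f x) ->
  (forall x, I x -> {for x, continuous f}) ->
  (forall x, I x -> is_derive x 1 F (f x)) ->
  (forall n, F (b n) - F (a n) <= C) ->
  (\int[mu]_(x in I) (f x)%:E <= C%:E)%E.
Proof.
move=> IE ab na nb f0 cf dF FC.
have sub n : `[a n, b n]%classic `<=` I by rewrite IE => x abx; exists n.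
have mfn n : measurable_fun `[a n, b n]%classic f.
  apply: subspace_continuous_measurable_fun => //.
  apply: continuous_in_subspaceT => x /set_mem xab; exact/cf/(sub n).
have := @ge0_nondecreasing_set_cvg_integral _ (measurableTypeR R) R
  (fun n => `[a n, b n]%classic) (EFin \o f) mu.
rewrite -IE => H.
have cv : (\int[mu]_(x in `[a i, b i]) (f x)%:E)%E @[i --> \oo] -->
          (\int[mu]_(x in I) (f x)%:E)%E.
  apply: H => //.
  - move=> m n mn; rewrite subsetEset => x /=; rewrite !in_itv/= => /andP[ax xb].
    by rewrite (le_trans (na _ _ mn) ax) (le_trans xb (nb _ _ mn)).
  - by move=> n; apply/measurable_EFinP; exact: mfn.
  - by move=> n x abx; rewrite lee_fin; apply: f0; exact: (sub n).
rewrite -(cvg_lim _ cv)//.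
apply: lime_le; first by apply/cvg_ex; eexists; exact: cv.
apply: nearW => n.
have cF x : I x -> {for x, continuous F}.
  move=> Ix; apply: differentiable_continuous; apply/derivable1_diffP.
  by have [] := dF _ Ix.
have oo x : x \in `]a n, b n[ -> I x.
  move=> /subset_itv_oo_cc; exact: sub.
rewrite (@continuous_FTC2 _ f F)//.
- by rewrite -EFinB lee_fin.
- by apply: continuous_in_subspaceT => x /set_mem xab; exact/cf/(sub n).
- split.
  + by move=> x /oo Ix; have [] := dF _ Ix.
  + apply: cvg_at_right_filter; apply: cF; apply: (sub n).
    by rewrite /= in_itv/= lexx ltW.
  + apply: cvg_at_left_filter; apply: cF; apply: (sub n).
    by rewrite /= in_itv/= lexx ltW.
- by move=> x /oo Ix; rewrite derive1E; have [] := dF _ Ix.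
Qed.

End calc.

(** * Differentiation rules *)

Section derive_rules.
Context {R : realType}.
Implicit Types (f g : R -> R) (x a b : R).

(** The rules take a value of the derivative that is unified with the goal,
    rather than one found by instance search, so that long explicit
    differentiations can be composed as terms. *)
Lemma derD f g x a b : is_derive x 1 f a -> is_derive x 1 g b ->
  is_derive x 1 (fun u => f u + g u) (a + b).
Proof. by move=> ? ?; exact: is_deriveD. Qed.

Lemma derB f g x a b : is_derive x 1 f a -> is_derive x 1 g b ->
  is_derive x 1 (fun u => f u - g u) (a - b).
Proof. by move=> ? ?; exact: is_deriveB. Qed.

Lemma derM f g x a b : is_derive x 1 f a -> is_derive x 1 g b ->
  is_derive x 1 (fun u => f u * g u) (f x * b + g x * a).
Proof. by move=> ? ?; exact: is_deriveM. Qed.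

Lemma der_sqr f x a : is_derive x 1 f a ->
  is_derive x 1 (fun u => f u ^+ 2) (2 * f x * a).
Proof.
move=> df; have -> : (fun u => f u ^+ 2) = (fun u => f u * f u).
  by apply/funext => u; rewrite expr2.
apply: (is_derive_eq (derM df df)); ring.
Qed.

Lemma derZ k f x a : is_derive x 1 f a ->
  is_derive x 1 (fun u => k * f u) (k * a).
Proof. by move=> ?; exact: is_deriveZ. Qed.

Lemma derV f x a : is_derive x 1 f a -> f x != 0 ->
  is_derive x 1 (fun u => (f u)^-1) (- a / f x ^+ 2).
Proof.
move=> dfx fx0; have H := is_deriveV fx0 dfx; apply: (is_derive_eq H).
by rewrite /GRing.scale/=; field.
Qed.

Lemma der_comp f g x a b : is_derive x 1 g b -> is_derive (g x) 1 f a ->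
  is_derive x 1 (fun u => f (g u)) (a * b).
Proof. by move=> ? ?; exact: is_derive1_comp. Qed.

Lemma der_cst k x : is_derive x 1 (fun _ : R => k) (0 : R).
Proof. exact: is_derive_cst. Qed.

Lemma der_id x : is_derive x 1 (fun u : R => u : R) (1 : R).
Proof. exact: is_derive_id. Qed.

Lemma der_ln g x b : is_derive x 1 g b -> 0 < g x ->
  is_derive x 1 (fun u => ln (g u)) ((g x)^-1 * b).
Proof. by move=> dg gx; exact: (der_comp dg (is_derive1_ln gx)). Qed.

Lemma der_sqrt x : 0 < x -> is_derive x 1 Num.sqrt (2 * Num.sqrt x)^-1.
Proof. exact: is_derive1_sqrt. Qed.

Lemma der_continuous f x a : is_derive x 1 f a -> {for x, continuous f}.
Proof.
by move=> [df _]; apply: differentiable_continuous; apply/derivable1_diffP.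
Qed.
End derive_rules.

(** * Moments of the Poisson-type kernel 1 / (u^2 - 2 u y + 1) *)
Section moment_integrals.
Context {R : realType}.
Notation mu := (@lebesgue_measure R).

Lemma denom_gt0 (y u : R) : -1 < y -> y < 1 -> 0 < u ^+ 2 - 2 * u * y + 1.
Proof.
move=> y1 y2; have : 0 < (1 - y) * (1 + y) by rewrite mulr_gt0; lra.
have := sqr_ge0 (u - y); rewrite !expr2; nra.
Qed.

Let w (u : R) := Num.sqrt u + (Num.sqrt u)^-1.
Let z (u : R) := Num.sqrt u - (Num.sqrt u)^-1.
(** With v = sqrt u, the quotient (u^2 - 2 u y + 1) / u equals
    (v - 1/v)^2 + s^2 and also (v + 1/v)^2 - r^2, where s^2 = 2 - 2 y and
    r^2 = 2 + 2 y. The part of the integrand that is even under u |-> 1/u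
    integrates to an arc tangent of v - 1/v, the odd part to a logarithm in
    v + 1/v. *)
Let prim (e s r u : R) :=
  s^-1 * atan (z u / s) + e / (2 * r) * (ln (w u - r) - ln (w u + r)).

Let w_gt (r u : R) : 0 < r -> r < 2 -> 0 < u -> 0 < w u - r.
Proof.
move=> r0 r2 u0; rewrite /w subr_gt0 (lt_le_trans r2)//.
have v0 : 0 < Num.sqrt u by rewrite sqrtr_gt0.
rewrite -(ler_pM2r v0) [leRHS]mulrDl mulVf ?gt_eqF//.
have := sqr_ge0 (Num.sqrt u - 1); nra.
Qed.

Let der_prim (e s r y u : R) : 0 < u -> 0 < s -> 0 < r -> r < 2 ->
    s ^+ 2 = 2 - 2 * y -> r ^+ 2 = 2 + 2 * y ->
  is_derive u 1 (prim e s r)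
    (((u + 1) + e * (u - 1)) / (2 * Num.sqrt u * (u ^+ 2 - 2 * u * y + 1))).
Proof.
move=> u0 s0 r0 r2 sE rE.
have v0 : 0 < Num.sqrt u by rewrite sqrtr_gt0.
have vn0 : Num.sqrt u != 0 by rewrite gt_eqF.
have dv := der_sqrt u0.
have dV := derV dv vn0.
have dw := derD dv dV.
have dz := derB dv dV.
have dat := der_comp (derZ s^-1 dz) (is_derive1_atan _).
have wr : 0 < w u - r := w_gt r0 r2 u0.
have wr' : 0 < w u + r by rewrite (lt_trans wr)// /w; lra.
have dl1 := der_ln (derB dw (der_cst r u)) wr.
have dl2 := der_ln (derD dw (der_cst r u)) wr'.
have H := derD (derZ s^-1 dat) (derZ (e / (2 * r)) (derB dl1 dl2)).
have -> : prim e s r = fun u : R => s^-1 * atan (s^-1 * (Num.sqrt u - (Num.sqrt u)^-1)) +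
     e / (2 * r) *
     (ln (Num.sqrt u + (Num.sqrt u)^-1 - r) -
      ln (Num.sqrt u + (Num.sqrt u)^-1 + r)).
  by apply/funext => t; rewrite /prim /w /z /= [_ / s]mulrC.
apply: (is_derive_eq H).
rewrite /w in wr wr' *.
move: wr wr' vn0 v0; set v := Num.sqrt u => wr wr' vn0 v0.
have uE : u = v ^+ 2 by rewrite sqr_sqrtr// ltW.
have yE : y = (2 - s ^+ 2) / 2 by rewrite sE; lra.
have rE2 : r ^+ 2 = 4 - s ^+ 2 by rewrite rE sE; lra.
have D0 : 0 < u ^+ 2 - 2 * u * y + 1.
  apply: denom_gt0; rewrite yE; nra.
have sn0 : s != 0 by rewrite gt_eqF.
have rn0 : r != 0 by rewrite gt_eqF.
rewrite uE yE in D0 *.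
have E1 : 1 + (s^-1 * (v - v^-1)) ^+ 2 =
   ((v ^+ 2) ^+ 2 - 2 * v ^+ 2 * ((2 - s ^+ 2) / 2) + 1) / (s ^+ 2 * v ^+ 2).
  by field; rewrite sn0 vn0.
have E2 : (v + v^-1 - r)^-1 - (v + v^-1 + r)^-1 =
    2 * r * v ^+ 2 / ((v ^+ 2) ^+ 2 - 2 * v ^+ 2 * ((2 - s ^+ 2) / 2) + 1).
  have -> : ((v ^+ 2) ^+ 2 - 2 * v ^+ 2 * ((2 - s ^+ 2) / 2) + 1) =
     v ^+ 2 * ((v + v^-1 - r) * (v + v^-1 + r)).
    rewrite -subr_sqr mulrBr rE2; by field.
  have P1 : v * v + 1 + - r * v = v * (v + v^-1 - r) by field.
  have P2 : v * v + 1 + r * v = v * (v + v^-1 + r) by field.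
  by field; rewrite P1 P2 !mulf_neq0 ?vn0 ?gt_eqF.
have -> : (v + v^-1 - r)^-1 * ((2 * v)^-1 + - (2 * v)^-1 / v ^+ 2 - 0) -
    (v + v^-1 + r)^-1 * ((2 * v)^-1 + - (2 * v)^-1 / v ^+ 2 + 0) =
   ((v + v^-1 - r)^-1 - (v + v^-1 + r)^-1) * ((2 * v)^-1 - (2 * v)^-1 / v ^+ 2).
  by rewrite subr0 addr0 mulNr -mulrBl.
rewrite E1 E2.
have D1 : v ^+ 2 ^+ 2 - v ^+ 2 * (2 - s ^+ 2) + 1 != 0.
  by move: (gt_eqF D0) => /negbT; congr (_ != _); field.
by field; rewrite vn0 rn0 sn0 D1.
Qed.

Let halfline_exhaustion :
  `]0, +oo[%classic = \bigcup_n `[(n.+2%:R)^-1, n.+2%:R]%classic :> set R.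
Proof.
apply/seteqP; split => u /=; last first.
  move=> [n _ /=]; rewrite !in_itv/= andbT => /andP[+ _].
  by apply: lt_le_trans; rewrite invr_gt0.
rewrite in_itv/= andbT => u0.
exists (Num.truncn (u + u^-1)) => //=; rewrite in_itv/=.
have ui0 : 0 < u^-1 by rewrite invr_gt0.
have H := truncnS_gt (u + u^-1).
have H2 : u + u^-1 < (Num.truncn (u + u^-1)).+2%:R.
  by rewrite (lt_trans H)// ltr_nat.
apply/andP; split; last by rewrite ltW// (le_lt_trans _ H2)// lerDl ltW.
rewrite -[leRHS]invrK lef_pV2 ?posrE// ltW// (le_lt_trans _ H2)//.
by rewrite lerDr ltW.
Qed.

Lemma integral_halfline_le_FTC (f F : R -> R) (C : R) :
  (forall u : R, 0 < u -> 0 <= f u) ->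
  (forall u : R, 0 < u -> {for u, continuous f}) ->
  (forall u : R, 0 < u -> is_derive u 1 F (f u)) ->
  (forall b, 1 < b -> F b - F b^-1 <= C) ->
  (\int[mu]_(u in `]0%R, +oo[) (f u)%:E <= C%:E)%E.
Proof.
move=> f0 cf dF FC.
have itv u : `]0, +oo[%classic u -> 0 < u by rewrite /= in_itv/= andbT.
apply: (ge0_integral_le_FTC halfline_exhaustion (F := F)).
- by move=> n; rewrite (@lt_trans _ _ 1)// ?invf_lt1// ltr1n.
- by move=> m n mn; rewrite lef_pV2 ?posrE// ler_nat.
- by move=> m n mn; rewrite ler_nat.
- by move=> u /itv; exact: f0.
- by move=> u /itv; exact: cf.
- by move=> u /itv; exact: dF.
- by move=> n; apply: FC; rewrite ltr1n.
Qed.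

Let continuous_moment (e y u : R) : 0 < u -> -1 < y -> y < 1 ->
  {for u, continuous (fun u : R => ((u + 1) + e * (u - 1)) /
     (2 * Num.sqrt u * (u ^+ 2 - 2 * u * y + 1)) : R)}.
Proof.
move=> u0 y1 y2; have D0 := denom_gt0 u y1 y2.
have v0 : 0 < Num.sqrt u by rewrite sqrtr_gt0.
have d1 := der_id u.
have dc (k : R) := der_cst k u.
have dn := derD (derD d1 (dc 1)) (derZ e (derB d1 (dc 1))).
have dD := derD (derB (der_sqr d1) (derM (derZ 2 d1) (dc y))) (dc 1).
have dd := derM (derZ 2 (der_sqrt u0)) dD.
have D1 : 2 * Num.sqrt u * (u ^+ 2 - 2 * u * y + 1) != 0.
  by rewrite !mulf_neq0 ?gt_eqF.
exact: (der_continuous (derM dn (derV dd D1))).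
Qed.

(** The logarithm in the primitive is invariant under u |-> 1/u, so it
    contributes nothing between 1/b and b: only the arc tangent, whose total
    variation is at most pi, remains. Hence the bound does not depend on e. *)
Lemma moment_le (e y : R) : -1 <= e <= 1 -> -1 < y -> y < 1 ->
  (\int[mu]_(u in `]0%R, +oo[) (((u + 1) + e * (u - 1)) /
     (2 * Num.sqrt u * (u ^+ 2 - 2 * u * y + 1)))%:E <=
   (pi / Num.sqrt (2 - 2 * y))%:E)%E.
Proof.
move=> e1 y1 y2.
set s := Num.sqrt (2 - 2 * y); set r := Num.sqrt (2 + 2 * y).
have s0 : 0 < s by rewrite sqrtr_gt0; lra.
have r0 : 0 < r by rewrite sqrtr_gt0; lra.
have sE : s ^+ 2 = 2 - 2 * y by rewrite sqr_sqrtr//; lra.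
have rE : r ^+ 2 = 2 + 2 * y by rewrite sqr_sqrtr//; lra.
have r2 : r < 2 by nra.
apply: (integral_halfline_le_FTC (F := prim e s r)).
- move=> u u0; apply: divr_ge0; first by nra.
  by rewrite !mulr_ge0// ?sqrtr_ge0// ltW// denom_gt0.
- by move=> u u0; exact: continuous_moment.
- by move=> u u0; apply: der_prim.
- move=> b b1; have b0 : 0 < b by lra.
  have wE : w b^-1 = w b by rewrite /w sqrtrV ?ltW// invrK addrC.
  (* w (1/b) = w b, so the logarithms cancel *)
  rewrite /prim wE opprD addrACA subrr addr0 -mulrBr mulrC ler_pM2r ?invr_gt0//.
  have := atan_ltpi2 (z b / s); have := atan_gtNpi2 (z b^-1 / s); lra.
Qed.


Let itv11_exhaustion :
  `]-1, 1[%classic =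
  \bigcup_n `[-1 + (n.+2%:R)^-1, 1 - (n.+2%:R)^-1]%classic :> set R.
Proof.
apply/seteqP; split => y /=; last first.
  move=> [n _ /=]; rewrite !in_itv/=.
  have : 0 < n.+2%:R^-1 :> R by rewrite invr_gt0// ltr0n.
  set i := _^-1; move=> i0 /andP[? ?]; apply/andP; split; lra.
rewrite in_itv/= => /andP[y1 y2].
pose e := Num.min (y + 1) (1 - y).
have e0 : 0 < e by rewrite lt_min; apply/andP; split; lra.
exists (Num.truncn e^-1) => //=; rewrite in_itv/=.
have H : (Num.truncn e^-1).+2%:R^-1 <= e.
  rewrite -[leRHS]invrK lef_pV2 ?posrE ?ltr0n ?invr_gt0//.
  by rewrite ltW// (lt_trans (truncnS_gt _))// ltr_nat.
have : e <= y + 1 by rewrite ge_min lexx.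
have : e <= 1 - y by rewrite ge_min lexx orbT.
move: H; set i := _^-1 => *; lra.
Qed.

Lemma integral_itv11_le_FTC (f F : R -> R) (C : R) :
  (forall y : R, -1 < y -> y < 1 -> 0 <= f y) ->
  (forall y : R, -1 < y -> y < 1 -> {for y, continuous f}) ->
  (forall y : R, -1 < y -> y < 1 -> is_derive y 1 F (f y)) ->
  (forall x y : R, -1 < x -> x < 1 -> -1 < y -> y < 1 -> F y - F x <= C) ->
  (\int[mu]_(y in `](-1)%R, 1%R[) (f y)%:E <= C%:E)%E.
Proof.
move=> f0 cf dF FC.
have itv (y : R) : `]-1, 1[%classic y -> -1 < y < 1 by rewrite /= in_itv.
have i1 n : n.+2%:R^-1 <= 2^-1 :> R by rewrite lef_pV2 ?posrE ?ltr0n// ler_nat.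
have i2 n : 0 < n.+2%:R^-1 :> R by rewrite invr_gt0 ltr0n.
have i3 m n : (m <= n)%N -> n.+2%:R^-1 <= m.+2%:R^-1 :> R.
  by move=> mn; rewrite lef_pV2 ?posrE ?ltr0n// ler_nat.
apply: (ge0_integral_le_FTC itv11_exhaustion (F := F)).
- by move=> n; have := i1 n; have := i2 n; set i := _^-1; lra.
- by move=> m n mn; rewrite lerD2l i3.
- by move=> m n mn; rewrite lerD2l lerN2 i3.
- by move=> y /itv/andP[]; exact: f0.
- by move=> y /itv/andP[]; exact: cf.
- by move=> y /itv/andP[]; exact: dF.
- by move=> n; have := i1 n; have := i2 n; set i := _^-1 => *; apply: FC; lra.
Qed.

Let der_gap (y : R) : y < 1 ->
  is_derive y 1 (fun y : R => Num.sqrt (2 - 2 * y) : R) (- (Num.sqrt (2 - 2 * y))^-1).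
Proof.
move=> y1; have z0 : 0 < 2 - 2 * y by lra.
have dz := derB (der_cst 2 y) (derZ 2 (der_id y)).
apply: (is_derive_eq (der_comp dz (der_sqrt z0))).
by field; rewrite gt_eqF// sqrtr_gt0.
Qed.

Let gap_bound (y : R) : -1 < y -> y < 1 ->
  0 < Num.sqrt (2 - 2 * y) < 2 /\ Num.sqrt (2 - 2 * y) ^+ 2 = 2 - 2 * y.
Proof.
move=> y1 y2.
have z0 : 0 < Num.sqrt (2 - 2 * y) by rewrite sqrtr_gt0; lra.
have zE : Num.sqrt (2 - 2 * y) ^+ 2 = 2 - 2 * y by rewrite sqr_sqrtr; lra.
by split=> //; rewrite z0/=; nra.
Qed.

Lemma angular_integral_le :
  (\int[mu]_(y in `](-1)%R, 1%R[) (pi / Num.sqrt (2 - 2 * y))%:E <= (2 * pi)%:E)%E.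
Proof.
have pi0 := pi_gt0 R.
apply: (integral_itv11_le_FTC (F := fun y : R => - pi * Num.sqrt (2 - 2 * y))).
- by move=> y y1 y2; rewrite divr_ge0 ?sqrtr_ge0// ltW.
- move=> y y1 y2; have [/andP[z0 _] _] := gap_bound y1 y2.
  exact: (der_continuous (derZ pi (derV (der_gap y2) (lt0r_neq0 z0)))).
- move=> y y1 y2; apply: (is_derive_eq (derZ (- pi) (der_gap y2))); ring.
- move=> x y x1 x2 y1 y2.
  have [/andP[? ?] _] := gap_bound y1 y2; have [/andP[? ?] _] := gap_bound x1 x2.
  nra.
Qed.

(** In terms of z = sqrt (2 - 2 y) one has (1 + y) / 2 = 1 - z^2 / 4 and
    dy = - z dz, whence the primitive - pi (z - z^3 / 12), which varies by at
    most 4 pi / 3 over 0 < z < 2. *)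
Lemma angular_integral_weighted_le :
  (\int[mu]_(y in `](-1)%R, 1%R[)
     ((1 + y) / 2 * (pi / Num.sqrt (2 - 2 * y)))%:E <= (4 / 3 * pi)%:E)%E.
Proof.
have pi0 := pi_gt0 R.
pose Z (y : R) : R := Num.sqrt (2 - 2 * y).
apply: (integral_itv11_le_FTC (F := fun y : R => - pi * (Z y - Z y ^+ 2 * Z y / 12))).
- by move=> y y1 y2; rewrite mulr_ge0 ?divr_ge0 ?sqrtr_ge0//; lra.
- move=> y y1 y2; have [/andP[z0 _] _] := gap_bound y1 y2.
  have dd := derZ pi (derV (der_gap y2) (lt0r_neq0 z0)).
  have dn := derM (derD (der_cst 1 y) (der_id y)) (der_cst 2^-1 y).
  exact: (der_continuous (derM dn dd)).
- move=> y y1 y2; have [/andP[z0 _] zE] := gap_bound y1 y2.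
  have dz := der_gap y2.
  have d3 := derM (derM (der_sqr dz) dz) (der_cst 12^-1 y).
  apply: (is_derive_eq (derZ (- pi) (derB dz d3))).
  have yE : (1 + y) / 2 = 1 - (Num.sqrt (2 - 2 * y)) ^+ 2 / 4 by rewrite zE; lra.
  by rewrite yE; field; rewrite gt_eqF.
- move=> x y x1 x2 y1 y2; rewrite /Z.
  have [/andP[b0 b2] _] := gap_bound y1 y2.
  have [/andP[a0 a2] _] := gap_bound x1 x2.
  move: a0 a2 b0 b2; set a := Num.sqrt (2 - 2 * x).
  set b := Num.sqrt (2 - 2 * y) => a0 a2 b0 b2.
  rewrite -mulrBr mulNr -mulrN mulrC ler_pM2r// opprB.
  have : 0 <= b - b ^+ 2 * b / 12.
    have -> : b - b ^+ 2 * b / 12 = b * ((12 - b * b) / 12) by field.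
    by rewrite mulr_ge0 ?divr_ge0//; nra.
  have : a - a ^+ 2 * a / 12 <= 4 / 3.
    have : 0 <= (2 - a) * ((2 - a) * (a + 4)) by rewrite !mulr_ge0; lra.
    by rewrite expr2 => H; nra.
  lra.
Qed.
End moment_integrals.

(** * Integrals under dilations and under exchange of variables *)
Section dilation.
Context {R : realType}.
Notation mu := (@lebesgue_measure R).

Lemma measurable_inv : measurable_fun [set: R] (fun x : R => x^-1).
Proof.
have -> : (fun x : R => x^-1) = (fun x => x * (x ^+ 2) `^ (-1)).
  apply/funext => x; rewrite powR_inv1 ?sqr_ge0//.
  by have [->|x0] := eqVneq x 0; rewrite ?invr0 ?mul0r//; field.
apply: measurable_funM => //.
apply: (measurableT_comp (f := @powR R ^~ (-1)) (g := fun x : R => x ^+ 2)).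
  exact: measurable_powR.
exact: exprn_measurable.
Qed.

Lemma measurable_funV d (T : measurableType d) (D : set T) (f : T -> R) :
  measurable_fun D f -> measurable_fun D (fun x => (f x)^-1).
Proof. by move=> mf; exact: measurableT_comp measurable_inv mf. Qed.

Lemma measurable_sqrt d (T : measurableType d) (D : set T) (f : T -> R) :
  measurable_fun D f -> measurable_fun D (fun x => Num.sqrt (f x)).
Proof.
move=> mf; apply: measurableT_comp mf; apply: continuous_measurable_fun.
exact: sqrt_continuous.
Qed.

Let mul_measurable (l : R) :
  measurable_fun [set: measurableTypeR R] ( *%R l : R -> measurableTypeR R).
Proof. exact: mulrl_measurable. Qed.

(** Both sides are measures in A; it suffices to compare them on half-open
    intervals. *)
Let lebesgue_measure_dilation (l : R) (A : set R) : 0 < l -> measurable A ->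
  mu A = (l%:E * mu ( *%R l @^-1` A))%E.
Proof.
move=> l0 mA; pose nl := NngNum (ltW l0).
have -> : (l%:E * mu ( *%R l @^-1` A))%E =
  mscale nl [the measure _ _ of pushforward mu ( *%R l : R -> measurableTypeR R)] A.
  by [].
apply: lebesgue_measure_unique => //= _ [[a b]] _ <-.
rewrite /mscale/= /pushforward.
have -> : *%R l @^-1` `]a, b]%classic = `]a / l, b / l]%classic.
  apply/seteqP; split=> x/=; rewrite !in_itv/= ltr_pdivrMr// ler_pdivlMr//;
  by rewrite mulrC.
rewrite !lebesgue_measure_itv/= !lte_fin ltr_pM2r ?invr_gt0//.
by case: ifP => _; rewrite ?mule0// -!EFinB -EFinM; congr (_%:E); field; rewrite gt_eqF.
Qed.

Lemma ge0_integral_dilation (l : R) (g : R -> \bar R) : 0 < l ->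
  measurable_fun setT g -> (forall x, 0 <= g x)%E ->
  (\int[mu]_x g (l * x)%R = (l^-1)%:E * \int[mu]_x g x)%E.
Proof.
move=> l0 mg g0; pose nl := NngNum (ltW l0).
pose m' := [the measure _ _ of pushforward mu ( *%R l : R -> measurableTypeR R)].
have -> : (\int[mu]_x g x = \int[mscale nl (m' (@mul_measurable l))]_x g x)%E.
  by apply: eq_measure_integral => A mA _; exact: lebesgue_measure_dilation.
rewrite ge0_integral_mscale//= muleA -EFinM mulVf ?gt_eqF// mul1e.
by rewrite ge0_integral_pushforward//.
Qed.

Notation mu2 := (mu \x mu)%E.

Lemma ge0_integral_dilation2 (l : R) (g : R * R -> \bar R) : 0 < l ->
  measurable_fun setT g -> (forall x, 0 <= g x)%E ->
  (\int[mu2]_q g (l * q.1, l * q.2)%R = (l ^- 2)%:E * \int[mu2]_q g q)%E.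
Proof.
move=> l0 mg g0.
rewrite fubini_tonelli1//; last first.
  apply: measurableT_comp => //; apply/measurable_fun_pairP; split => /=.
    by apply: measurable_funM.
  by apply: measurable_funM.
rewrite [in RHS]fubini_tonelli1// /fubini_F.
under eq_integral => x _.
  rewrite (@ge0_integral_dilation l (fun y => g (l * x, y)))//; last first.
    by apply: measurableT_comp => //; exact: measurable_pair1.
  over.
rewrite ge0_integralZl//; last 3 first.
- apply: (@measurableT_comp _ _ _ _ _ _ (fun x => \int[mu]_y g (x, y))%E).
    exact: measurable_fun_fubini_tonelli_F.
  exact: mulrl_measurable.
- by move=> x _; exact: integral_ge0.
- by rewrite lee_fin invr_ge0 ltW.
rewrite (@ge0_integral_dilation l (fun x => \int[mu]_y g (x, y))%E)//.
- by rewrite muleA -EFinM -invfM.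
- exact: measurable_fun_fubini_tonelli_F.
- by move=> x; exact: integral_ge0.
Qed.

End dilation.
(** A change of variables known for nonnegative functions passes to integrable
    functions through positive and negative parts. It is used for one- and
    two-dimensional dilations and for the swap of coordinates. *)
Section transport.
Context d (T : measurableType d) (R : realType) (m : {measure set T -> \bar R}).
Variables (phi : T -> T) (k : R).
Hypothesis mphi : measurable_fun [set: T] phi.
Hypothesis transport : forall g : T -> \bar R, measurable_fun setT g ->
  (forall x, 0 <= g x)%E -> (\int[m]_x g (phi x) = k%:E * \int[m]_x g x)%E.

Lemma integrable_transport (g : T -> R) :
  m.-integrable setT (EFin \o g) -> m.-integrable setT (EFin \o (g \o phi)).
Proof.
move=> /integrableP[/measurable_EFinP mg gfin]; apply/integrableP; split.
  by apply/measurable_EFinP; exact: measurableT_comp.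
rewrite /comp (transport (g := fun x => `|(g x)%:E|%E))//.
- have -> : (\int[m]_x `|(g x)%:E|)%E = (fine (\int[m]_x `|(g x)%:E|))%:E.
    by rewrite fineK// ge0_fin_numE ?integral_ge0.
  by rewrite -EFinM ltry.
- by do 2 apply: measurableT_comp => //.
Qed.

Lemma Rintegral_transport (g : T -> R) :
  m.-integrable setT (EFin \o g) ->
  \int[m]_x g (phi x) = k * \int[m]_x g x.
Proof.
move=> ig; have /integrableP[mg _] := ig.
rewrite /Rintegral.
rewrite integralE [in RHS]integralE.
have e1 : (\int[m]_x ((EFin \o (g \o phi)) ^\+ x) =
   k%:E * \int[m]_x ((EFin \o g)^\+ x))%E.
  rewrite -(transport (g := (EFin \o g)^\+%E))//; last exact: measurable_funepos.
  by apply: eq_integral => x _; rewrite unlock.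
have e2 : (\int[m]_x ((EFin \o (g \o phi)) ^\- x) =
   k%:E * \int[m]_x ((EFin \o g)^\- x))%E.
  rewrite -(transport (g := (EFin \o g)^\-%E))//; last exact: measurable_funeneg.
  by apply: eq_integral => x _; rewrite unlock.
rewrite [X in fine (X - _)]e1 [X in fine (_ - X)]e2.
have f1 := integrable_pos_fin_num measurableT ig.
have f2 := integrable_neg_fin_num measurableT ig.
by rewrite -(fineK f1) -(fineK f2) -!EFinM -!EFinB /= mulrBr.
Qed.

End transport.

Section dilation_integrable.
Context {R : realType}.
Notation mu := (@lebesgue_measure R).
Notation mu2 := (mu \x mu)%E.
Variable l : R.
Hypothesis l0 : 0 < l.

Lemma integrable_dilation (g : R -> R) : mu.-integrable setT (EFin \o g) ->
  mu.-integrable setT (EFin \o (fun x => g (l * x))).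
Proof.
move=> ig.
have H := @integrable_transport _ _ R mu ( *%R l) l^-1 _ _ g ig.
apply: H.
  exact: mulrl_measurable.
by move=> h mh h0; exact: ge0_integral_dilation.
Qed.

Lemma Rintegral_dilation (g : R -> R) : mu.-integrable setT (EFin \o g) ->
  \int[mu]_x g (l * x) = l^-1 * \int[mu]_x g x.
Proof.
move=> ig; have H := @Rintegral_transport _ _ R mu ( *%R l) l^-1 _ g ig; apply: H.
by move=> h mh h0; exact: ge0_integral_dilation.
Qed.

Let dil2 (q : R * R) := (l * q.1, l * q.2).

Lemma Rintegral_dilation2 (g : R * R -> R) : mu2.-integrable setT (EFin \o g) ->
  \int[mu2]_q g (l * q.1, l * q.2) = l ^- 2 * \int[mu2]_q g q.
Proof.
move=> ig; have H := @Rintegral_transport _ _ R mu2 dil2 (l ^- 2) _ g ig; apply: H.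
by move=> h mh h0; exact: ge0_integral_dilation2.
Qed.

Let measurable_flip : measurable_fun [set: R * R] (fun q : R * R => (q.2, q.1)).
Proof. by apply/measurable_fun_pairP; split; [exact: measurable_snd|exact: measurable_fst]. Qed.

Lemma Rintegral_swap (g : R * R -> R) : mu2.-integrable setT (EFin \o g) ->
  \int[mu2]_q g (q.2, q.1) = \int[mu2]_q g q.
Proof.
move=> ig; rewrite -[RHS]mul1r.
have H := @Rintegral_transport _ _ R mu2 (fun q : R * R => (q.2, q.1)) 1 _ g ig.
apply: H.
move=> h mh h0; rewrite mul1e.
rewrite fubini_tonelli1 ?[in RHS]fubini_tonelli2//.
by apply: measurableT_comp => //; exact: measurable_flip.
Qed.

End dilation_integrable.

(** * Legendre functions of the second kind *)
Section rodrigues.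
Context {R : realType}.
Notation mu := (@lebesgue_measure R).

(** Each differentiation removes at most one factor p; this makes the boundary
    terms vanish when Rodrigues' formula is integrated by parts. *)
Lemma derivn_exp_factor (p : {poly R}) (l i : nat) : (i <= l)%N ->
  exists q, (p ^+ l)^`(i) = p ^+ (l - i) * q.
Proof.
elim: i => [_|i IH il]; first by exists 1; rewrite derivn0 subn0 mulr1.
have [q qE] := IH (ltnW il).
exists ((l - i)%:R *: p^`() * q + p * q^`()).
rewrite derivnS qE derivM deriv_exp.
have -> : (l - i = (l - i.+1).+1)%N by rewrite subnS prednK// subn_gt0.
rewrite /= exprS; set n := (l - i.+1)%N.
rewrite scaler_nat -[_ *+ n.+1]mulr_natr -[p^`() *+ _]mulr_natr; ring.
Qed.

Lemma der_horner (p : {poly R}) (x : R) :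
  is_derive x 1 (fun y => p.[y]) (p^`().[x]).
Proof.
apply: DeriveDef; first exact: derivable_horner.
by rewrite -derive1E (derivE p).
Qed.

Lemma der_exp (f : R -> R) (n : nat) (x a : R) : is_derive x 1 f a ->
  is_derive x 1 (fun y => f y ^+ n.+1) (n.+1%:R * f x ^+ n * a).
Proof.
move=> df; elim: n => [|n IH].
  by rewrite expr0 mulr1 mul1r; under eq_fun do rewrite expr1.
under eq_fun do rewrite exprS.
by apply: (is_derive_eq (derM df IH)); rewrite exprS; ring.
Qed.

Variable t : R.
Hypothesis t1 : 1 < t.

(** The j-th derivative of 1 / (t - x). *)
Let pole (j : nat) (x : R) : R := j`!%:R * ((t - x)^-1) ^+ j.+1.

Let der_pole j (x : R) : x <= 1 -> is_derive x 1 (pole j) (pole j.+1 x).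
Proof.
move=> x1; have tx : t - x != 0 by rewrite gt_eqF// subr_gt0 (le_lt_trans x1).
have d := derV (derB (der_cst t x) (der_id x)) tx.
apply: (is_derive_eq (derZ j`!%:R (der_exp j d))).
rewrite /pole factS natrM !exprS.
by move: (_ ^+ j) => z; field.
Qed.

Let continuous_itv11 (f : R -> R) : (forall x : R, x <= 1 -> {for x, continuous f}) ->
  {within `[-1, 1]%classic, continuous f}.
Proof.
move=> cf; apply: continuous_in_subspaceT => x /set_mem /=.
by rewrite in_itv/= => /andP[_]; exact: cf.
Qed.

Let LR (f df : R -> R) : (forall x : R, x <= 1 -> is_derive x 1 f (df x)) ->
  derivable_oo_LRcontinuous f (-1) 1 /\ {in `](-1), 1[, f^`()%classic =1 df}.
Proof.
move=> dfx.
have cf (x : R) : x <= 1 -> {for x, continuous f} by move=> /dfx; exact: der_continuous.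
have oo (x : R) : x \in `](-1), 1[ -> x <= 1 by rewrite in_itv/= => /andP[_ /ltW].
split; last by move=> x /oo /dfx d; rewrite derive1E; case: d.
split.
- by move=> x /oo /dfx [].
- by apply: cvg_at_right_filter; apply: cf; lra.
- by apply: cvg_at_left_filter; apply: cf; lra.
Qed.

Let W (l : nat) : {poly R} := ('X ^+ 2 - 1) ^+ l.

Let W_root (l i : nat) (x : R) : (i < l)%N -> x ^+ 2 = 1 -> ((W l)^`(i)).[x] = 0.
Proof.
move=> il x1; have [q ->] := derivn_exp_factor ('X ^+ 2 - 1) (ltnW il).
by rewrite hornerM horner_exp !hornerE x1 subrr expr0n subn_eq0 leqNgt il mul0r.
Qed.

Let rodrigues_step (l j : nat) : (j < l)%N ->
  \int[mu]_(x in `[-1, 1]) (pole j x * ((W l)^`(l - j)).[x]) =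
  - \int[mu]_(x in `[-1, 1]) (pole j.+1 x * ((W l)^`(l - j.+1)).[x]).
Proof.
move=> jl.
have dG (x : R) : x <= 1 -> is_derive x 1 (fun y : R => ((W l)^`(l - j.+1)).[y])
    (((W l)^`(l - j)).[x]).
  by move=> _; have := der_horner ((W l)^`(l - j.+1)) x; rewrite -derivnS -subSn// subSS.
have [F1 F2] := LR (@der_pole j); have [G1 G2] := LR dG.
rewrite (@Rintegration_by_parts R (pole j) (fun x => ((W l)^`(l - j.+1)).[x])
  (pole j.+1) (fun x => ((W l)^`(l - j)).[x]))//.
- have lt : (l - j.+1 < l)%N by rewrite ltn_subrL (leq_ltn_trans _ jl).
  by rewrite !W_root ?mulr0 ?subrr ?sub0r ?sqrrN ?expr1n.
- by apply: continuous_itv11 => x x1; exact: (der_continuous (der_pole _ x1)).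
- by apply: continuous_itv11 => x x1; exact: (der_continuous (der_horner _ _)).
Qed.

Let rodrigues_iter (l j : nat) : (j <= l)%N ->
  \int[mu]_(x in `[-1, 1]) (pole 0 x * ((W l)^`(l)).[x]) =
  (-1) ^+ j * \int[mu]_(x in `[-1, 1]) (pole j x * ((W l)^`(l - j)).[x]).
Proof.
elim: j => [_|j IH jl]; first by rewrite expr0 mul1r subn0.
by rewrite IH 1?ltnW// rodrigues_step// exprS mulrN mulN1r mulNr.
Qed.

(** Integrating Rodrigues' formula by parts l times against 1 / (t - x) moves
    all derivatives onto the pole. The resulting integrand is positive, which
    the oscillating P_l (x) / (t - x) is not. *)
Lemma legendreQ_rodrigues (l : nat) :
  legendreQ l t = 2^-1 * \int[mu]_(x in `[-1, 1])
    (((1 - x ^+ 2) / (2 * (t - x))) ^+ l * (t - x)^-1).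
Proof.
rewrite /legendreQ; congr (_ * _).
have tx (x : R) : x \in `[-1, 1]%classic -> t - x != 0.
  by rewrite inE /= in_itv/= => /andP[_ x1]; rewrite gt_eqF// subr_gt0 (le_lt_trans x1).
have l0 : l`!%:R != 0 :> R by rewrite pnatr_eq0 -lt0n fact_gt0.
pose C : R := (2 ^+ l * l`!%:R)^-1.
have int j : mu.-integrable `[-1, 1]%classic
    (EFin \o (fun x => pole j x * ((W l)^`(l - j)).[x])).
  apply: continuous_compact_integrable; first exact: segment_compact.
  apply: continuous_itv11 => x x1.
  exact: (der_continuous (derM (der_pole _ x1) (der_horner _ _))).
transitivity (C * \int[mu]_(x in `[-1, 1]) (pole 0 x * ((W l)^`(l)).[x])).
  rewrite -RintegralZl//; last by have := int 0%N; rewrite subn0.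
  apply: eq_Rintegral => x _.
  by rewrite /legendreP hornerZ /pole expr1 fact0 mul1r /W /C; ring.
rewrite (rodrigues_iter (leqnn l)) subnn mulrA -RintegralZl//; last first.
  by have := int l; rewrite subnn.
apply: eq_Rintegral => x /tx x1; rewrite /pole derivn0 /W horner_exp !hornerE /C.
rewrite exprS !expr_div_n !exprMn exprVn.
have -> : (x ^+ 2 - 1) ^+ l = (-1) ^+ l * (1 - x ^+ 2) ^+ l :> R.
  by rewrite -exprMn mulN1r opprB.
have e1 : (-1) ^+ l * (-1) ^+ l = 1 :> R by rewrite -exprMn mulrNN mulr1 expr1n.
transitivity (((-1) ^+ l * (-1) ^+ l) * ((1 - x ^+ 2) ^+ l /
   (2 ^+ l * (t - x) ^+ l) / (t - x))); last by rewrite e1 mul1r.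
move: ((-1) ^+ l) ((1 - x ^+ 2) ^+ l) => s v /=.
have : 2 ^+ l != 0 :> R by rewrite expf_neq0.
by move: (2 ^+ l) (t - x) x1 => a y y0 a0; field; rewrite y0 a0 l0 expf_neq0.
Qed.

End rodrigues.

Section legendre_moments.
Context {R : realType}.
Notation mu := (@lebesgue_measure R).

(** Since (1 - y^2) / (2 (t - y)) <= (1 + y) / 2 <= 1 for t > 1, the l-th power
    in Rodrigues' integrand is bounded by this weight: for every l >= 1 one factor
    (1 + y) / 2 is kept, for l = 0 there is none. This is the whole difference
    between the channel in which Q_0 multiplies the small components and all
    other channels. *)
Definition angular_weight (l : nat) (y : R) : R := if l is 0%N then 1 else (1 + y) / 2.

Lemma angular_weight_itv l (y : R) : -1 <= y -> y <= 1 -> 0 <= angular_weight l y <= 1.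
Proof. by move=> y1 y2; case: l => [|l] /=; apply/andP; split; lra. Qed.

(** Rodrigues' integrand, as a jointly measurable function of (t, y). *)
Let G (l : nat) (q : R * R) : R :=
  2^-1 * (((1 - q.2 ^+ 2) / (2 * (q.1 - q.2))) ^+ l * (q.1 - q.2)^-1).

Let measurable_angular l : measurable_fun [set: R] (angular_weight l).
Proof.
case: l => [|l]; first exact: measurable_cst.
apply: (measurable_funM (f := fun y : R => 1 + y) (g := cst 2^-1)) => //.
exact: measurable_funD.
Qed.

Let measurable_G l : measurable_fun [set: R * R] (G l).
Proof.
have mB : measurable_fun [set: R * R] (fun q : R * R => q.1 - q.2).
  by apply: measurable_funB; [exact: measurable_fst|exact: measurable_snd].
apply: measurable_funM => //; apply: measurable_funM; last exact: measurable_funV.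
apply: measurable_funX; apply: measurable_funM; last first.
  by apply: measurable_funV; apply: measurable_funM.
by apply: measurable_funB => //; apply: measurable_funX; exact: measurable_snd.
Qed.

Let G_itv l (t y : R) : 1 < t -> -1 <= y -> y <= 1 ->
  0 <= G l (t, y) <= 2^-1 * (angular_weight l y * (t - y)^-1).
Proof.
move=> t1 y1 y2; rewrite /G/=.
have ty : 0 < t - y by rewrite subr_gt0 (le_lt_trans y2).
have r0 : 0 <= (1 - y ^+ 2) / (2 * (t - y)).
  by rewrite divr_ge0//; nra.
have r1 : (1 - y ^+ 2) / (2 * (t - y)) <= (1 + y) / 2.
  by rewrite ler_pdivrMr ?mulr_gt0//; nra.
have r2 : (1 + y) / 2 <= 1 by lra.
have ti : 0 <= (t - y)^-1 by rewrite invr_ge0 ltW.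
rewrite !mulr_ge0 ?exprn_ge0//= ler_pM2l ?invr_gt0// ler_wpM2r//.
case: l => [|l] /=; first by rewrite expr0.
by rewrite exprS (le_trans _ r1)// ler_piMr// exprn_ile1// (le_trans r1).
Qed.

Let gfun l (q : R * R) : \bar R :=
  ((fun q => (G l q)%:E) \_ (`]1, +oo[%classic `*` `[-1, 1]%classic)) q.

Let measurable_gfun l : measurable_fun setT (gfun l).
Proof.
apply/(measurable_restrictT _ _).1; first exact: measurableX.
by apply: measurable_funTS; apply/measurable_EFinP; exact: measurable_G.
Qed.

Let gfun_ge0 l q : (0 <= gfun l q)%E.
Proof.
apply: erestrict_ge0 => -[t y]/= []; rewrite !in_itv/= andbT => t1 /andP[y1 y2].
by rewrite lee_fin; have /andP[] := G_itv l t1 y1 y2.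
Qed.

Let integrable_G l (t : R) : 1 < t ->
  mu.-integrable `[-1, 1]%classic (EFin \o (fun y => G l (t, y))).
Proof.
move=> t1.
have tx (x : R) : -1 <= x <= 1 -> t - x != 0.
  by move=> /andP[_ x1]; rewrite gt_eqF// subr_gt0 (le_lt_trans x1).
apply: continuous_compact_integrable; first exact: segment_compact.
apply: continuous_in_subspaceT => x /set_mem /=; rewrite in_itv/= => /tx x1.
have d := derB (der_cst t x) (der_id x).
have d2 := derB (der_cst 1 x) (der_sqr (der_id x)).
have tx2 : 2 * (t - x) != 0 by rewrite mulf_neq0.
rewrite /G; case: l => [|l] /=.
  exact: (der_continuous (derZ 2^-1 (derM (der_cst 1 x) (derV d x1)))).
exact: (der_continuous (derZ 2^-1
  (derM (der_exp l (derM d2 (derV (derZ 2 d) tx2))) (derV d x1)))).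
Qed.

Let legendreQ_G l (t : R) : 1 < t ->
  (legendreQ l t)%:E = (\int[mu]_(y in `[(-1)%R, 1%R]) (G l (t, y))%:E)%E.
Proof.
move=> t1; have iG := integrable_G l t1.
rewrite -[RHS]fineK; last exact: integrable_fin_num.
congr (_%:E); rewrite legendreQ_rodrigues// -RintegralZl//.
rewrite [X in _.-integrable _ X](_ : _ =
  (fun y => 2%:E * (EFin \o (fun y => G l (t, y))) y)%E); first exact: integrableZl.
by apply/funext => y /=; rewrite -EFinM /G/= mulrA divff// mul1r.
Qed.

Let legendreQ_gfun l (t : R) : 1 < t ->
  legendreQ l t = fine (\int[mu]_y gfun l (t, y))%E.
Proof.
move=> t1; rewrite -[LHS]/(fine (_%:E)) legendreQ_G// integral_mkcond.
congr fine; apply: eq_integral => x _.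
rewrite /gfun !patchE; case: ifPn => [|/negP] x1.
  by rewrite ifT// inE; split; [rewrite /= in_itv/= t1|exact: set_mem x1].
by rewrite ifF//; apply/negP; rewrite inE => -[_ /= ?]; apply: x1; rewrite inE.
Qed.

Lemma legendreQ_ge0 l (t : R) : 1 < t -> 0 <= legendreQ l t.
Proof.
by move=> t1; rewrite legendreQ_gfun// fine_ge0// integral_ge0.
Qed.

Lemma legendreQ_le l (t : R) : 1 < t ->
  ((legendreQ l t)%:E <= \int[mu]_(y in `](-1)%R, 1%R[)
    (2^-1 * (angular_weight l y * (t - y)^-1))%:E)%E.
Proof.
move=> t1; rewrite legendreQ_G//.
have mGt : measurable_fun setT (fun y => G l (t, y)).
  by apply: measurableT_comp => //; exact: measurable_pair1.
rewrite integral_itv_bndoo; last first.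
  by apply/measurable_EFinP; exact: measurable_funTS.
apply: ge0_le_integral => //.
- move=> y /=; rewrite in_itv/= => /andP[y1 y2].
  by rewrite lee_fin; have /andP[] := G_itv l t1 (ltW y1) (ltW y2).
- by apply/measurable_EFinP; exact: measurable_funTS.
- apply/measurable_EFinP/measurable_funTS; apply: measurable_funM => //.
  apply: measurable_funM; last by apply: measurable_funV; exact: measurable_funB.
  exact: measurable_angular.
- move=> y /=; rewrite in_itv/= => /andP[y1 y2].
  by rewrite lee_fin; have /andP[] := G_itv l t1 (ltW y1) (ltW y2).
Qed.

(** The kernel depends on the momenta through Q_l of (p'/p + p/p') / 2 only; u is
    the ratio p'/p. *)
Definition ratioQ (l : nat) (u : R) : R :=
  if 0 < u then legendreQ l (2^-1 * (u + u^-1)) else 0.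

Lemma ratioQV l u : ratioQ l u^-1 = ratioQ l u.
Proof. by rewrite /ratioQ invr_gt0 invrK addrC. Qed.

Let arg_gt1 (u : R) : 0 < u -> u != 1 -> 1 < 2^-1 * (u + u^-1).
Proof.
move=> u0 u1; rewrite -subr_gt0.
have -> : 2^-1 * (u + u^-1) - 1 = (u - 1) ^+ 2 / (2 * u).
  by field; rewrite gt_eqF.
apply: divr_gt0; last by rewrite mulr_gt0.
by rewrite exprn_even_gt0//= subr_eq0.
Qed.

Lemma ratioQ_ge0 l u : u != 1 -> 0 <= ratioQ l u.
Proof.
by rewrite /ratioQ; case: ifP => // u0 u1; apply: legendreQ_ge0; exact: arg_gt1.
Qed.

Lemma measurable_ratioQ l : measurable_fun [set: R] (ratioQ l).
Proof.
pose q (t : R) := fine (\int[mu]_y gfun l (t, y))%E.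
have mq : measurable_fun setT q.
  apply: (measurableT_comp (f := fine)); first exact: fine_measurable.
  exact: (@measurable_fun_fubini_tonelli_F _ _ _ _ _ mu (gfun l)  (@measurable_gfun l) (gfun_ge0 l)).
have -> : ratioQ l = fun u => if 0 < u then
    (if u == 1 then legendreQ l (2^-1 * (1 + 1^-1)) else q (2^-1 * (u + u^-1))) else 0.
  apply/funext => u; rewrite /ratioQ; case: ifP => // u0.
  by case: eqVneq => [->//|u1]; rewrite legendreQ_gfun//; exact: arg_gt1.
apply: measurable_fun_ifT => //; first exact: measurable_fun_ltr.
apply: measurable_fun_ifT => //; first exact: measurable_fun_eqr.
apply: measurableT_comp => //; apply: measurable_funM => //.
by apply: measurable_funD => //; exact: measurable_inv.
Qed.

(** The bounds 2 pi and 4 pi / 3 for Mellin-type moments of Q_0 and of Q_l,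
    l >= 1. *)
Definition momentQ (l : nat) : R := if l is 0%N then 2 * pi else 4 / 3 * pi.

Lemma momentQ_gt0 l : 0 < momentQ l.
Proof. by have := pi_gt0 R; case: l => [|l] /= *; lra. Qed.

Let kern (e : R) (q : R * R) : R :=
  ((q.1 + 1) + e * (q.1 - 1)) /
     (2 * Num.sqrt q.1 * (q.1 ^+ 2 - 2 * q.1 * q.2 + 1)).

Let measurable_kern e : measurable_fun [set: R * R] (kern e).
Proof.
have m1 : measurable_fun [set: R * R] (fun q : R * R => q.1) by exact: measurable_fst.
have m2 : measurable_fun [set: R * R] (fun q : R * R => q.2) by exact: measurable_snd.
apply: measurable_funM.
  apply: measurable_funD; first exact: measurable_funD.
  by apply: measurable_funM => //; exact: measurable_funB.
apply: measurable_funV; apply: measurable_funM.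
  by apply: measurable_funM => //; exact: measurable_sqrt.
apply: measurable_funD => //; apply: measurable_funB; first exact: measurable_funX.
by apply: measurable_funM => //; exact: measurable_funM.
Qed.

(** Inserting the integral bound on Q_l and exchanging the integrations, the
    integral over u is a moment of the Poisson-type kernel because
    1 / (2 ((u + 1/u) / 2 - y)) = u / (u^2 - 2 u y + 1). The weight
    (u + 1 + e (u - 1)) / (2 u sqrt u) interpolates between u^(-3/2) for e = -1
    and u^(-1/2) for e = 1; the bound is uniform in e. *)
Lemma ratioQ_moment_le l (e : R) : -1 <= e <= 1 ->
  (\int[mu]_(u in `]0%R, +oo[) (ratioQ l u *
     (((u + 1) + e * (u - 1)) / (2 * u * Num.sqrt u)))%:E <= (momentQ l)%:E)%E.
Proof.
move=> e1.
pose D := `]0, +oo[%classic : set R.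
pose I := `]-1, 1[%classic : set R.
have mD : measurable D by exact: measurable_itv.
have mI : measurable I by exact: measurable_itv.
pose h (q : R * R) := (angular_weight l q.2 * kern e q)%:E.
have mh : measurable_fun setT h.
  apply/measurable_EFinP; apply: measurable_funM => //.
  by apply: measurableT_comp => //; exact: measurable_snd.
pose hh q := (h \_ (D `*` I)) q.
have h0 u y : D u -> I y -> (0 <= h (u, y))%E.
  rewrite /D /I /= !in_itv/= andbT => u0 /andP[y1 y2].
  have /andP[a0 _] := angular_weight_itv l (ltW y1) (ltW y2).
  rewrite lee_fin mulr_ge0// /kern/= divr_ge0//; first by nra.
  by rewrite !mulr_ge0 ?sqrtr_ge0// ltW// denom_gt0.
have hh0 q : (0 <= hh q)%E by apply: erestrict_ge0 => -[u y] [/= ? ?]; exact: h0.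
have mhh : measurable_fun setT hh.
  apply/(measurable_restrictT _ _).1; first exact: measurableX.
  exact: measurable_funTS.
have row u : D u -> (\int[mu]_y hh (u, y) = \int[mu]_(y in I) h (u, y))%E.
  move=> Du; rewrite [RHS]integral_mkcond; apply: eq_integral => y _.
  rewrite /hh !patchE; congr (if _ then _ else _).
  by apply/idP/idP => [/set_mem[_ /=]|/set_mem ?]; rewrite inE.
have row0 u : ~ D u -> (\int[mu]_y hh (u, y) = 0)%E.
  move=> Du; rewrite integral0_eq// => y _.
  by rewrite /hh !patchE ifF//; apply/negP => /set_mem[].
have col y : I y -> (\int[mu]_u hh (u, y) = \int[mu]_(u in D) h (u, y))%E.
  move=> Iy; rewrite [RHS]integral_mkcond; apply: eq_integral => u _.
  rewrite /hh !patchE; congr (if _ then _ else _).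
  by apply/idP/idP => [/set_mem[/= ? _]|/set_mem ?]; rewrite inE.
have col0 y : ~ I y -> (\int[mu]_u hh (u, y) = 0)%E.
  move=> Iy; rewrite integral0_eq// => u _.
  by rewrite /hh !patchE ifF//; apply/negP => /set_mem[].
have mw : measurable_fun setT (fun u : R => ratioQ l u *
     (((u + 1) + e * (u - 1)) / (2 * u * Num.sqrt u))).
  apply: measurable_funM; first exact: measurable_ratioQ.
  apply: measurable_funM.
    apply: measurable_funD; first exact: measurable_funD.
    by apply: measurable_funM => //; exact: measurable_funB.
  apply: measurable_funV; apply: measurable_funM; first exact: measurable_funM.
  exact: measurable_sqrt.
(* at u = 1 the argument of Q_l is 1, the endpoint of its domain *)
rewrite -(@integral_setD1 _ _ 1)//; last 2 first.
- exact: measurableD.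
- by apply/measurable_EFinP; exact: measurable_funTS.
apply: (@le_trans _ _ (\int[mu]_(u in D) \int[mu]_y hh (u, y))%E).
  pose D1 : set R := D `\ 1.
  have mD1 : measurable D1 by exact: measurableD.
  rewrite -/D -/D1.
  apply: (@le_trans _ _ (\int[mu]_(u in D1) \int[mu]_y hh (u, y))%E); last first.
    apply: ge0_subset_integral => //.
    - by apply: measurable_funTS; exact: (@measurable_fun_fubini_tonelli_F _ _ _ _ _ mu _ mhh hh0).
    - by move=> u _; exact: integral_ge0.
    - by move=> u [].
  apply: ge0_le_integral.
  - exact: mD1.
  - move=> u [Du /= /eqP u1]; have u0 : 0 < u by move: Du; rewrite /D/= in_itv/= andbT.
    rewrite lee_fin mulr_ge0 ?ratioQ_ge0// divr_ge0//; first by nra.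
    by rewrite !mulr_ge0 ?sqrtr_ge0// ltW.
  - by apply/measurable_EFinP; exact: measurable_funTS.
  - by apply: measurable_funTS; exact: (@measurable_fun_fubini_tonelli_F _ _ _ _ _ mu _ mhh hh0).
  - move=> u [Du /= /eqP u1]; have u0 : 0 < u by move: Du; rewrite /D/= in_itv/= andbT.
    rewrite row// /ratioQ u0 mulrC.
    set c := (_ / _ : R).
    have c0 : 0 <= c.
      by rewrite divr_ge0 ?mulr_ge0 ?sqrtr_ge0 ?ltW//; nra.
    rewrite EFinM (le_trans (lee_wpmul2l _ (legendreQ_le l (arg_gt1 u0 u1))))//.
    rewrite -ge0_integralZl//; last 2 first.
    + apply/measurable_EFinP/measurable_funTS; apply: measurable_funM => //.
      apply: measurable_funM; first exact: measurable_angular.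
      by apply: measurable_funV; exact: measurable_funB.
    + move=> y; rewrite /= in_itv/= => /andP[y1 y2].
      have /andP[a0 _] := angular_weight_itv l (ltW y1) (ltW y2).
      rewrite lee_fin !mulr_ge0// invr_ge0 subr_ge0 ltW//.
      by rewrite (lt_trans y2)// arg_gt1.
    rewrite le_eqVlt; apply/orP; left; apply/eqP; apply: eq_integral => y.
    rewrite inE /= in_itv/= => /andP[y1 y2].
    rewrite /h -EFinM /kern/= /c; congr (_%:E).
    have v0 : 0 < Num.sqrt u by rewrite sqrtr_gt0.
    have d0 := denom_gt0 u y1 y2.
    have -> : 2^-1 * (u + u^-1) - y = (u ^+ 2 - 2 * u * y + 1) / (2 * u).
      by field; rewrite gt_eqF.
    by field; rewrite !gt_eqF.
have -> : (\int[mu]_(u in D) \int[mu]_y hh (u, y) = \int[mu]_u \int[mu]_y hh (u, y))%E.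
  rewrite integral_mkcond; apply: eq_integral => u _; rewrite patchE.
  by case: ifPn => // /negP Du; rewrite row0// => ?; apply: Du; rewrite inE.
rewrite (fubini_tonelli (m1 := mu) (m2 := mu))//.
have -> : (\int[mu]_y \int[mu]_u hh (u, y) =
   \int[mu]_(y in I) \int[mu]_(u in D) h (u, y))%E.
  rewrite [RHS]integral_mkcond; apply: eq_integral => y _; rewrite patchE.
  by case: ifPn => [/set_mem Iy|/negP Iy]; [rewrite col|rewrite col0// => ?; apply: Iy; rewrite inE].
apply: (@le_trans _ _ (\int[mu]_(y in I)
   (angular_weight l y * (pi / Num.sqrt (2 - 2 * y)))%:E)%E); last first.
  case: (l) => [|l'] /=; last exact: angular_integral_weighted_le.
  by under eq_integral do rewrite mul1r; exact: angular_integral_le.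
apply: ge0_le_integral => //.
- by move=> y Iy; apply: integral_ge0 => u Du; exact: h0.
- apply: (eq_measurable_fun (fun y => \int[mu]_u hh (u, y))%E).
    by move=> y /set_mem Iy; rewrite col.
  by apply: measurable_funTS; exact: (@measurable_fun_fubini_tonelli_G _ _ _ _ _ mu _ mhh hh0).
- apply/measurable_EFinP/measurable_funTS.
  apply: measurable_funM; first exact: measurable_angular.
  apply: measurable_funM => //; apply: measurable_funV; apply: measurable_sqrt.
  by apply: measurable_funB => //; exact: measurable_funM.
- move=> y Iy; have [y1 y2] : -1 < y /\ y < 1 by move: Iy; rewrite /I/= in_itv/= => /andP.
  have /andP[a0 _] := angular_weight_itv l (ltW y1) (ltW y2).
  have -> : (\int[mu]_(u in D) h (u, y) =
      \int[mu]_(u in D) ((angular_weight l y)%:E * (kern e (u, y))%:E))%E.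
    by apply: eq_integral => u _; rewrite -EFinM.
  rewrite ge0_integralZl//; last 2 first.
  + apply/measurable_EFinP/measurable_funTS.
    by apply: (@measurableT_comp _ _ _ _ _ _ (kern e)) => //; exact: measurable_pair2.
  + move=> u; rewrite /D/= in_itv/= andbT => u0; rewrite lee_fin /kern/= divr_ge0//.
      by nra.
    by rewrite !mulr_ge0 ?sqrtr_ge0// ltW// denom_gt0.
  by rewrite EFinM lee_wpmul2l// moment_le.
Qed.

End legendre_moments.

(** * Schur tests for kernels depending on the ratio of the momenta *)
Section schur_test.
Context {R : realType}.
Notation mu := (@lebesgue_measure R).
Notation mu2 := (mu \x mu)%E.

(** Young's inequality |u v| <= (w u^2 + v^2 / w) / 2, followed by the integration
    of M w over rows and of M / w over columns. *)
Lemma schur_test (M w : R * R -> R) (u v r c : R -> R) :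
  measurable_fun setT M -> measurable_fun setT w ->
  measurable_fun setT u -> measurable_fun setT v ->
  measurable_fun setT r -> measurable_fun setT c ->
  (forall q, 0 <= M q) -> (forall q, 0 <= w q) ->
  (forall p, 0 <= r p) -> (forall q, 0 <= c q) ->
  (forall p q, u p != 0 -> v q != 0 -> 0 < w (p, q)) ->
  (forall p, u p != 0 -> (\int[mu]_q (M (p, q) * w (p, q))%:E <= (r p)%:E)%E) ->
  (forall q, v q != 0 -> (\int[mu]_p (M (p, q) * (w (p, q))^-1)%:E <= (c q)%:E)%E) ->
  (\int[mu2]_q (M q * `|u q.1| * `|v q.2|)%:E <=
   2^-1%:E * (\int[mu]_p (r p * u p ^+ 2)%:E + \int[mu]_q (c q * v q ^+ 2)%:E))%E.
Proof.
move=> mM mw mU mV mr mc M0 w0 r0 c0 wpos row col.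
have m1 : measurable_fun [set: R * R] (fun q : R * R => q.1) by exact: measurable_fst.
have m2 : measurable_fun [set: R * R] (fun q : R * R => q.2) by exact: measurable_snd.
have mU1 : measurable_fun [set: R * R] (fun q : R * R => u q.1) by exact: measurableT_comp.
have mV2 : measurable_fun [set: R * R] (fun q : R * R => v q.2) by exact: measurableT_comp.
pose F1 (q : R * R) := (M q * w q * u q.1 ^+ 2)%:E.
pose F2 (q : R * R) := (M q * (w q)^-1 * v q.2 ^+ 2)%:E.
have mF1 : measurable_fun setT F1.
  apply/measurable_EFinP; apply: measurable_funM; last exact: measurable_funX.
  exact: measurable_funM.
have mF2 : measurable_fun setT F2.
  apply/measurable_EFinP; apply: measurable_funM; last exact: measurable_funX.
  by apply: measurable_funM => //; exact: measurable_funV.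
have F10 q : (0 <= F1 q)%E by rewrite lee_fin mulr_ge0 ?sqr_ge0 ?mulr_ge0.
have F20 q : (0 <= F2 q)%E by rewrite lee_fin mulr_ge0 ?sqr_ge0 ?mulr_ge0 ?invr_ge0.
apply: (@le_trans _ _ (\int[mu2]_q (2^-1%:E * (F1 q + F2 q)))%E).
  apply: ge0_le_integral => //.
  - by move=> q _; rewrite lee_fin !mulr_ge0.
  - apply/measurable_EFinP; apply: measurable_funM; last exact: measurableT_comp.
    by apply: measurable_funM => //; exact: measurableT_comp.
  - by apply: emeasurable_funM => //; exact: emeasurable_funD.
  - move=> q _; rewrite /F1 /F2 -EFinD -EFinM lee_fin.
    have [u0|u0] := eqVneq (u q.1) 0.
      rewrite u0 normr0 mulr0 mul0r mulr_ge0// addr_ge0//.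
        by rewrite expr0n mulr0.
      by rewrite mulr_ge0 ?sqr_ge0 ?mulr_ge0 ?invr_ge0.
    have [v0|v0] := eqVneq (v q.2) 0.
      rewrite v0 normr0 mulr0 mulr_ge0// addr_ge0//.
        by rewrite mulr_ge0 ?sqr_ge0 ?mulr_ge0.
      by rewrite expr0n mulr0.
    have wq : 0 < w q by have := wpos _ _ u0 v0; rewrite -surjective_pairing.
    rewrite -!mulrA -mulrDr [leRHS]mulrCA ler_wpM2l//.
    rewrite -(real_normK (num_real (u q.1))) -(real_normK (num_real (v q.2))).
    rewrite -subr_ge0.
    set a := `|u q.1|; set b := `|v q.2|.
    have -> : 2^-1 * (w q * a ^+ 2 + (w q)^-1 * b ^+ 2) - a * b =
      (w q * a - b) ^+ 2 / (2 * w q) by field; rewrite gt_eqF.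
    by rewrite divr_ge0 ?sqr_ge0// mulr_ge0// ltW.
rewrite ge0_integralZl//; last 2 first.
- exact: emeasurable_funD.
- by move=> q _; exact: adde_ge0.
rewrite lee_wpmul2l// ge0_integralD//; apply: leeD.
- rewrite fubini_tonelli1// /fubini_F; apply: ge0_le_integral => //.
  + by move=> p _; exact: integral_ge0.
  + exact: (@measurable_fun_fubini_tonelli_F _ _ _ _ _ mu _ mF1 F10).
  + by apply/measurable_EFinP/measurable_funM => //; exact: measurable_funX.
  + move=> p _; rewrite /F1/=.
    have [u0|u0] := eqVneq (u p) 0.
      by rewrite u0 expr0n/= mulr0; under eq_integral do rewrite mulr0; rewrite integral0.
    rewrite (_ : (\int[mu]_y _)%E = ((u p ^+ 2)%:E * \int[mu]_q (M (p, q) * w (p, q))%:E)%E).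
      rewrite [leRHS](_ : _ = ((u p ^+ 2)%:E * (r p)%:E)%E); last by rewrite -EFinM mulrC.
      by rewrite lee_wpmul2l ?lee_fin ?sqr_ge0// row.
    rewrite -ge0_integralZl//.
    * by apply: eq_integral => y _; rewrite -EFinM mulrC.
    * apply/measurable_EFinP/measurable_funM; apply: measurableT_comp => //; exact: measurable_pair1.
    * by move=> y _; rewrite lee_fin mulr_ge0.
    * by rewrite lee_fin sqr_ge0.
- rewrite fubini_tonelli2// /fubini_G; apply: ge0_le_integral => //.
  + by move=> p _; exact: integral_ge0.
  + exact: (@measurable_fun_fubini_tonelli_G _ _ _ _ _ mu _ mF2 F20).
  + by apply/measurable_EFinP/measurable_funM => //; exact: measurable_funX.
  + move=> p _; rewrite /F2/=.
    have [u0|u0] := eqVneq (v p) 0.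
      by rewrite u0 expr0n/= mulr0; under eq_integral do rewrite mulr0; rewrite integral0.
    rewrite (_ : (\int[mu]_y _)%E = ((v p ^+ 2)%:E * \int[mu]_q (M (q, p) * (w (q, p))^-1)%:E)%E).
      rewrite [leRHS](_ : _ = ((v p ^+ 2)%:E * (c p)%:E)%E); last by rewrite -EFinM mulrC.
      by rewrite lee_wpmul2l ?lee_fin ?sqr_ge0// col.
    rewrite -ge0_integralZl//.
    * by apply: eq_integral => y _; rewrite -EFinM mulrC.
    * apply/measurable_EFinP/measurable_funM.
        by apply: measurableT_comp => //; exact: measurable_pair2.
      by apply: measurable_funV; apply: measurableT_comp => //; exact: measurable_pair2.
    * by move=> y _; rewrite lee_fin mulr_ge0// invr_ge0.
    * by rewrite lee_fin sqr_ge0.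
Qed.

End schur_test.

Section energy_bounds.
Context {R : realType}.
Variables (c e0 : R).
Hypotheses (c0 : 0 < c) (e00 : 0 < e0).

Definition en (p : R) : R := Num.sqrt (c ^+ 2 * p ^+ 2 + e0 ^+ 2).

Lemma en_sqr p : en p ^+ 2 = c ^+ 2 * p ^+ 2 + e0 ^+ 2.
Proof.
by rewrite sqr_sqrtr//; apply: addr_ge0; rewrite ?sqr_ge0// -exprMn sqr_ge0.
Qed.

Lemma en_gt0 p : 0 < en p.
Proof.
by rewrite sqrtr_gt0 ltr_wpDl ?exprn_gt0// -exprMn sqr_ge0.
Qed.

Lemma en_ge p : e0 <= en p.
Proof.
rewrite -[leLHS]gtr0_norm// -sqrtr_sqr ler_wsqrtr// lerDr.
by rewrite -exprMn sqr_ge0.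
Qed.

Lemma le_en p : 0 <= p -> c * p <= en p.
Proof.
move=> p0; rewrite -[leLHS]ger0_norm; last by rewrite mulr_ge0// ltW.
by rewrite -sqrtr_sqr ler_wsqrtr// exprMn lerDl sqr_ge0.
Qed.

Lemma measurable_en : measurable_fun [set: R] en.
Proof.
by apply: measurable_sqrt; apply: measurable_funD => //; apply: measurable_funM.
Qed.

(** The graph of u |-> u / en (p u) lies below its tangent at u = 1, the slope of
    which involves (e0 / en p)^2. The tangent makes the Schur row integral of the
    kernel with the factor 1 / en q computable by moments that are linear
    in u. *)
Lemma en_tangent (p u : R) : 0 < p -> 0 < u ->
  u / en (p * u) <= (1 + (e0 / en p) ^+ 2 * (u - 1)) / en p.
Proof.
move=> p0 u0.
have E1 := en_gt0 p; have E2 := en_gt0 (p * u).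
have s1 := en_sqr p; have s2 := en_sqr (p * u).
have -> : (1 + (e0 / en p) ^+ 2 * (u - 1)) / en p =
  (en p ^+ 2 + e0 ^+ 2 * (u - 1)) / en p ^+ 3 by field; rewrite gt_eqF.
rewrite ler_pdivrMr// mulrAC ler_pdivlMr ?exprn_gt0//.
set s := c ^+ 2 * p ^+ 2 in s1; set d := e0 ^+ 2 in s1 *.
have s_ge0 : 0 <= s by rewrite /s -exprMn sqr_ge0.
have d_gt0 : 0 < d by rewrite exprn_gt0.
have s2' : en (p * u) ^+ 2 = u ^+ 2 * s + d by rewrite s2 /s /d; ring.
have f0 : 0 <= en p ^+ 2 + d * (u - 1) by rewrite s1; nra.
rewrite -ler_sqr ?nnegrE; last 2 first.
- by rewrite mulr_ge0 ?exprn_ge0// ltW.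
- by rewrite mulr_ge0// ltW.
have -> : (u * en p ^+ 3) ^+ 2 = u ^+ 2 * (en p ^+ 2) ^+ 3 by ring.
rewrite [leRHS]exprMn s2' s1 -subr_ge0.
have -> : (s + d + d * (u - 1)) ^+ 2 * (u ^+ 2 * s + d) - u ^+ 2 * (s + d) ^+ 3 =
  s * d * (u - 1) ^+ 2 * (s * (2 * u + 1) + d * u * (u + 2)) by ring.
have A : 0 <= s * (2 * u + 1) by apply: mulr_ge0 => //; lra.
have B : 0 <= d * u * (u + 2) by apply: mulr_ge0; [rewrite mulr_ge0 ?ltW|lra].
apply: mulr_ge0; last exact: addr_ge0.
by apply: mulr_ge0; rewrite ?sqr_ge0// mulr_ge0// ltW.
Qed.

End energy_bounds.

Section ratio_schur.
Context {R : realType}.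
Notation mu := (@lebesgue_measure R).
Notation mu2 := (mu \x mu)%E.
Variables (c e0 kappa : R) (a : R -> R).
Hypotheses (c0 : 0 < c) (e00 : 0 < e0).
Hypothesis ma : measurable_fun [set: R] a.
Hypothesis aV : forall u, a u^-1 = a u.
Hypothesis a_neg : forall u, u <= 0 -> a u = 0.
Hypothesis moment : forall e : R, -1 <= e <= 1 ->
  (\int[mu]_u (`|a u| * (((u + 1) + e * (u - 1)) / (2 * u * Num.sqrt u)))%:E
     <= kappa%:E)%E.
Hypothesis kappa0 : 0 <= kappa.
Local Notation E := (en c e0).

Let measurable_ratio : measurable_fun [set: R * R] (fun q : R * R => q.2 / q.1).
Proof.
apply: measurable_funM; first exact: measurable_snd.
by apply: measurable_funV; exact: measurable_fst.
Qed.

Lemma measurable_ratio_kernel : measurable_fun [set: R * R] (fun q : R * R => a (q.2 / q.1)).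
Proof. exact: measurableT_comp ma measurable_ratio. Qed.

Let wt (e u : R) := ((u + 1) + e * (u - 1)) / (2 * u * Num.sqrt u).

Let measurable_wt e : measurable_fun [set: R] (wt e).
Proof.
apply: measurable_funM.
  apply: measurable_funD; first exact: measurable_funD.
  by apply: measurable_funM => //; exact: measurable_funB.
apply: measurable_funV; apply: measurable_funM; first exact: measurable_funM.
exact: measurable_sqrt.
Qed.

(** The substitution q = p u turns a row integral into a moment of a. *)
Lemma ratio_row_le (p K e : R) (phi : R -> R) : 0 < p -> 0 <= K -> -1 <= e <= 1 ->
  measurable_fun setT phi -> (forall q, 0 <= phi q) ->
  (forall u, 0 < u -> phi (p * u) <= K * wt e u) ->
  (\int[mu]_q (`|a (q / p)| * phi q)%:E <= (p * K * kappa)%:E)%E.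
Proof.
move=> p0 K0 e1 mphi phi0 H.
have mg : measurable_fun setT (fun q : R => `|a (q / p)| * phi q).
  apply: measurable_funM => //; apply: measurableT_comp => //.
  by apply: measurableT_comp ma _; exact: measurable_funM.
have g0 (q : R) : 0 <= `|a (q / p)| * phi q by rewrite mulr_ge0.
have D : (\int[mu]_q (`|a (q / p)| * phi q)%:E =
    p%:E * \int[mu]_u (`|a (p * u / p)| * phi (p * u))%:E)%E.
  rewrite (@ge0_integral_dilation R p (fun q : R => (`|a (q / p)| * phi q)%:E))//.
    by rewrite muleA -EFinM divff ?gt_eqF// mul1e.
  exact/measurable_EFinP.
rewrite D -mulrA EFinM; apply: lee_wpmul2l; first by rewrite lee_fin ltW.
  apply: (@le_trans _ _ (\int[mu]_u (K%:E * (`|a u| * wt e u)%:E))%E).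
    apply: ge0_le_integral => //.
    + by move=> u _; rewrite lee_fin mulr_ge0.
    + by apply/measurable_EFinP; apply: (measurableT_comp (f := fun q : R => `|a (q / p)| * phi q) (g := *%R p)) => //.
    + apply: emeasurable_funM => //; apply/measurable_EFinP; apply: measurable_funM => //.
        exact: measurableT_comp.
      exact: measurable_wt.
    + move=> u _; rewrite -EFinM lee_fin.
      have -> : p * u / p = u by field; rewrite gt_eqF.
      have [u0|u0] := leP u 0; first by rewrite a_neg// normr0 !mul0r mulr0.
      by rewrite mulrCA ler_wpM2l// H.
  rewrite ge0_integralZl//.
  + by rewrite EFinM lee_wpmul2l ?lee_fin// moment.
  + apply/measurable_EFinP; apply: measurable_funM; last exact: measurable_wt.
    exact: measurableT_comp.
  + move=> u _; rewrite lee_fin.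
    have [u0|u0] := leP u 0; first by rewrite a_neg// normr0 mul0r.
    rewrite mulr_ge0// divr_ge0//; first by nra.
    by rewrite !mulr_ge0 ?sqrtr_ge0// ltW.
Qed.

(** The Schur weight p / q suffices here: it is bounded by the moment weight with
    e = 0, and it makes the potential form finite on the form domain. *)
Lemma schur_momentum (u v : R -> R) :
  measurable_fun setT u -> measurable_fun setT v ->
  (forall p, p <= 0 -> u p = 0) -> (forall p, p <= 0 -> v p = 0) ->
  (\int[mu2]_q (`|a (q.2 / q.1)| * `|u q.1| * `|v q.2|)%:E <=
   2^-1%:E * (\int[mu]_p (`|p| * kappa * u p ^+ 2)%:E +
              \int[mu]_q (`|q| * kappa * v q ^+ 2)%:E))%E.
Proof.
move=> mu_ mv un vn.
have pos (f : R -> R) (p : R) : (forall p, p <= 0 -> f p = 0) -> f p != 0 -> 0 < p.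
  by move=> fn; apply: contraNT; rewrite -leNgt => /fn ->.
have wtle (u' : R) : 0 < u' -> u'^-1 <= 1 * wt 0 u'.
  move=> u0; rewrite mul1r /wt mul0r addr0.
  have [s s0 ->] : exists2 s : R, 0 < s & u' = s ^+ 2.
    by exists (Num.sqrt u'); rewrite ?sqrtr_gt0 ?sqr_sqrtr// ltW.
  rewrite sqrtr_sqr gtr0_norm//.
  have -> : (s ^+ 2)^-1 = (2 * s) / (2 * s ^+ 2 * s) by field; rewrite gt_eqF.
  rewrite ler_wpM2r//; last by have := sqr_ge0 (s - 1); nra.
  by rewrite invr_ge0 mulr_ge0 ?(ltW s0)// mulr_ge0 ?sqr_ge0.
apply: (@schur_test R (fun q => `|a (q.2 / q.1)|) (fun q => `|q.1 / q.2|)) => //.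
- by apply: measurableT_comp => //; exact: measurable_ratio_kernel.
- apply: measurableT_comp => //; apply: measurable_funM; first exact: measurable_fst.
  by apply: measurable_funV; exact: measurable_snd.
- by apply: measurable_funM => //; exact: measurableT_comp.
- by apply: measurable_funM => //; exact: measurableT_comp.
- by move=> p; rewrite mulr_ge0.
- by move=> p; rewrite mulr_ge0.
- move=> p q /(pos _ _ un) p0 /(pos _ _ vn) q0 /=.
  by rewrite normr_gt0 gt_eqF// divr_gt0.
- move=> p /(pos _ _ un) p0 /=; rewrite gtr0_norm//.
  rewrite -[p in leRHS]mulr1; apply: (@ratio_row_le p 1 0) => //; first by lra.
    apply: measurableT_comp => //; apply: measurable_funM => //; exact: measurable_inv.
  move=> u' u0; have -> : p / (p * u') = u'^-1 by field; rewrite !gt_eqF.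
  by rewrite gtr0_norm ?invr_gt0// wtle.
- move=> p /(pos _ _ vn) p0 /=; rewrite gtr0_norm//.
  under eq_integral do rewrite -aV invf_div -normfV invf_div.
  rewrite -[p in leRHS]mulr1; apply: (@ratio_row_le p 1 0) => //; first by lra.
    apply: measurableT_comp => //; apply: measurable_funM => //; exact: measurable_inv.
  move=> u' u0; have -> : p / (p * u') = u'^-1 by field; rewrite !gt_eqF.
  by rewrite gtr0_norm ?invr_gt0// wtle.
Qed.

(** With the Schur weight sqrt (p / q) and the tangent bound, a row of
    (1 / E p + 1 / E q) a is at most 2 kappa p / E p. The sharp constant matters:
    this is the estimate that decides the positivity at the end. *)
Lemma schur_energy (u v : R -> R) :
  measurable_fun setT u -> measurable_fun setT v ->
  (forall p, p <= 0 -> u p = 0) -> (forall p, p <= 0 -> v p = 0) ->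
  (\int[mu2]_q (((E q.1)^-1 + (E q.2)^-1) * `|a (q.2 / q.1)| * `|u q.1| * `|v q.2|)%:E <=
   2^-1%:E * (\int[mu]_p (`|p| * (2 / E p) * kappa * u p ^+ 2)%:E +
              \int[mu]_q (`|q| * (2 / E q) * kappa * v q ^+ 2)%:E))%E.
Proof.
move=> mu_ mv un vn.
have pos (f : R -> R) (p : R) : (forall p, p <= 0 -> f p = 0) -> f p != 0 -> 0 < p.
  by move=> fn; apply: contraNT; rewrite -leNgt => /fn ->.
have Ei0 p : 0 < (E p)^-1 by rewrite invr_gt0 en_gt0.
have mEi : measurable_fun setT (fun p => (E p)^-1).
  by apply: measurable_funV; exact: measurable_en.
have mr : measurable_fun setT (fun p : R => `|p| * (2 / E p) * kappa).
  apply: (measurable_funM (f := fun p : R => `|p| * (2 / E p)) (g := cst kappa)) => //.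
  apply: (measurable_funM (f := fun p : R => `|p|)); first exact: measurableT_comp.
  exact: measurable_funM.
have row (p : R) : 0 < p ->
  (\int[mu]_q (`|a (q / p)| * (((E p)^-1 + (E q)^-1) * Num.sqrt (p / q)))%:E <=
   (`|p| * (2 / E p) * kappa)%:E)%E.
  move=> p0; rewrite gtr0_norm//.
  have x0 : 0 < e0 / E p by rewrite divr_gt0// en_gt0.
  have x1 : e0 / E p <= 1 by rewrite ler_pdivrMr ?mul1r ?en_gt0 ?en_ge.
  apply: (@ratio_row_le p (2 / E p) ((e0 / E p) ^+ 2)) => //.
  - by rewrite divr_ge0// ltW// en_gt0.
  - by rewrite expr2; nra.
  - apply: measurable_funM; first exact: measurable_funD.
    by apply: measurable_sqrt; apply: measurable_funM => //; exact: measurable_inv.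
  - by move=> q; rewrite mulr_ge0 ?sqrtr_ge0// addr_ge0 ?ltW.
  - move=> u' u0.
    have -> : p / (p * u') = u'^-1 by field; rewrite !gt_eqF.
    have v0 : 0 < Num.sqrt u' by rewrite sqrtr_gt0.
    rewrite sqrtrV; last exact: ltW.
    rewrite /wt.
    have -> : 2 / E p * ((u' + 1 + (e0 / E p) ^+ 2 * (u' - 1)) / (2 * u' * Num.sqrt u')) =
      ((u' / E p + (1 + (e0 / E p) ^+ 2 * (u' - 1)) / E p) / u') * (Num.sqrt u')^-1.
      by field; rewrite !gt_eqF// en_gt0.
    apply: ler_wpM2r; first by rewrite invr_ge0 ltW.
    rewrite ler_pdivlMr// mulrDl.
    by have := en_tangent c e00 p0 u0; lra.
apply: (@schur_test R (fun q => ((E q.1)^-1 + (E q.2)^-1) * `|a (q.2 / q.1)|)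
   (fun q => Num.sqrt (q.1 / q.2))) => //.
- apply: measurable_funM; last by apply: measurableT_comp => //; exact: measurable_ratio_kernel.
  apply: measurable_funD.
    exact: measurableT_comp mEi measurable_fst.
  exact: measurableT_comp mEi measurable_snd.
- apply: measurable_sqrt; apply: measurable_funM; first exact: measurable_fst.
  by apply: measurable_funV; exact: measurable_snd.
- by move=> q; rewrite mulr_ge0// addr_ge0// ltW.
- by move=> p; rewrite !mulr_ge0// ltW.
- by move=> p; rewrite !mulr_ge0// ltW.
- move=> p q /(pos _ _ un) p0 /(pos _ _ vn) q0 /=.
  by rewrite sqrtr_gt0 divr_gt0.
- move=> p /(pos _ _ un) p0 /=.
  under eq_integral => q _ do rewrite [_ * `|_|]mulrC -mulrA.
  exact: row.
- move=> p /(pos _ _ vn) p0 /=.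
  rewrite [leLHS](_ : _ = \int[mu]_q
    (`|a (q / p)| * (((E p)^-1 + (E q)^-1) * Num.sqrt (p / q)))%:E)%E; first exact: row.
  apply: eq_integral => q _; congr (_%:E).
  have -> : a (p / q) = a (q / p) by rewrite -aV invf_div.
  have -> : (Num.sqrt (q / p))^-1 = Num.sqrt (p / q).
    rewrite -[p / q]invf_div; have [qp|qp] := leP 0 (q / p); first by rewrite sqrtrV.
    by rewrite !ler0_sqrtr ?invr0 ?invr_le0 ?ltW.
  by rewrite [_^-1 + _]addrC mulrAC mulrC.
Qed.

End ratio_schur.

(** * Continuity of dilations in L^1 and L^2 *)
Section dilation_continuity.
Context {R : realType}.
Notation mu := (@lebesgue_measure R).

Lemma cvge0_near_lt (u : nat -> \bar R) (e : R) : u @ \oo --> 0%E -> 0 < e ->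
  \forall n \near \oo, (u n < e%:E)%E.
Proof.
move=> /fine_cvgP[ufin uc] e0.
have : \forall n \near \oo, (fine \o u) n < e by exact: (cvgr_lt 0).
by move=> H; near=> n; rewrite -[u n]fineK ?lte_fin; near: n.
Unshelve. all: by end_near. Qed.

Variable l : nat -> R.
Hypotheses (l1 : l @ \oo --> (1 : R)) (l_itv : forall n, 2^-1 <= l n <= 2).

Let l_gt0 n : 0 < l n.
Proof. by have /andP[la _] := l_itv n; rewrite (lt_le_trans _ la)// invr_gt0. Qed.

(** Truncated continuous functions are dense in L^1, and for them the dilations
    converge by dominated convergence except at the two points |x| = N. *)
Let cut (N : R) (k : R -> R) (x : R) : R := if `|x| <= N then k x else 0.

Let cut_cvg (N : R) (k : R -> R) (x : R) : continuous k -> `|x| != N ->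
  cut N k (l n * x) @[n --> \oo] --> cut N k x.
Proof.
move=> ck xN.
have lx : l n * x @[n --> \oo] --> x by rewrite -[X in _ --> X]mul1r; exact: cvgMl.
have nlx : `|l n * x| @[n --> \oo] --> `|x| by exact: cvg_norm.
case: (ltgtP `|x| N) xN => // xN _.
- rewrite {2}/cut ltW//.
  have kx : k (l n * x) @[n --> \oo] --> k x by apply: continuous_cvg; [exact: ck|].
  apply: cvg_trans kx.
  apply: near_eq_cvg; near=> n; rewrite /cut ifT// ltW//.
  by near: n; exact: (cvgr_lt `|x|).
- rewrite {2}/cut leNgt xN/=.
  have c0 : (fun _ : nat => 0 : R) @ \oo --> (0 : R) by exact: cvg_cst.
  apply: cvg_trans c0.
  apply: near_eq_cvg; near=> n.
  have H : N < `|l n * x| by near: n; exact: (cvgr_gt `|x|).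
  by rewrite /cut leNgt H.
Unshelve. all: by end_near. Qed.

Let measurable_cut (N : R) (k : R -> R) : measurable_fun setT k -> measurable_fun setT (cut N k).
Proof.
move=> mk; apply: measurable_fun_ifT => //.
by apply: measurable_fun_ler => //; exact: measurableT_comp.
Qed.

Let dilation_continuity_cut (N : R) (k : R -> R) (e : R) : 0 <= N -> continuous k -> 0 < e ->
  \forall n \near \oo,
    (\int[mu]_x `|cut N k (l n * x) - cut N k x|%:E < e%:E)%E.
Proof.
move=> N0 ck e0.
have mk : measurable_fun setT (cut N k).
  by apply: measurable_cut; exact: continuous_measurable_fun.
have [C kC] : exists C, forall x, `|cut N k x| <= C.
  have NN : - N <= N by lra.
  have ckn : {within `[- N, N]%classic, continuous (fun x => `|k x|)}.
    by apply: continuous_subspaceT => x; apply: cvg_norm; exact: ck.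
  have [c _ cmax] := EVT_max NN ckn.
  exists (Num.max 0 `|k c|) => x; rewrite /cut; case: ifP => [xN|_].
    by rewrite le_max cmax ?orbT// in_itv/= -ler_norml.
  by rewrite normr0 le_max lexx.
have C0 : 0 <= C by exact: le_trans (normr_ge0 _) (kC 0).
pose f_ n (x : R) := (`|cut N k (l n * x) - cut N k x|)%:E.
pose g (x : R) := ((2 * C)%:E * (\1_(`[- (2 * N), 2 * N]%classic : set R) x)%:E)%E.
have mf n : measurable_fun setT (f_ n).
  apply/measurable_EFinP; apply: measurableT_comp => //; apply: measurable_funB => //.
  by apply: (measurableT_comp mk); exact: mulrl_measurable.
have [] := @dominated_convergence _ _ R mu setT measurableT f_ (cst 0%E) g mf.
- exact: measurable_cst.
- exists ([set N] `|` [set - N]); split.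
  + exact: measurableU.
  + apply: null_set_setU; last 2 first.
    * exact: lebesgue_measure_set1.
    * exact: lebesgue_measure_set1.
    * exact: measurable_set1.
    * exact: measurable_set1.
  + move=> x /= xx; apply: contrapT => /(proj1 (not_orP _ _))[xN xNN]; apply: xx => _.
    have xN' : `|x| != N.
      apply/eqP => xE; have [x0|x0] := leP 0 x.
        by apply: xN; rewrite -xE ger0_norm.
      by apply: xNN; rewrite -xE ltr0_norm// opprK.
    apply: cvg_EFin; first by apply: nearW.
    have := cut_cvg ck xN' => H.
    rewrite -[X in _ --> X](normr0 R); apply: cvg_norm.
    by rewrite -(subrr (cut N k x)); apply: cvgB => //; exact: cvg_cst.
- by apply: integrableZl => //; exact: integrable_indic_itv.
- apply: nearW => x n _; rewrite /f_ /g gee0_abs ?lee_fin// indicE.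
  case: (boolP (x \in _)) => [_|xN].
    rewrite mulr1 (le_trans (ler_normB _ _))// mulr2n mulrDl mul1r lerD//.
  have x2 : 2 * N < `|x|.
    rewrite ltNge; apply: contra xN => x2; rewrite inE/= in_itv/= -ler_norml//.
  have xx : `|x| <= N = false by apply/negbTE; rewrite -ltNge; lra.
  have /andP[la lb] := l_itv n.
  have lx : `|l n * x| <= N = false.
    apply/negbTE; rewrite -ltNge normrM gtr0_norm//; nra.
  by rewrite mulr0 /cut xx lx subrr normr0.
move=> _ H _; have {H} := cvge0_near_lt H e0.
apply: filterS => n; apply: le_lt_trans.
rewrite le_eqVlt; apply/orP; left; apply/eqP; apply: eq_integral => x _.
by rewrite /f_ sube0 gee0_abs ?lee_fin.
Unshelve. all: by end_near. Qed.

Let norm_dilation (g : R -> R) n : measurable_fun setT g ->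
  (\int[mu]_x `|g (l n * x)|%:E <= 2%:E * \int[mu]_x `|g x|%:E)%E.
Proof.
move=> mg.
rewrite (@ge0_integral_dilation R (l n) (fun x => `|g x|%:E))//.
- apply: lee_wpmul2r; first exact: integral_ge0.
  have /andP[la _] := l_itv n.
  by rewrite lee_fin -[leRHS]invrK lef_pV2 ?posrE// invr_gt0.
- by apply/measurable_EFinP; exact: measurableT_comp.
Qed.

Let cut_approx (g : R -> R) (e : R) : mu.-integrable setT (EFin \o g) -> 0 < e ->
  exists N k, [/\ 0 <= N, continuous k & (\int[mu]_x `|g x - cut N k x|%:E < e%:E)%E].
Proof.
move=> ig e0; have /integrableP[/measurable_EFinP mg gfin] := ig.
have e20 : 0 < e / 2 by rewrite divr_gt0.
have [N [N0 HN]] : exists N, 0 <= N /\ (\int[mu]_x `|g x - cut N g x|%:E < (e / 2)%:E)%E.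
  pose f_ n (x : R) := (cut n%:R g x)%:E.
  have mf n : measurable_fun setT (f_ n) by apply/measurable_EFinP; exact: measurable_cut.
  have [] := @dominated_convergence _ _ R mu setT measurableT f_ (EFin \o g)
    (fun x => `|g x|%:E)%E mf.
  - exact/measurable_EFinP.
  - apply: nearW => x _; apply: cvg_EFin; first by apply: nearW.
    have cg : (fun _ : nat => g x) @ \oo --> g x by exact: cvg_cst.
    apply: cvg_trans cg; apply: near_eq_cvg; near=> n.
    rewrite /= /cut ifT//; near: n; exact: nbhs_infty_ger.
  - by have := integrable_abse ig.
  - apply: nearW => x n _; rewrite /f_ lee_fin /cut; case: ifP => // _.
    by rewrite normr0.
  move=> _ H _; have {H}[n _ /(_ n (leqnn n)) H] := cvge0_near_lt H e20.
  exists n%:R; split => //; move: H; apply: le_lt_trans.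
  rewrite le_eqVlt; apply/orP; left; apply/eqP; apply: eq_integral => x _.
  by rewrite /f_ -EFinB/= distrC.
pose I := `[- N, N]%classic : set R.
have mI : measurable I by exact: measurable_itv.
have [||k_ [ck _ kc]] := @approximation_continuous_integrable R I g mI.
- have Hm : mu I = _ := lebesgue_measure_itv `[- N, N].
  have H2 : (mu I < +oo)%E by rewrite Hm /=; case: ifP => _; rewrite -?EFinB ltry.
  exact: H2.
- by apply: integrableS ig.
have [n _ /(_ n (leqnn n)) Hk] := cvge0_near_lt kc e20.
exists N, (k_ n); split => //.
have mkn : measurable_fun setT (k_ n) by exact: continuous_measurable_fun.
have -> : e%:E = ((e / 2)%:E + (e / 2)%:E)%E by rewrite -EFinD -splitr.
apply: (@le_lt_trans _ _ (\int[mu]_x (`|g x - cut N g x|%:E + `|cut N g x - cut N (k_ n) x|%:E))%E).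
  apply: ge0_le_integral => //.
  - by apply/measurable_EFinP; apply: measurableT_comp => //; apply: measurable_funB => //; exact: measurable_cut.
  - apply: emeasurable_funD; apply/measurable_EFinP; apply: measurableT_comp => //; apply: measurable_funB => //; exact: measurable_cut.
  - by move=> x _; rewrite -EFinD lee_fin; apply: ler_distD.
rewrite ge0_integralD//; last 2 first.
- by apply/measurable_EFinP; apply: measurableT_comp => //; apply: measurable_funB => //; exact: measurable_cut.
- by apply/measurable_EFinP; apply: measurableT_comp => //; apply: measurable_funB => //; exact: measurable_cut.
apply: lteD => //; apply: le_lt_trans Hk.
rewrite [leRHS]integral_mkcond le_eqVlt; apply/orP; left; apply/eqP.
apply: eq_integral => x _; rewrite patchE /cut.
have -> : (x \in I) = (`|x| <= N) by apply/idP/idP; rewrite inE /I/= in_itv/= ler_norml.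
by case: ifP => _ //; rewrite subrr normr0.
Unshelve. all: by end_near. Qed.

Lemma dilation_continuity_L1 (g : R -> R) (e : R) :
  mu.-integrable setT (EFin \o g) -> 0 < e ->
  \forall n \near \oo, (\int[mu]_x `|g (l n * x) - g x|%:E < e%:E)%E.
Proof.
move=> ig e0; have /integrableP[/measurable_EFinP mg _] := ig.
have e40 : 0 < e / 4 by rewrite divr_gt0.
have [N [k [N0 ck Hk]]] := cut_approx ig e40.
have := dilation_continuity_cut N0 ck e40; apply: filterS => n H.
have mk : measurable_fun setT (cut N k).
  by apply: measurable_cut; exact: continuous_measurable_fun.
have ml (h : R -> R) : measurable_fun setT h -> measurable_fun setT (fun x => h (l n * x)).
  by move=> mh; apply: (measurableT_comp mh); exact: mulrl_measurable.
have md : measurable_fun setT (fun x => g x - cut N k x) by exact: measurable_funB.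
have mn (h : R -> R) : measurable_fun setT h -> measurable_fun setT (fun x => `|h x|%:E).
  by move=> mh; apply/measurable_EFinP; exact: measurableT_comp.
have m1 := mn _ (ml _ md).
have m2 := mn _ (measurable_funB (ml _ mk) mk).
have m3 := mn _ md.
apply: (@le_lt_trans _ _ (\int[mu]_x
   (`|g (l n * x) - cut N k (l n * x)|%:E +
    (`|cut N k (l n * x) - cut N k x|%:E + `|g x - cut N k x|%:E)))%E).
  apply: ge0_le_integral => //.
  - by apply: mn; apply: measurable_funB => //; exact: ml.
  - by apply: emeasurable_funD => //; exact: emeasurable_funD.
  - move=> x _; rewrite -!EFinD lee_fin [`|g x - _|]distrC.
    apply: le_trans (ler_distD (cut N k (l n * x)) _ _) _; rewrite lerD2l.
    exact: ler_distD.
rewrite ge0_integralD//; last 2 first.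
- by move=> x _; rewrite -EFinD lee_fin addr_ge0.
- exact: emeasurable_funD.
rewrite ge0_integralD//.
have H1 := norm_dilation n md.
have -> : e%:E = ((e / 4 + e / 4)%:E + ((e / 4)%:E + (e / 4)%:E))%E.
  by rewrite -!EFinD; congr (_%:E); lra.
apply: lteD.
- apply: le_lt_trans H1 _.
  have -> : (e / 4 + e / 4)%:E = (2%:E * (e / 4)%:E)%E by rewrite -EFinM; congr (_%:E); lra.
  by rewrite lte_pmul2l.
- by apply: lteD.
Qed.

(** The inequality (a - b)^2 <= 2 | a|a| - b|b| | reduces the L^2 statement for f
    to the L^1 statement for f |f|. *)
Lemma dilation_continuity_L2 (f : R -> R) (e : R) :
  measurable_fun setT f -> mu.-integrable setT (EFin \o (fun x => f x ^+ 2)) -> 0 < e ->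
  \forall n \near \oo, (\int[mu]_x ((f (l n * x) - f x) ^+ 2)%:E < e%:E)%E.
Proof.
move=> mf if2 e0.
pose g x := f x * `|f x|.
have mg : measurable_fun setT g by apply: measurable_funM => //; exact: measurableT_comp.
have ig : mu.-integrable setT (EFin \o g).
  apply: le_integrable if2 => //; first exact/measurable_EFinP.
  by move=> x _; rewrite /= lee_fin normrM normr_id -normrM -expr2.
have e20 : 0 < e / 2 by rewrite divr_gt0.
have := dilation_continuity_L1 ig e20; apply: filterS => n H.
have mfl : measurable_fun setT (fun x => f (l n * x)).
  by apply: (measurableT_comp mf); exact: mulrl_measurable.
have mgl : measurable_fun setT (fun x => g (l n * x)).
  by apply: (measurableT_comp mg); exact: mulrl_measurable.
apply: (@le_lt_trans _ _ (\int[mu]_x (2%:E * `|g (l n * x) - g x|%:E))%E).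
  apply: ge0_le_integral => //.
  - by move=> x _; rewrite lee_fin sqr_ge0.
  - by apply/measurable_EFinP; apply: measurable_funX; exact: measurable_funB.
  - by apply: emeasurable_funM => //; apply/measurable_EFinP; apply: measurableT_comp => //; exact: measurable_funB.
  - move=> x _; rewrite -EFinM lee_fin /g.
    move: (f (l n * x)) (f x) => a b.
    have [a0|a0] := leP 0 a; have [b0|b0] := leP 0 b.
    + rewrite (ger0_norm a0) (ger0_norm b0); have [ab|ab] := leP a b.
        by rewrite ler0_norm ?expr2; nra.
      by rewrite ger0_norm ?expr2; nra.
    + by rewrite (ger0_norm a0) (ltr0_norm b0) ger0_norm; have := sqr_ge0 (a + b); rewrite ?expr2; nra.
    + by rewrite (ltr0_norm a0) (ger0_norm b0) ler0_norm; have := sqr_ge0 (a + b); rewrite ?expr2; nra.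
    + rewrite (ltr0_norm a0) (ltr0_norm b0); have [ab|ab] := leP a b.
        by rewrite ler0_norm ?expr2; nra.
      by rewrite ger0_norm ?expr2; nra.
rewrite ge0_integralZl//; last first.
  by apply/measurable_EFinP; apply: measurableT_comp => //; exact: measurable_funB.
by have -> : e%:E = (2%:E * (e / 2)%:E)%E; [rewrite -EFinM mulrC divfK|rewrite lte_pmul2l].
Qed.

End dilation_continuity.

(** * Limits of forms along a dilation *)
Lemma Rintegral_dominated_cvg d (T : measurableType d) (R : realType)
    (m : {measure set T -> \bar R}) (F_ : nat -> T -> R) (F G : T -> R) :
  (forall n, measurable_fun setT (F_ n)) ->
  (forall x, F_ n x @[n --> \oo] --> F x) ->
  m.-integrable setT (EFin \o G) ->
  (forall n x, `|F_ n x| <= G x) ->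
  \int[m]_x F_ n x @[n --> \oo] --> \int[m]_x F x.
Proof.
move=> mF FF iG FG.
have mFl : measurable_fun setT F by exact: (measurable_fun_cvg mF).
have H := @dominated_cvg _ _ R m setT measurableT
  (fun n => EFin \o F_ n) (EFin \o F) (EFin \o G).
have H2 : (\int[m]_x (F_ n x)%:E)%E @[n --> \oo] --> (\int[m]_x (F x)%:E)%E.
  apply: H => //.
  - by move=> n; exact/measurable_EFinP.
  - by move=> x _; apply: cvg_EFin; [exact: nearW|exact: FF].
  - by move=> n x _; rewrite /= lee_fin FG.
have iF : m.-integrable setT (EFin \o F).
  apply: le_integrable iG => //; first exact/measurable_EFinP.
  move=> x _; have G0 : 0 <= G x by exact: le_trans (normr_ge0 _) (FG 0%N x).
  rewrite /= lee_fin [leRHS]ger0_norm//.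
  have c : `|F_ n x| @[n --> \oo] --> `|F x| by apply: cvg_norm; exact: FF.
  rewrite -(cvg_lim _ c)//; apply: limr_le.
    by apply/cvg_ex; eexists; exact: c.
  by apply: nearW => n; exact: FG.
have fF : (\int[m]_x (F x)%:E)%E = (\int[m]_x F x)%:E.
  by rewrite /Rintegral fineK//; exact: integrable_fin_num.
by move: H2; rewrite fF => /fine_cvgP[].
Qed.

(** Two situations are covered at once: an integral in one variable (both
    projections are the identity) and one over pairs of momenta. *)
Section perturb_limit.
Context {R : realType} d (T : measurableType d) (m : {measure set T -> \bar R}).
Notation mu := (@lebesgue_measure R).
Variables (pi1 pi2 : T -> R) (N : T -> R) (kappa : R).
Hypotheses (mpi1 : measurable_fun setT pi1) (mpi2 : measurable_fun setT pi2).
Hypotheses (mN : measurable_fun setT N) (N0 : forall t, 0 <= N t) (kappa0 : 0 <= kappa).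
Hypothesis bound : forall u v : R -> R, measurable_fun setT u -> measurable_fun setT v ->
  (forall p, p <= 0 -> u p = 0) -> (forall p, p <= 0 -> v p = 0) ->
  (\int[m]_t (N t * `|u (pi1 t)| * `|v (pi2 t)|)%:E <=
   kappa%:E * (\int[mu]_p (u p ^+ 2)%:E + \int[mu]_p (v p ^+ 2)%:E))%E.

(** Functions on the half-line are represented by their extension by zero. *)
Definition square_integrable (f : R -> R) := [/\ measurable_fun setT f,
  forall p, p <= 0 -> f p = 0 & mu.-integrable setT (EFin \o (fun p => f p ^+ 2))].

Let dominating_integrable (u v : R -> R) : square_integrable u -> square_integrable v ->
  m.-integrable setT (EFin \o (fun t => N t * `|u (pi1 t)| * `|v (pi2 t)|)).
Proof.
move=> [mu_ u0 iu] [mv v0 iv]; apply/integrableP; split.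
  apply/measurable_EFinP; apply: measurable_funM; first apply: measurable_funM => //.
    by apply: measurableT_comp => //; exact: measurableT_comp.
  by apply: measurableT_comp => //; exact: measurableT_comp.
rewrite [ltLHS](_ : _ = \int[m]_t (N t * `|u (pi1 t)| * `|v (pi2 t)|)%:E)%E; last first.
  by apply: eq_integral => t _; rewrite /= ger0_norm// !mulr_ge0.
apply: le_lt_trans (bound mu_ mv u0 v0) _.
have lty (h : R -> R) : mu.-integrable setT (EFin \o (fun p => h p ^+ 2)) ->
    (\int[mu]_p (h p ^+ 2)%:E < +oo)%E by move=> ih; exact: integrable_lty.
by rewrite lte_mul_pinfty// lte_add_pinfty// lty.
Qed.

Lemma integrable_weighted_product (r : T -> R) (u v : R -> R) :
  measurable_fun setT r ->
  (forall t, 0 < pi1 t -> 0 < pi2 t -> `|r t| <= N t) ->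
  square_integrable u -> square_integrable v ->
  m.-integrable setT (EFin \o (fun t => u (pi1 t) * r t * v (pi2 t))).
Proof.
move=> mr rN su sv; have := dominating_integrable su sv.
have [mu_ u0 iu] := su; have [mv v0 iv] := sv.
apply: le_integrable => //.
  apply/measurable_EFinP; apply: measurable_funM; last exact: measurableT_comp.
  by apply: measurable_funM => //; exact: measurableT_comp.
move=> t _ /=; rewrite lee_fin !normrM !normr_id [`|N t|]ger0_norm//.
have [p1|p1] := leP (pi1 t) 0; first by rewrite u0// normr0 !(mul0r, mulr0).
have [p2|p2] := leP (pi2 t) 0; first by rewrite v0// normr0 !mulr0.
by rewrite [`|u _| * `|r t|]mulrC ler_wpM2r// ler_wpM2r// rN.
Qed.

(** The weight converges pointwise under a common majorant, and the second factor
    converges in L^2 by continuity of dilations; the form bound on the majorant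
    controls the error of replacing the dilated function by f. *)
Lemma perturb_limit (f : R -> R) (nu : nat -> R) (r_ : nat -> T -> R) (r : T -> R) :
  square_integrable f -> nu @ \oo --> (1 : R) -> (forall n, 2^-1 <= nu n <= 2) ->
  (forall n, measurable_fun setT (r_ n)) ->
  (forall n t, 0 < pi1 t -> 0 < pi2 t -> `|r_ n t| <= N t) ->
  (forall t, 0 < pi1 t -> 0 < pi2 t -> r_ n t @[n --> \oo] --> r t) ->
  \int[m]_t (f (pi1 t) * r_ n t * f (nu n * pi2 t)) @[n --> \oo] -->
  \int[m]_t (f (pi1 t) * r t * f (pi2 t)).
Proof.
move=> sf nu1 nuI mr rN rr; have [mf f0 if2] := sf.
have nu0 n : 0 < nu n.
  by have /andP[la _] := nuI n; rewrite (lt_le_trans _ la)// invr_gt0.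
have mfn n : measurable_fun setT (fun p => f (nu n * p)).
  by apply: (measurableT_comp mf); exact: mulrl_measurable.
pose dn n p := f (nu n * p) - f p.
have mdn n : measurable_fun setT (dn n) by exact: measurable_funB.
have dn0 n p : p <= 0 -> dn n p = 0.
  by move=> p0; rewrite /dn !f0 ?subrr// pmulr_rle0.
have sfn n : square_integrable (fun p => f (nu n * p)).
  split => //; first by move=> p p0; rewrite f0// pmulr_rle0.
  exact: (integrable_dilation (nu0 n) if2).
have sdn n : square_integrable (dn n).
  split => //; first exact: dn0.
  have : mu.-integrable setT (EFin \o (fun p => 2 * f (nu n * p) ^+ 2 + 2 * f p ^+ 2)).
    have [_ _ i1] := sfn n.
    have := integrableD measurableT (integrableZl measurableT 2 i1) (integrableZl measurableT 2 if2).
    by apply: eq_integrable => // p _ /=; rewrite -!EFinM -EFinD.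
  apply: le_integrable => //; first by apply/measurable_EFinP; apply: measurable_funX; exact: mdn.
  move=> p _ /=; rewrite lee_fin ger0_norm ?sqr_ge0// ger0_norm; last first.
    by rewrite addr_ge0// mulr_ge0// sqr_ge0.
  by rewrite /dn !expr2; have := sqr_ge0 (f (nu n * p) + f p); rewrite expr2; nra.
have -> : (fun n => \int[m]_t (f (pi1 t) * r_ n t * f (nu n * pi2 t))) =
  (fun n => \int[m]_t (f (pi1 t) * r_ n t * f (pi2 t)) +
            \int[m]_t (f (pi1 t) * r_ n t * dn n (pi2 t))).
  apply/funext => n; rewrite -RintegralD//.
  - by apply: eq_Rintegral => t _; rewrite /dn -mulrDr addrC subrK.
  - exact: (integrable_weighted_product (mr n) (rN n) sf sf).
  - exact: (integrable_weighted_product (mr n) (rN n) sf (sdn n)).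
rewrite -[X in _ --> X]addr0; apply: cvgD.
- apply: (Rintegral_dominated_cvg _ _ (dominating_integrable sf sf)).
  + move=> n; apply: measurable_funM; last exact: measurableT_comp.
    by apply: measurable_funM => //; exact: measurableT_comp.
  + move=> t.
    have [p1|p1] := leP (pi1 t) 0.
      by rewrite f0//; under eq_cvg do rewrite !mul0r; rewrite !mul0r; exact: cvg_cst.
    have [p2|p2] := leP (pi2 t) 0.
      by rewrite [f (pi2 t)]f0//; under eq_cvg do rewrite !mulr0; rewrite !mulr0; exact: cvg_cst.
    apply: cvgMl; apply: cvgMr; exact: rr.
  + move=> n t.
    have [p1|p1] := leP (pi1 t) 0; first by rewrite f0// normr0 !(mul0r, mulr0) normr0.
    have [p2|p2] := leP (pi2 t) 0; first by rewrite [f (pi2 t)]f0// normr0 !mulr0 normr0.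
    by rewrite !normrM [`|f _| * `|r_ n t|]mulrC ler_wpM2r// ler_wpM2r// rN.
  (* the error pairs f with d_n; the form bound is applied to s f and d_n / s, with
     s small enough for the term in f, and then n large for the term in d_n *)
- apply/cvgr0Pnorm_lt => e e0; have k0 := kappa0.
  pose F := fine (\int[mu]_p (f p ^+ 2)%:E).
  have FE : (\int[mu]_p (f p ^+ 2)%:E = F%:E)%E.
    by rewrite fineK//; exact: integrable_fin_num.
  have F0 : 0 <= F by rewrite fine_ge0// integral_ge0// => p _; rewrite lee_fin sqr_ge0.
  pose s : R := Num.min 1 (e / (3 * (kappa + 1) * (F + 1))).
  have s0 : 0 < s by rewrite lt_min ltr01/= divr_gt0// !mulr_gt0//; lra.
  have s1 : s <= 1 by rewrite ge_min lexx.
  have s2 : kappa * (s ^+ 2 * F) <= e / 3.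
    have : s <= e / (3 * (kappa + 1) * (F + 1)) by rewrite ge_min lexx orbT.
    rewrite ler_pdivlMr; last by rewrite !mulr_gt0//; lra.
    move=> H; have : kappa * (s ^+ 2 * F) <= s * ((kappa + 1) * (F + 1)).
      rewrite expr2 -mulrA mulrCA ler_wpM2l ?(ltW s0)//.
      apply: (@le_trans _ _ (kappa * F)); last by nra.
      by rewrite ler_wpM2l// ler_piMl.
    lra.
  have d0 : 0 < e * s ^+ 2 / (3 * (kappa + 1)).
    by rewrite divr_gt0// ?mulr_gt0 ?exprn_gt0//; lra.
  have := dilation_continuity_L2 nu1 nuI mf if2 d0; apply: filterS => n Hn.
  have su : square_integrable (fun p => s * f p).
    split; [exact: measurable_funM|by move=> p p0; rewrite f0// mulr0|].
    have := integrableZl measurableT (s ^+ 2) if2.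
    by apply: eq_integrable => // p _ /=; rewrite -EFinM exprMn.
  have sv : square_integrable (fun p => s^-1 * dn n p).
    split; [exact: measurable_funM|by move=> p p0; rewrite dn0// mulr0|].
    have [_ _ id2] := sdn n.
    have := integrableZl measurableT (s^-1 ^+ 2) id2.
    by apply: eq_integrable => // p _ /=; rewrite -EFinM exprMn.
  have [mu1 u1 _] := su; have [mv1 v1 _] := sv.
  have B := bound mu1 mv1 u1 v1.
  have i1 := integrable_weighted_product (mr n) (rN n) sf (sdn n).
  rewrite -lte_fin EFin_normr_Rintegral//.
  apply: le_lt_trans (le_abse_integral _ measurableT _) _.
    by have /integrableP[] := i1.
  apply: le_lt_trans (_ : (_ <= \int[m]_t (N t * `|s * f (pi1 t)| * `|s^-1 * dn n (pi2 t)|)%:E)%E) _.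
    apply: ge0_le_integral => //.
    + by have /integrableP[mi _] := i1; exact: measurableT_comp.
    + by have /integrableP[mi _] := dominating_integrable su sv.
    + move=> t _; rewrite /= lee_fin !normrM [`|s|]gtr0_norm// [`|s^-1|]gtr0_norm ?invr_gt0//.
      have [p1|p1] := leP (pi1 t) 0; first by rewrite f0// normr0 !(mul0r, mulr0).
      have [p2|p2] := leP (pi2 t) 0; first by rewrite dn0// normr0 !mulr0.
      have -> : N t * (s * `|f (pi1 t)|) * (s^-1 * `|dn n (pi2 t)|) =
        N t * `|f (pi1 t)| * `|dn n (pi2 t)| by field; rewrite gt_eqF.
      by rewrite [`|f _| * `|r_ n t|]mulrC ler_wpM2r// ler_wpM2r// rN.
  apply: le_lt_trans B _.
  have -> : (\int[mu]_p ((s * f p) ^+ 2)%:E = (s ^+ 2 * F)%:E)%E.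
    rewrite EFinM -FE -ge0_integralZl//.
    + by apply: eq_integral => p _; rewrite -EFinM exprMn.
    + by apply/measurable_EFinP; apply: measurable_funX.
    + by move=> p _; rewrite lee_fin sqr_ge0.
    + by rewrite lee_fin sqr_ge0.
  have -> : (\int[mu]_p ((s^-1 * dn n p) ^+ 2)%:E =
     (s^-1 ^+ 2)%:E * \int[mu]_p (dn n p ^+ 2)%:E)%E.
    rewrite -ge0_integralZl//.
    + by apply: eq_integral => p _; rewrite -EFinM exprMn.
    + by apply/measurable_EFinP; apply: measurable_funX; exact: mdn.
    + by move=> p _; rewrite lee_fin sqr_ge0.
    + by rewrite lee_fin sqr_ge0.
  have [_ _ id2] := sdn n.
  have dE : (\int[mu]_p (dn n p ^+ 2)%:E = (fine (\int[mu]_p (dn n p ^+ 2)%:E))%:E)%E.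
    by rewrite fineK//; exact: integrable_fin_num.
  move: Hn; rewrite -/(dn n) dE lte_fin; set D := fine _ => Hn.
  rewrite -[((s^-1 ^+ 2)%:E * D%:E)%E]EFinM -[X in (_ * X)%E]EFinD -EFinM lte_fin mulrDr.
  have : kappa * (s^-1 ^+ 2 * D) <= e / 3.
    have D0 : 0 <= D by rewrite fine_ge0// integral_ge0// => p _; rewrite lee_fin sqr_ge0.
    move: Hn; rewrite ltr_pdivlMr; last lra.
    move=> Hn; rewrite exprVn mulrCA mulrC ler_pdivrMr ?exprn_gt0//.
    by nra.
  lra.
Qed.

End perturb_limit.

(** * Dependence of the kernel factors on the rest energy *)
Section difference_quotient.
Context {R : realType}.

Lemma cvg_diff_quotient (F : R -> R) (x a : R) (l : nat -> R) :
  is_derive x 1 F a -> l @ \oo --> x -> (forall n, l n != x) ->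
  (F (l n) - F x) / (l n - x) @[n --> \oo] --> a.
Proof.
move=> [dF <-] lx lnx.
have H : h^-1 *: (F (h *: 1 + x) - F x) @[h --> 0^'] --> 'D_1 F x by exact: dF.
have c0 : l n - x @[n --> \oo] --> (0 : R).
  by rewrite -(subrr x); apply: cvgB => //; exact: cvg_cst.
have h0 : l n - x @[n --> \oo] --> 0^'.
  move=> P HP.
  have K : \forall n \near \oo, l n - x != 0 -> P (l n - x).
    exact: (c0 (fun y => y != 0 -> P y) HP).
  suff : \forall n \near \oo, P (l n - x) by [].
  by apply: filterS K => n Pn; apply: Pn; move: (lnx n); rewrite -subr_eq0.
have := cvg_comp _ _ h0 H.
apply: cvg_trans; apply: near_eq_cvg; apply: nearW => n /=.
by rewrite /GRing.scale/= mulr1 subrK mulrC.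
Qed.

End difference_quotient.

Section mixing.
Context {R : realType}.
Variables (c e0 : R).
Hypotheses (e00 : 0 < e0).
Local Notation E := (en c e0).

(** With x = e0 / e(p), the coefficients of the kernel are
    (e(p) + e0) / n(p) = sqrt ((1 + x) / 2) and c p / n(p) = sqrt ((1 - x) / 2).
    The parameter l multiplies the rest energy e0: by scaling, a dilation of the
    momentum amounts to a change of the rest energy. *)
Definition restx (l p : R) : R := l * e0 / en c (l * e0) p.
Definition mixG (l p : R) : R := Num.sqrt ((1 + restx l p) / 2).
Definition mixH (l p : R) : R := Num.sqrt ((1 - restx l p) / 2).

Lemma en_scale (n l p : R) : 0 < n -> en c (n * l) (n * p) = n * en c l p.
Proof.
move=> n0; rewrite /en -[in RHS](gtr0_norm n0) -sqrtr_sqr -sqrtrM ?sqr_ge0//.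
by congr (Num.sqrt _); ring.
Qed.

Lemma restx_scale (n l p : R) : 0 < n -> restx (n * l) (n * p) = restx l p.
Proof.
move=> n0; rewrite /restx -(mulrA n l) en_scale//.
by rewrite -mulf_div divff ?mul1r// gt_eqF.
Qed.

Lemma restx_gt0 l p : 0 < l -> 0 < restx l p.
Proof. by move=> l0; rewrite divr_gt0 ?en_gt0 ?mulr_gt0. Qed.

Lemma restx_le1 l p : 0 < l -> restx l p <= 1.
Proof.
by move=> l0; rewrite ler_pdivrMr ?mul1r ?en_ge ?en_gt0// mulr_gt0.
Qed.

Lemma restx_lt1 l p : 0 < c -> 0 < l -> 0 < p -> restx l p < 1.
Proof.
move=> c0 l0 p0; have le0 : 0 < l * e0 by rewrite mulr_gt0.
rewrite ltr_pdivrMr ?mul1r ?en_gt0//.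
rewrite -[ltLHS]gtr0_norm// -sqrtr_sqr ltr_sqrt; last first.
  by rewrite ltr_wpDl ?exprn_gt0// -exprMn sqr_ge0.
by rewrite ltrDr mulr_gt0 ?exprn_gt0.
Qed.

Lemma mixG_sqr l p : 0 < l -> mixG l p ^+ 2 = (1 + restx l p) / 2.
Proof. by move=> l0; have := restx_gt0 p l0 => ?; rewrite sqr_sqrtr//; lra. Qed.

Lemma mixH_sqr l p : 0 < l -> mixH l p ^+ 2 = (1 - restx l p) / 2.
Proof. by move=> l0; have := restx_le1 p l0 => ?; rewrite sqr_sqrtr//; lra. Qed.

Lemma mixG_bound l p : 0 < l -> 2^-1 <= mixG l p <= 1.
Proof.
move=> l0; have x0 := restx_gt0 p l0; have x1 := restx_le1 p l0.
have g0 : 0 <= mixG l p by exact: sqrtr_ge0.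
have := mixG_sqr p l0; rewrite expr2 => gE.
by apply/andP; split; nra.
Qed.

Lemma mixH_bound l p : 0 < l -> 0 <= mixH l p <= 1.
Proof.
move=> l0; have x0 := restx_gt0 p l0; have x1 := restx_le1 p l0.
have h0 : 0 <= mixH l p by exact: sqrtr_ge0.
have := mixH_sqr p l0; rewrite expr2 => hE.
by apply/andP; split; nra.
Qed.

Lemma mixH_gt0 l p : 0 < c -> 0 < l -> 0 < p -> 0 < mixH l p.
Proof. by move=> c0 l0 p0; rewrite sqrtr_gt0; have := restx_lt1 c0 l0 p0; lra. Qed.

Lemma en_mass_le (l p : R) : 1 <= l -> E p <= en c (l * e0) p.
Proof.
move=> l1; have le0 : e0 <= l * e0 by rewrite ler_peMl// ltW.
rewrite ler_wsqrtr// lerD2l ler_sqr ?nnegrE// ?(ltW e00)//.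
exact: le_trans (ltW e00) le0.
Qed.

Lemma en_mass_diff (l p : R) : 1 < l -> l <= 2 ->
  `|(en c (l * e0) p - E p) / (l - 1)| <= 2 * e0.
Proof.
move=> l1 l2; have e1 := en_gt0 c e00 p; have l0 : 0 < l - 1 by lra.
have le0 : 0 < l * e0 by rewrite mulr_gt0//; lra.
have le := en_mass_le p (ltW l1).
have s1 := en_sqr c e0 p; have s2 := en_sqr c (l * e0) p.
have g1 := en_ge c e00 p.
have e00' := e00.
rewrite ger0_norm; last by rewrite divr_ge0//; lra.
rewrite ler_pdivrMr//.
have : (en c (l * e0) p - E p) * (en c (l * e0) p + E p) = (l - 1) * (l + 1) * e0 ^+ 2.
  by rewrite -subr_sqr s1 s2; ring.
set u := en c (l * e0) p in le *; set v := E p in le g1 e1 * => H.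
have H2 : (l - 1) * (l + 1) * e0 ^+ 2 <= 2 * e0 * (l - 1) * (u + v).
  have -> : 2 * e0 * (l - 1) * (u + v) = (l - 1) * (2 * (u + v) * e0) by ring.
  rewrite -mulrA ler_wpM2l ?(ltW l0)// expr2 mulrA ler_wpM2r ?(ltW e00)//; nra.
have uv : 0 < u + v by lra.
by rewrite -(ler_pM2r uv) H.
Qed.

(** The increments of the kernel factors are bounded by (l - 1) x, up to a
    constant, and x = e0 / e(p) decays like 1 / p. This decay is what makes the
    difference quotients of the kernel bounded on L^2 and not only on the form
    domain. *)
Lemma restx_diff (l p : R) : 1 < l ->
  0 <= restx l p - restx 1 p <= (l - 1) * (restx 1 p * (1 - restx 1 p ^+ 2)).
Proof.
move=> l1; have e1 := en_gt0 c e00 p; have l0 : 0 < l - 1 by lra.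
have le0 : 0 < l * e0 by rewrite mulr_gt0//; lra.
have el := en_gt0 c le0 p.
have le := en_mass_le p (ltW l1).
have s1 := en_sqr c e0 p; have s2 := en_sqr c (l * e0) p.
have e00' := e00.
rewrite /restx mul1r.
move: s1 s2; set s := c ^+ 2 * p ^+ 2 => s1 s2.
have s0 : 0 <= s by rewrite /s -exprMn sqr_ge0.
set u := en c (l * e0) p in le el s2 *; set v := E p in le e1 s1 *.
have D0 : 0 < l * v + u by nra.
have -> : l * e0 / u - e0 / v = e0 * (l - 1) * (l + 1) * s / (u * v * (l * v + u)).
  have : (l * v - u) * (l * v + u) = (l - 1) * (l + 1) * s.
    rewrite -subr_sqr exprMn s1 s2; ring.
  move=> H; have -> : e0 * (l - 1) * (l + 1) * s = e0 * ((l * v - u) * (l * v + u)).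
    by rewrite H; ring.
  by field; rewrite !gt_eqF.
have N0 : 0 <= e0 * (l - 1) * (l + 1) * s.
  apply: mulr_ge0 => //; apply: mulr_ge0; last lra.
  by apply: mulr_ge0; lra.
apply/andP; split; first by rewrite divr_ge0// ltW// !mulr_gt0.
have -> : (l - 1) * (e0 / v * (1 - (e0 / v) ^+ 2)) =
   e0 * (l - 1) * (l + 1) * s / (v * v * ((l + 1) * v)).
  have -> : s = v ^+ 2 - e0 ^+ 2 by rewrite s1; ring.
  by field; rewrite !gt_eqF//; lra.
rewrite ler_wpM2l// lef_pV2 ?posrE; last 2 first.
- by rewrite !mulr_gt0.
- by rewrite !mulr_gt0//; lra.
apply: ler_pM; [by rewrite mulr_ge0 ?ltW|by apply: mulr_ge0; lra|by rewrite ler_wpM2r ?(ltW e1)|].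
lra.
Qed.

Lemma mixG_diff (l p : R) : 1 < l ->
  `|mixG l p - mixG 1 p| <= (l - 1) * restx 1 p.
Proof.
move=> l1; have l0 : 0 < l by lra.
have /andP[d0 d1] := restx_diff p l1.
have x0 := restx_gt0 p ltr01; have x1 := restx_le1 p ltr01.
have /andP[g0 _] := mixG_bound p l0; have /andP[g1 _] := mixG_bound p ltr01.
have := mixG_sqr p l0; have := mixG_sqr p ltr01.
move: d0 d1 x0 x1 g0 g1.
set X := restx 1 p; set Y := restx l p; set A := mixG l p; set B := mixG 1 p.
move=> d0 d1 x0 x1 A0 B0 BE AE.
have AB : (A - B) * (A + B) = (Y - X) / 2 by rewrite -subr_sqr AE BE; ring.
have d2 : Y - X <= (l - 1) * X.
  by apply: (le_trans d1); rewrite ler_wpM2l//; [lra|rewrite expr2; nra].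
have A_B : 0 <= A - B by nra.
by rewrite ger0_norm//; nra.
Qed.

Lemma mixH_diff (l p : R) : 0 < c -> 0 < p -> 1 < l ->
  `|mixH l p - mixH 1 p| <= 2 * (l - 1) * restx 1 p.
Proof.
move=> c0 p0 l1; have l0 : 0 < l by lra.
have /andP[d0 d1] := restx_diff p l1.
have x0 := restx_gt0 p ltr01; have x1 := restx_le1 p ltr01.
have /andP[g0 _] := mixH_bound p l0; have /andP[_ g1] := mixH_bound p ltr01.
have h1 := mixH_gt0 c0 ltr01 p0.
have := mixH_sqr p l0; have := mixH_sqr p ltr01.
move: d0 d1 x0 x1 g0 g1 h1.
set X := restx 1 p; set Y := restx l p; set A := mixH l p; set B := mixH 1 p.
move=> d0 d1 x0 x1 A0 B1 B0 BE AE.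
have AB : (B - A) * (A + B) = (Y - X) / 2.
  by rewrite [A + B]addrC -subr_sqr AE BE; ring.
have BA : 0 <= B - A by nra.
rewrite distrC ger0_norm//.
have H1 : (B - A) * B <= (l - 1) * X * (1 + X) * B * B.
  apply: (@le_trans _ _ ((B - A) * (A + B))).
    by rewrite ler_wpM2l// lerDr.
  have -> : (l - 1) * X * (1 + X) * B * B = (l - 1) * (X * (1 - X ^+ 2)) / 2.
    by rewrite -mulrA -expr2 BE; field.
  by rewrite AB ler_pM2r ?invr_gt0.
have H2 : B - A <= (l - 1) * X * (1 + X) * B by rewrite -(ler_pM2r B0).
apply: (le_trans H2).
have lX : 0 <= (l - 1) * X by rewrite mulr_ge0 ?(ltW x0)//; lra.
have -> : 2 * (l - 1) * X = (l - 1) * X * 2 by ring.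
by rewrite -mulrA ler_wpM2l//; nra.
Qed.

Lemma der_en_mass (p : R) :
  is_derive (1 : R) 1 (fun l => en c (l * e0) p) (e0 ^+ 2 / E p).
Proof.
have e1 := en_gt0 c e00 p.
have d2 := der_sqr (derM (der_id 1) (der_cst e0 1)).
have d := derD (der_cst (c ^+ 2 * p ^+ 2) 1) d2.
have pos : 0 < c ^+ 2 * p ^+ 2 + (1 * e0) ^+ 2.
  by rewrite mul1r ltr_wpDl ?exprn_gt0// -exprMn sqr_ge0.
apply: (is_derive_eq (der_comp d (der_sqrt pos))).
rewrite mul1r -/(en c e0 p).
by field; rewrite gt_eqF.
Qed.

Lemma der_restx (p : R) :
  is_derive (1 : R) 1 (fun l => restx l p) (restx 1 p * (1 - restx 1 p ^+ 2)).
Proof.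
have e1 := en_gt0 c e00 p.
have en0 : en c (1 * e0) p != 0 by rewrite mul1r gt_eqF.
have d := derM (derM (der_id 1) (der_cst e0 1)) (derV (der_en_mass p) en0).
apply: (is_derive_eq d); rewrite /restx !mul1r.
by field; rewrite gt_eqF.
Qed.

Lemma der_mixG (p : R) :
  is_derive (1 : R) 1 (fun l => mixG l p) (2^-1 * restx 1 p * (1 - restx 1 p) * mixG 1 p).
Proof.
have x0 := restx_gt0 p ltr01.
have pos : 0 < (1 + restx 1 p) / 2 by lra.
have d := derM (derD (der_cst 1 1) (der_restx p)) (der_cst 2^-1 1).
apply: (is_derive_eq (der_comp d (der_sqrt pos))).
rewrite -/(mixG 1 p); have /andP[g0 _] := mixG_bound p ltr01.
have gE := mixG_sqr p ltr01.
have xE : restx 1 p = 2 * mixG 1 p ^+ 2 - 1 by rewrite gE; field.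
rewrite xE; field; rewrite gt_eqF//; lra.
Qed.

Lemma der_mixH (p : R) : 0 < c -> 0 < p ->
  is_derive (1 : R) 1 (fun l => mixH l p) (- (2^-1 * restx 1 p * (1 + restx 1 p) * mixH 1 p)).
Proof.
move=> c0 p0; have x1 := restx_lt1 c0 ltr01 p0.
have pos : 0 < (1 - restx 1 p) / 2 by lra.
have d := derM (derB (der_cst 1 1) (der_restx p)) (der_cst 2^-1 1).
apply: (is_derive_eq (der_comp d (der_sqrt pos))).
rewrite -/(mixH 1 p); have h0 := mixH_gt0 c0 ltr01 p0.
have hE := mixH_sqr p ltr01.
have xE : restx 1 p = 1 - 2 * mixH 1 p ^+ 2 by rewrite hE; field.
by rewrite xE; field; rewrite gt_eqF.
Qed.

Lemma measurable_restx l : measurable_fun [set: R] (restx l).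
Proof. by apply: measurable_funM => //; apply: measurable_funV; exact: measurable_en. Qed.

Lemma measurable_mixG l : measurable_fun [set: R] (mixG l).
Proof.
apply: measurable_sqrt; apply: measurable_funM => //; apply: measurable_funD => //.
exact: measurable_restx.
Qed.

Lemma measurable_mixH l : measurable_fun [set: R] (mixH l).
Proof.
apply: measurable_sqrt; apply: measurable_funM => //; apply: measurable_funB => //.
exact: measurable_restx.
Qed.

End mixing.

(** * The virial identity and its consequence *)
Section virial.
Context {R : realType}.
Notation mu := (@lebesgue_measure R).
Notation mu2 := (mu \x mu)%E.
Variables (c e0 K E ka kb : R) (a b : R -> R).
Hypotheses (c0 : 0 < c) (e00 : 0 < e0).

(** The properties of u |-> Q_l ((u + 1/u) / 2) on which the argument rests; kappa
    is the moment that enters the Schur test. *)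
Definition ratio_kernel (kappa : R) (a : R -> R) :=
  [/\ measurable_fun [set: R] a, forall u, a u^-1 = a u, forall u, u <= 0 -> a u = 0,
      0 <= kappa & forall e : R, -1 <= e <= 1 ->
  (\int[mu]_u (`|a u| * (((u + 1) + e * (u - 1)) / (2 * u * Num.sqrt u)))%:E
     <= kappa%:E)%E].

Hypotheses (Ha : ratio_kernel ka a) (Hb : ratio_kernel kb b).

Local Notation X := (restx c e0).
Local Notation G := (mixG c e0).
Local Notation H := (mixH c e0).

Definition energy_kernel (l : R) (q : R * R) : R :=
  a (q.2 / q.1) * (G l q.1 * G l q.2) + b (q.2 / q.1) * (H l q.1 * H l q.2).
Local Notation kk := energy_kernel.

Definition test_function (f : R -> R) := square_integrable f /\
  mu.-integrable setT (EFin \o (fun p => `|p| * f p ^+ 2)).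

Let mfst : measurable_fun [set: R * R] (fun q : R * R => q.1).
Proof. exact: measurable_fst. Qed.
Let msnd : measurable_fun [set: R * R] (fun q : R * R => q.2).
Proof. exact: measurable_snd. Qed.

Let ma2 : measurable_fun [set: R * R] (fun q : R * R => a (q.2 / q.1)).
Proof. by have [ma _ _ _ _] := Ha; exact: measurable_ratio_kernel. Qed.
Let mb2 : measurable_fun [set: R * R] (fun q : R * R => b (q.2 / q.1)).
Proof. by have [mb _ _ _ _] := Hb; exact: measurable_ratio_kernel. Qed.

Let mG1 l : measurable_fun [set: R * R] (fun q : R * R => G l q.1).
Proof. exact: measurableT_comp (measurable_mixG c e0 l) mfst. Qed.
Let mG2 l : measurable_fun [set: R * R] (fun q : R * R => G l q.2).
Proof. exact: measurableT_comp (measurable_mixG c e0 l) msnd. Qed.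
Let mH1 l : measurable_fun [set: R * R] (fun q : R * R => H l q.1).
Proof. exact: measurableT_comp (measurable_mixH c e0 l) mfst. Qed.
Let mH2 l : measurable_fun [set: R * R] (fun q : R * R => H l q.2).
Proof. exact: measurableT_comp (measurable_mixH c e0 l) msnd. Qed.

Lemma measurable_energy_kernel l : measurable_fun [set: R * R] (kk l).
Proof.
by apply: measurable_funD; apply: measurable_funM => //; exact: measurable_funM.
Qed.

Lemma energy_kernel_sym l q : kk l (q.2, q.1) = kk l q.
Proof.
have [_ aV _ _ _] := Ha; have [_ bV _ _ _] := Hb.
rewrite /energy_kernel /= -[q.1 / q.2]invf_div aV bV.
by rewrite [G l q.2 * _]mulrC [H l q.2 * _]mulrC.
Qed.

Lemma energy_kernel_scale (n l : R) q : 0 < n ->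
  kk (n * l) (n * q.1, n * q.2) = kk l q.
Proof.
move=> n0; rewrite /energy_kernel /= /mixG /mixH !restx_scale//.
by rewrite -mulf_div divff ?gt_eqF// mul1r.
Qed.

Let S (q : R * R) := `|a (q.2 / q.1)| + `|b (q.2 / q.1)|.

Lemma energy_kernel_le l q : 0 < l -> `|kk l q| <= S q.
Proof.
move=> l0; apply: (le_trans (ler_normD _ _)); rewrite /S !normrM.
have gb p : `|G l p| <= 1.
  by have /andP[g0 g1] := mixG_bound c e00 p l0; rewrite ger0_norm// (le_trans _ g0)// invr_ge0.
have hb p : `|H l p| <= 1.
  by have /andP[h0 h1] := mixH_bound c e00 p l0; rewrite ger0_norm.
by apply: lerD; rewrite ler_piMr// mulr_ile1.
Qed.

Lemma test_dilation l f : 0 < l -> test_function f -> test_function (fun p => f (l * p)).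
Proof.
move=> l0 [[mf f0 if2] ipf]; split; first split.
- by apply: (measurableT_comp mf); exact: mulrl_measurable.
- by move=> p p0; rewrite f0// pmulr_rle0.
- exact: (integrable_dilation l0 if2).
- have := integrableZl measurableT l^-1 (integrable_dilation l0 ipf).
  apply: eq_integrable => // p _ /=; rewrite -EFinM normrM (gtr0_norm l0) !mulrA.
  by rewrite mulVf ?mul1r// gt_eqF.
Qed.

(** Multiplication by bounded functions preserves the form domain, so that the
    eigenvalue equation can be tested with x f and x^2 f. *)
Lemma test_weight (w f : R -> R) : measurable_fun setT w -> (forall p, `|w p| <= 1) ->
  test_function f -> test_function (fun p => w p * f p).
Proof.
move=> mw w1 [[mf f0 if2] ipf].
have w2 p : w p ^+ 2 <= 1 by rewrite -real_normK ?num_real// exprn_ile1.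
have mwf : measurable_fun setT (fun p => (w p * f p) ^+ 2).
  by apply: measurable_funX; exact: measurable_funM.
split; first split.
- exact: measurable_funM.
- by move=> p p0; rewrite f0// mulr0.
- apply: le_integrable if2 => //; first exact/measurable_EFinP.
  move=> p _; rewrite /= lee_fin !ger0_norm ?sqr_ge0//.
  by rewrite exprMn ler_piMl// sqr_ge0.
- apply: le_integrable ipf => //.
    by apply/measurable_EFinP; apply: measurable_funM => //; exact: measurableT_comp.
  move=> p _; rewrite /= lee_fin.
  have pos (x : R) : 0 <= `|p| * x ^+ 2 by apply: mulr_ge0 => //; exact: sqr_ge0.
  by rewrite !(ger0_norm (pos _)) ler_wpM2l// exprMn ler_piMl// sqr_ge0.
Qed.

Let integrable_sq (u v : R -> R) : test_function u -> test_function v ->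
  mu.-integrable setT (EFin \o (fun p => (1 + `|p|) * (u p ^+ 2 + v p ^+ 2))).
Proof.
move=> [[mu_ u0 iu] ipu] [[mv v0 iv] ipv].
have := integrableD measurableT (integrableD measurableT iu iv) (integrableD measurableT ipu ipv).
by apply: eq_integrable => // p _ /=; rewrite -!EFinD; congr (_%:E); ring.
Qed.

Lemma integrable_form1 (C : R) (r u v : R -> R) : measurable_fun setT r ->
  (forall p, `|r p| <= C * (1 + `|p|)) -> test_function u -> test_function v ->
  mu.-integrable setT (EFin \o (fun p => u p * r p * v p)).
Proof.
move=> mr rC tu tv; have := integrableZl measurableT C (integrable_sq tu tv).
have [[mu_ _ _] _] := tu; have [[mv _ _] _] := tv.
apply: le_integrable => //.
  apply/measurable_EFinP; apply: measurable_funM => //; exact: measurable_funM.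
move=> p _; rewrite /= lee_fin.
have C0 : 0 <= C * (1 + `|p|) by exact: le_trans (normr_ge0 _) (rC p).
have s0 : 0 <= u p ^+ 2 + v p ^+ 2 by apply: addr_ge0; exact: sqr_ge0.
rewrite (mulrA C) [leRHS]normrM (ger0_norm C0) (ger0_norm s0).
rewrite !normrM [`|u p| * _]mulrC -mulrA.
apply: ler_pM => //.
rewrite -(real_normK (num_real (u p))) -(real_normK (num_real (v p))).
by have := sqr_ge0 (`|u p| - `|v p|); have := normr_ge0 (u p); have := normr_ge0 (v p);
  rewrite !expr2; nra.
Qed.

Lemma integrable_form2 (C : R) (r : R * R -> R) (u v : R -> R) :
  measurable_fun setT r -> (forall q, `|r q| <= C * S q) ->
  test_function u -> test_function v ->
  mu2.-integrable setT (EFin \o (fun q => u q.1 * r q * v q.2)).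
Proof.
move=> mr rC [[mu_ u0 iu] ipu] [[mv v0 iv] ipv].
have [ma aV an ka0 am] := Ha; have [mb bV bn kb0 bm] := Hb.
have fin (h : R -> R) (k : R) : mu.-integrable setT (EFin \o (fun p => `|p| * h p ^+ 2)) ->
    (\int[mu]_p (`|p| * k * h p ^+ 2)%:E < +oo)%E.
  move=> ih; apply: integrable_lty => //.
  have := integrableZl measurableT k ih; apply: eq_integrable => // p _ /=.
  by rewrite -EFinM; congr (_%:E); ring.
have S1 := schur_momentum ma aV an am ka0 mu_ mv u0 v0.
have S2 := schur_momentum mb bV bn bm kb0 mu_ mv u0 v0.
have mU : measurable_fun setT (fun q : R * R => u q.1) by exact: measurableT_comp.
have mV : measurable_fun setT (fun q : R * R => v q.2) by exact: measurableT_comp.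
have int (A : R * R -> R) : measurable_fun setT A ->
  (\int[mu2]_q (`|A q| * `|u q.1| * `|v q.2|)%:E < +oo)%E ->
  mu2.-integrable setT (EFin \o (fun q => `|A q| * `|u q.1| * `|v q.2|)).
  move=> mA fA; apply/integrableP; split.
    apply/measurable_EFinP; apply: measurable_funM; last exact: measurableT_comp.
    by apply: measurable_funM; exact: measurableT_comp.
  rewrite [ltLHS](_ : _ = \int[mu2]_q (`|A q| * `|u q.1| * `|v q.2|)%:E)%E//.
  by apply: eq_integral => q _; rewrite /= ger0_norm// !mulr_ge0.
have ia := int _ ma2 (le_lt_trans S1 (lte_mul_pinfty _ _ (lte_add_pinfty (fin _ ka ipu) (fin _ ka ipv)))).
have ib := int _ mb2 (le_lt_trans S2 (lte_mul_pinfty _ _ (lte_add_pinfty (fin _ kb ipu) (fin _ kb ipv)))).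
have h0 : (0 <= (2^-1)%:E :> \bar R)%E by rewrite lee_fin.
have {}ia := ia h0 isT; have {}ib := ib h0 isT.
have := integrableZl measurableT C (integrableD measurableT ia ib).
apply: le_integrable => //.
  by apply/measurable_EFinP; apply: measurable_funM => //; exact: measurable_funM.
move=> q _; rewrite /= lee_fin.
have -> : C * (`|a (q.2 / q.1)| * `|u q.1| * `|v q.2| + `|b (q.2 / q.1)| * `|u q.1| * `|v q.2|)
  = C * S q * (`|u q.1| * `|v q.2|) by rewrite /S; ring.
have C0 : 0 <= C * S q by exact: le_trans (normr_ge0 _) (rC q).
rewrite !normrM [`|C| * `|S q|](_ : _ = C * S q); last by rewrite -normrM ger0_norm.
by rewrite !normr_id [`|u _| * _]mulrC -mulrA ler_wpM2r// mulr_ge0.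
Qed.

Variable f : R -> R.
Hypothesis tf : test_function f.
Hypothesis eigen : forall phi, test_function phi ->
  \int[mu]_p (phi p * en c e0 p * f p) - K * \int[mu2]_q (phi q.1 * kk 1 q * f q.2) =
  E * \int[mu]_p (phi p * 1 * f p).

Let en_le_lin (l p : R) : 0 < l -> `|en c (l * e0) p| <= (c + l * e0) * (1 + `|p|).
Proof.
move=> l0; have le0 : 0 < l * e0 by rewrite mulr_gt0.
have lo := en_gt0 c le0 p; rewrite gtr0_norm//.
have c0' := c0; have p0 := normr_ge0 p.
have cp0 : 0 <= c * `|p| by rewrite mulr_ge0// ltW.
apply: (@le_trans _ _ (c * `|p| + l * e0)); last by nra.
rewrite -[leRHS]ger0_norm; last lra.
rewrite -sqrtr_sqr ler_wsqrtr// -[p ^+ 2]real_normK ?num_real// -exprMn.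
by rewrite !expr2; nra.
Qed.

Let integrable_kk (l : R) (u v : R -> R) : 0 < l -> test_function u -> test_function v ->
  mu2.-integrable setT (EFin \o (fun q => u q.1 * kk l q * v q.2)).
Proof.
move=> l0; apply: (@integrable_form2 1); first exact: measurable_energy_kernel.
by move=> q; rewrite mul1r energy_kernel_le.
Qed.

Let integrable_en (l : R) (u v : R -> R) : 0 < l -> test_function u -> test_function v ->
  mu.-integrable setT (EFin \o (fun p => u p * en c (l * e0) p * v p)).
Proof.
move=> l0; apply: (@integrable_form1 (c + l * e0)); first exact: measurable_en.
by move=> p; exact: en_le_lin.
Qed.

Let integrable_1 (u v : R -> R) : test_function u -> test_function v ->
  mu.-integrable setT (EFin \o (fun p => u p * 1 * v p)).
Proof.
by apply: (@integrable_form1 1) => // p; rewrite normr1 mul1r lerDl.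
Qed.

(** Dilating the test function and substituting p -> p / l turns the form for rest
    energy e0 into the form for rest energy l e0, up to a power of l. *)
Let eigen_dilated (l : R) : 0 < l ->
  \int[mu]_p (f p * en c (l * e0) p * f (l^-1 * p)) -
    K * \int[mu2]_q (f q.1 * kk l q * f (l^-1 * q.2)) =
  l * (E * \int[mu]_p (f p * 1 * f (l^-1 * p))).
Proof.
move=> l0; have n0 : 0 < l^-1 by rewrite invr_gt0.
have ln : l != 0 by rewrite gt_eqF.
have tfl := test_dilation l0 tf.
have fK p : f (l * (l^-1 * p)) = f p by rewrite mulrA divff// mul1r.
have i1 : mu.-integrable setT (EFin \o (fun p => f (l * p) * en c e0 p * f p)).
  by have := integrable_en ltr01 tfl tf; rewrite mul1r.
have i2 := integrable_kk ltr01 tfl tf.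
have i3 := integrable_1 tfl tf.
have e1 : \int[mu]_p (f p * en c (l * e0) p * f (l^-1 * p)) =
    l ^+ 2 * \int[mu]_p (f (l * p) * en c e0 p * f p).
  have := Rintegral_dilation n0 i1; rewrite invrK => D.
  rewrite expr2 -mulrA -D -RintegralZl//; last exact: (integrable_dilation n0 i1).
  apply: eq_Rintegral => p _; rewrite fK.
  have -> : en c (l * e0) p = l * en c e0 (l^-1 * p).
    by rewrite -en_scale// mulrA divff// mul1r.
  by ring.
have e2 : \int[mu2]_q (f q.1 * kk l q * f (l^-1 * q.2)) =
    l ^+ 2 * \int[mu2]_q (f (l * q.1) * kk 1 q * f q.2).
  have := Rintegral_dilation2 n0 i2; rewrite exprVn invrK => <-.
  apply: eq_Rintegral => q _ /=; rewrite fK.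
  by rewrite -[kk l q](energy_kernel_scale _ _ n0) mulVf.
have e3 : \int[mu]_p (f p * 1 * f (l^-1 * p)) =
    l * \int[mu]_p (f (l * p) * 1 * f p).
  have := Rintegral_dilation n0 i3; rewrite invrK => <-.
  by apply: eq_Rintegral => p _; rewrite fK.
rewrite e1 e2 e3; have := eigen tfl; set I1 := Rintegral _ _ _; set I2 := Rintegral _ _ _.
move=> Q; have -> : l ^+ 2 * I1 - K * (l ^+ 2 * I2) = l ^+ 2 * (I1 - K * I2) by ring.
by rewrite Q; ring.
Qed.

(** The difference of the dilated equation and of the equation tested with the
    inversely dilated eigenfunction, divided by l - 1. The eigenfunction need not
    be differentiable: only the kernels are differentiated. *)
Let virial_difference (l : R) : 1 < l ->
  \int[mu]_p (f p * ((en c (l * e0) p - en c e0 p) / (l - 1)) * f (l^-1 * p)) -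
    K * \int[mu2]_q (f q.1 * ((kk l q - kk 1 q) / (l - 1)) * f (l^-1 * q.2)) =
  E * \int[mu]_p (f p * 1 * f (l^-1 * p)).
Proof.
move=> l1; have l0 : 0 < l by rewrite (lt_trans _ l1).
have n0 : 0 < l^-1 by rewrite invr_gt0.
have lm : l - 1 != 0 by rewrite subr_eq0 gt_eqF.
have tfn := test_dilation n0 tf.
have i1 := integrable_en l0 tf tfn.
have i1' : mu.-integrable setT (EFin \o (fun p => f p * en c e0 p * f (l^-1 * p))).
  by have := integrable_en ltr01 tf tfn; rewrite mul1r.
have i2 := integrable_kk l0 tf tfn.
have i2' := integrable_kk ltr01 tf tfn.
have e1 : \int[mu]_p (f p * ((en c (l * e0) p - en c e0 p) / (l - 1)) * f (l^-1 * p)) =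
  (l - 1)^-1 * (\int[mu]_p (f p * en c (l * e0) p * f (l^-1 * p)) -
                \int[mu]_p (f p * en c e0 p * f (l^-1 * p))).
  rewrite -RintegralB// -RintegralZl//; last first.
    have := integrableB measurableT i1 i1'; apply: eq_integrable => // p _.
  by apply: eq_Rintegral => p _; ring.
have e2 : \int[mu2]_q (f q.1 * ((kk l q - kk 1 q) / (l - 1)) * f (l^-1 * q.2)) =
  (l - 1)^-1 * (\int[mu2]_q (f q.1 * kk l q * f (l^-1 * q.2)) -
                \int[mu2]_q (f q.1 * kk 1 q * f (l^-1 * q.2))).
  rewrite -RintegralB// -RintegralZl//; last first.
    have := integrableB measurableT i2 i2'; apply: eq_integrable => // p _.
  by apply: eq_Rintegral => p _; ring.
have Q1 := eigen_dilated l0.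
have Q2 := eigen tfn.
have s1 : \int[mu]_p (f (l^-1 * p) * en c e0 p * f p) =
          \int[mu]_p (f p * en c e0 p * f (l^-1 * p)).
  by apply: eq_Rintegral => p _; ring.
have s2 : \int[mu]_p (f (l^-1 * p) * 1 * f p) = \int[mu]_p (f p * 1 * f (l^-1 * p)).
  by apply: eq_Rintegral => p _; ring.
have s3 : \int[mu2]_q (f (l^-1 * q.1) * kk 1 q * f q.2) =
          \int[mu2]_q (f q.1 * kk 1 q * f (l^-1 * q.2)).
  rewrite -(Rintegral_swap i2'); apply: eq_Rintegral => q _ /=.
  by rewrite energy_kernel_sym; ring.
rewrite s1 s2 s3 in Q2; rewrite e1 e2.
move: Q1 Q2; set A1 := Rintegral _ _ _; set A2 := Rintegral _ _ _; set A3 := Rintegral _ _ _.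
set A4 := Rintegral _ _ _; set A5 := Rintegral _ _ _ => Q1 Q2.
have -> : (l - 1)^-1 * (A1 - A4) - K * ((l - 1)^-1 * (A2 - A5)) =
  (l - 1)^-1 * ((A1 - K * A2) - (A4 - K * A5)) by ring.
by rewrite Q1 Q2; field.
Qed.

Let mass (n : nat) : R := 1 + n.+1%:R^-1.

Let mass_bound n : 1 < mass n <= 2.
Proof.
rewrite /mass ltrDl invr_gt0 ltr0n/=.
have i1 : n.+1%:R^-1 <= 1 :> R by rewrite invf_le1 ?ltr0n// ler1n.
by rewrite -[leRHS]/(1 + 1) lerD2l.
Qed.

Let mass_cvg : mass @ \oo --> (1 : R).
Proof.
rewrite -[X in _ --> X]addr0; apply: cvgD; first exact: cvg_cst.
exact: cvg_harmonic.
Qed.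

Let massV_bound n : 2^-1 <= (mass n)^-1 <= 2.
Proof.
have /andP[m1 m2] := mass_bound n; have m0 : 0 < mass n by rewrite (lt_trans _ m1).
rewrite lef_pV2 ?posrE// m2/= -[leRHS]invrK lef_pV2 ?posrE ?invr_gt0//.
by rewrite (le_trans _ (ltW m1))// invf_le1// ler1n.
Qed.

Let massV_cvg : (fun n => (mass n)^-1) @ \oo --> (1 : R).
Proof. by rewrite -[X in _ --> X]invr1; apply: cvgV => //; exact: oner_neq0. Qed.

Let dG (p : R) := 2^-1 * X 1 p * (1 - X 1 p) * G 1 p.
Let dH (p : R) := - (2^-1 * X 1 p * (1 + X 1 p) * H 1 p).

(** The derivative of the kernel in l at l = 1. *)
Let dkk (q : R * R) : R :=
  a (q.2 / q.1) * (G 1 q.1 * dG q.2 + G 1 q.2 * dG q.1) +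
  b (q.2 / q.1) * (H 1 q.1 * dH q.2 + H 1 q.2 * dH q.1).

Let diff_kk_cvg q : 0 < q.1 -> 0 < q.2 ->
  (kk (mass n) q - kk 1 q) / (mass n - 1) @[n --> \oo] --> dkk q.
Proof.
move=> q1 q2; have m1 n : mass n != 1 by have /andP[m1 _] := mass_bound n; rewrite gt_eqF.
apply: (@cvg_diff_quotient R (fun l => kk l q) 1 (dkk q) mass _ mass_cvg m1).
apply: (is_derive_eq (derD
  (derZ (a (q.2 / q.1)) (derM (der_mixG c e00 q.1) (der_mixG c e00 q.2)))
  (derZ (b (q.2 / q.1)) (derM (der_mixH e00 c0 q1) (der_mixH e00 c0 q2))))).
by [].
Qed.

Let N (q : R * R) : R := 2 * e0 * (((en c e0 q.1)^-1 + (en c e0 q.2)^-1) * S q).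

Let diff_kk_le l q : 1 < l -> 0 < q.1 -> 0 < q.2 ->
  `|(kk l q - kk 1 q) / (l - 1)| <= N q.
Proof.
move=> l1 q1 q2; have l0 : 0 < l by rewrite (lt_trans _ l1).
have lm : 0 < l - 1 by rewrite subr_gt0.
rewrite normrM [`|_^-1|]gtr0_norm ?invr_gt0// ler_pdivrMr//.
have -> : N q * (l - 1) = S q * (2 * (l - 1) * (X 1 q.1 + X 1 q.2)).
  by rewrite /N /restx mul1r; ring.
have prod (P : R -> R -> R) (C x y : R) : (forall p, `|P l p| <= 1) -> `|P 1 x| <= 1 -> `|P 1 y| <= 1 ->
    `|P l x - P 1 x| <= C * X 1 x -> `|P l y - P 1 y| <= C * X 1 y ->
    `|P l x * P l y - P 1 x * P 1 y| <= C * (X 1 x + X 1 y).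
  move=> Pl P1 P1y Dx Dy.
  have -> : P l x * P l y - P 1 x * P 1 y =
    P l y * (P l x - P 1 x) + P 1 x * (P l y - P 1 y) by ring.
  apply: (le_trans (ler_normD _ _)); rewrite !normrM mulrDr; apply: lerD.
    by apply: le_trans Dx; rewrite ler_piMl.
  by apply: le_trans Dy; rewrite ler_piMl.
have gb l' p : 0 < l' -> `|G l' p| <= 1.
  by move=> l0'; have /andP[g0 g1] := mixG_bound c e00 p l0'; rewrite ger0_norm// (le_trans _ g0)// invr_ge0.
have hb l' p : 0 < l' -> `|H l' p| <= 1.
  by move=> l0'; have /andP[h0 h1] := mixH_bound c e00 p l0'; rewrite ger0_norm.
have x1 p := restx_gt0 c e00 p (@ltr01 R).
have PG : `|G l q.1 * G l q.2 - G 1 q.1 * G 1 q.2| <= 2 * (l - 1) * (X 1 q.1 + X 1 q.2).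
  apply: (@le_trans _ _ ((l - 1) * (X 1 q.1 + X 1 q.2))).
    by apply: prod => *; rewrite ?gb ?mixG_diff.
  rewrite ler_wpM2r; [by []|by rewrite addr_ge0 ?ltW|lra].
have PH : `|H l q.1 * H l q.2 - H 1 q.1 * H 1 q.2| <= 2 * (l - 1) * (X 1 q.1 + X 1 q.2).
  by apply: prod => *; rewrite ?hb ?mixH_diff.
have -> : kk l q - kk 1 q = a (q.2 / q.1) * (G l q.1 * G l q.2 - G 1 q.1 * G 1 q.2) +
  b (q.2 / q.1) * (H l q.1 * H l q.2 - H 1 q.1 * H 1 q.2) by rewrite /energy_kernel; ring.
apply: (le_trans (ler_normD _ _)); rewrite /S mulrDl !normrM.
by apply: lerD; rewrite ler_wpM2l.
Qed.

Let mEi : measurable_fun setT (fun p => (en c e0 p)^-1).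
Proof. by apply: measurable_funV; exact: measurable_en. Qed.

Let mEE : measurable_fun setT (fun q : R * R => (en c e0 q.1)^-1 + (en c e0 q.2)^-1).
Proof.
by apply: measurable_funD; [exact: measurableT_comp mEi mfst|exact: measurableT_comp mEi msnd].
Qed.

Let mN : measurable_fun setT N.
Proof.
apply: measurable_funM => //; apply: measurable_funM => //.
by apply: measurable_funD; exact: measurableT_comp.
Qed.

Let EE0 (q : R * R) : 0 <= (en c e0 q.1)^-1 + (en c e0 q.2)^-1.
Proof. by rewrite addr_ge0// invr_ge0 ltW// en_gt0. Qed.

Let N0 q : 0 <= N q.
Proof.
rewrite /N mulr_ge0//; first by rewrite mulr_ge0// ltW.
by rewrite mulr_ge0// addr_ge0.
Qed.

Let kN := 2 * e0 * ((ka + kb) / c).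

Let kN0 : 0 <= kN.
Proof.
have [_ _ _ ka0 _] := Ha; have [_ _ _ kb0 _] := Hb.
by rewrite /kN !mulr_ge0 ?invr_ge0 ?addr_ge0// ltW.
Qed.

(** By c |p| <= en c e0 p, the energy-weighted Schur bound is a bound on L^2. *)
Lemma schur_energy_le (k : R) (a' : R -> R) (u v : R -> R) : ratio_kernel k a' ->
  measurable_fun setT u -> measurable_fun setT v ->
  (forall p, p <= 0 -> u p = 0) -> (forall p, p <= 0 -> v p = 0) ->
  (\int[mu2]_q (((en c e0 q.1)^-1 + (en c e0 q.2)^-1) * `|a' (q.2 / q.1)| * `|u q.1| * `|v q.2|)%:E
   <= (k / c)%:E * (\int[mu]_p (u p ^+ 2)%:E + \int[mu]_p (v p ^+ 2)%:E))%E.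
Proof.
move=> [ma aV an k0 am] mu_ mv u0 v0.
apply: (le_trans (schur_energy c e00 ma aV an am k0 mu_ mv u0 v0)).
have B (h : R -> R) : measurable_fun setT h ->
  (\int[mu]_p (`|p| * (2 / en c e0 p) * k * h p ^+ 2)%:E <=
   (2 * (k / c))%:E * \int[mu]_p (h p ^+ 2)%:E)%E.
  move=> mh; rewrite -ge0_integralZl//; last 3 first.
  - by apply/measurable_EFinP; exact: measurable_funX.
  - by move=> p _; rewrite lee_fin sqr_ge0.
  - by rewrite lee_fin mulr_ge0// divr_ge0// ltW.
  apply: ge0_le_integral => //.
  - move=> p _; rewrite lee_fin; apply: mulr_ge0; last exact: sqr_ge0.
    by rewrite !mulr_ge0// invr_ge0 ltW// en_gt0.
  - apply/measurable_EFinP; apply: measurable_funM; last exact: measurable_funX.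
    apply: (measurable_funM (f := fun p : R => `|p| * (2 / en c e0 p)) (g := cst k)) => //.
    apply: (measurable_funM (f := fun p : R => `|p|)); first exact: measurableT_comp.
    exact: measurable_funM.
  - by apply: emeasurable_funM => //; apply/measurable_EFinP; exact: measurable_funX.
  - move=> p _; rewrite -EFinM lee_fin ler_wpM2r ?sqr_ge0//.
    have -> : `|p| * (2 / en c e0 p) * k = 2 * k * (`|p| / en c e0 p) by ring.
    have -> : 2 * (k / c) = 2 * k * c^-1 by ring.
    rewrite ler_wpM2l ?mulr_ge0// ler_pdivrMr ?en_gt0// mulrC ler_pdivlMr// mulrC.
    have -> : en c e0 p = en c e0 `|p| by rewrite /en real_normK ?num_real.
    by rewrite le_en.
apply: (@le_trans _ _ ((2^-1)%:E * ((2 * (k / c))%:E * \int[mu]_p (u p ^+ 2)%:E +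
   (2 * (k / c))%:E * \int[mu]_p (v p ^+ 2)%:E))%E).
  by rewrite lee_wpmul2l ?lee_fin//; apply: leeD; exact: B.
have i0 (h : R -> R) : (0 <= \int[mu]_p (h p ^+ 2)%:E)%E.
  by apply: integral_ge0 => p _; rewrite lee_fin sqr_ge0.
rewrite -ge0_muleDr// muleA.
have -> : ((2^-1)%:E * (2 * (k / c))%:E = (k / c)%:E)%E.
  by rewrite -EFinM; congr (_%:E); field; rewrite gt_eqF.
by [].
Qed.

Let bound2 (u v : R -> R) : measurable_fun setT u -> measurable_fun setT v ->
  (forall p, p <= 0 -> u p = 0) -> (forall p, p <= 0 -> v p = 0) ->
  (\int[mu2]_q (N q * `|u q.1| * `|v q.2|)%:E <=
   kN%:E * (\int[mu]_p (u p ^+ 2)%:E + \int[mu]_p (v p ^+ 2)%:E))%E.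
Proof.
move=> mu_ mv u0 v0.
have Sa := schur_energy_le Ha mu_ mv u0 v0.
have Sb := schur_energy_le Hb mu_ mv u0 v0.
have [_ _ _ ka0 _] := Ha; have [_ _ _ kb0 _] := Hb.
have mA (a' : R -> R) : measurable_fun setT (fun q : R * R => a' (q.2 / q.1)) ->
  measurable_fun setT (fun q : R * R => (((en c e0 q.1)^-1 + (en c e0 q.2)^-1) *
      `|a' (q.2 / q.1)| * `|u q.1| * `|v q.2|)%:E).
  move=> ma'; apply/measurable_EFinP.
  have mU : measurable_fun setT (fun q : R * R => u q.1) by exact: measurableT_comp.
  have mV : measurable_fun setT (fun q : R * R => v q.2) by exact: measurableT_comp.
  apply: measurable_funM; last exact: measurableT_comp.
  apply: measurable_funM; last exact: measurableT_comp.
  by apply: measurable_funM => //; exact: measurableT_comp.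
have p0 (a' : R -> R) (q : R * R) : (0 <= (((en c e0 q.1)^-1 + (en c e0 q.2)^-1) *
      `|a' (q.2 / q.1)| * `|u q.1| * `|v q.2|)%:E)%E.
  by rewrite lee_fin !mulr_ge0.
have i0 (h : R -> R) : (0 <= \int[mu]_p (h p ^+ 2)%:E)%E.
  by apply: integral_ge0 => p _; rewrite lee_fin sqr_ge0.
have e0' : 0 <= 2 * e0 by rewrite mulr_ge0// ltW.
rewrite [leLHS](_ : _ = \int[mu2]_q ((2 * e0)%:E *
  ((((en c e0 q.1)^-1 + (en c e0 q.2)^-1) * `|a (q.2 / q.1)| * `|u q.1| * `|v q.2|)%:E +
   (((en c e0 q.1)^-1 + (en c e0 q.2)^-1) * `|b (q.2 / q.1)| * `|u q.1| * `|v q.2|)%:E)))%E; last first.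
  by apply: eq_integral => q _; rewrite -EFinD -EFinM /N /S; congr (_%:E); ring.
rewrite ge0_integralZl ?lee_fin//; last 2 first.
- by apply: emeasurable_funD; exact: mA.
- by move=> q _; rewrite adde_ge0.
rewrite ge0_integralD//; [|exact: mA|exact: mA].
have -> : kN%:E = ((2 * e0)%:E * ((ka / c)%:E + (kb / c)%:E))%E.
  by rewrite /kN [(ka + kb) / c]mulrDl EFinM EFinD.
rewrite -muleA; apply: lee_wpmul2l; first by rewrite lee_fin.
rewrite ge0_muleDl.
- exact: leeD.
- by rewrite lee_fin divr_ge0// ltW.
- by rewrite lee_fin divr_ge0// ltW.
Qed.

Let bound1 (C : R) (u v : R -> R) : 0 <= C -> measurable_fun setT u -> measurable_fun setT v ->
  (\int[mu]_p (C * `|u p| * `|v p|)%:E <=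
   C%:E * (\int[mu]_p (u p ^+ 2)%:E + \int[mu]_p (v p ^+ 2)%:E))%E.
Proof.
move=> C0 mu_ mv.
have s (h : R -> R) p : (0 <= (h p ^+ 2)%:E)%E by rewrite lee_fin sqr_ge0.
have m2 (h : R -> R) : measurable_fun setT h -> measurable_fun setT (fun p => (h p ^+ 2)%:E).
  by move=> mh; apply/measurable_EFinP; exact: measurable_funX.
have mm := m2 _ mu_; have mm' := m2 _ mv.
rewrite -ge0_integralD// -ge0_integralZl//; last 2 first.
- exact: emeasurable_funD.
- by move=> p _; rewrite adde_ge0.
apply: ge0_le_integral => //.
- by move=> p _; rewrite lee_fin !mulr_ge0.
- apply/measurable_EFinP; apply: measurable_funM; last exact: measurableT_comp.
  by apply: measurable_funM => //; exact: measurableT_comp.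
- by apply: emeasurable_funM => //; exact: emeasurable_funD.
- move=> p _; rewrite -EFinD -EFinM lee_fin -mulrA ler_wpM2l//.
  rewrite -(real_normK (num_real (u p))) -(real_normK (num_real (v p))) !expr2.
  by have := sqr_ge0 (`|u p| - `|v p|); have := normr_ge0 (u p); have := normr_ge0 (v p);
    rewrite expr2; nra.
Qed.

(** The derivative of the forms with respect to the rest energy has, at an
    eigenfunction, the value E / e0 times the square of its norm (the factor e0 is
    absorbed by differentiating in l). *)
Let virial :
  \int[mu]_p (f p * (e0 ^+ 2 / en c e0 p) * f p) -
    K * \int[mu2]_q (f q.1 * dkk q * f q.2) =
  E * \int[mu]_p (f p * 1 * f p).
Proof.
have [sf _] := tf; have e2 : 0 <= 2 * e0 by rewrite mulr_ge0// ltW.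
have m1 n : 1 < mass n by have /andP[] := mass_bound n.
have mn1 n : mass n != 1 by rewrite gt_eqF.
have L1 := @perturb_limit R _ _ mu id id (cst (2 * e0)) (2 * e0)
  (@measurable_id _ _ _) (@measurable_id _ _ _) (measurable_cst _) (fun=> e2) e2
  (fun u v mu_ mv _ _ => bound1 e2 mu_ mv) f (fun n => (mass n)^-1)
  (fun n p => (en c (mass n * e0) p - en c e0 p) / (mass n - 1))
  (fun p => e0 ^+ 2 / en c e0 p) sf massV_cvg massV_bound.
have L3 := @perturb_limit R _ _ mu id id (cst 1) 1
  (@measurable_id _ _ _) (@measurable_id _ _ _) (measurable_cst _) (fun=> ler01) ler01
  (fun u v mu_ mv _ _ => bound1 ler01 mu_ mv) f (fun n => (mass n)^-1)
  (fun n p => 1) (fun p => 1) sf massV_cvg massV_bound.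
have L2 := @perturb_limit R _ _ mu2 (fun q => q.1) (fun q => q.2) N kN mfst msnd mN N0 kN0
  bound2 f (fun n => (mass n)^-1) (fun n q => (kk (mass n) q - kk 1 q) / (mass n - 1))
  dkk sf massV_cvg massV_bound.
have {}L1 : \int[mu]_p (f p * ((en c (mass n * e0) p - en c e0 p) / (mass n - 1)) *
    f ((mass n)^-1 * p)) @[n --> \oo] --> \int[mu]_p (f p * (e0 ^+ 2 / en c e0 p) * f p).
  apply: L1.
  - by move=> n; apply: measurable_funM => //; apply: measurable_funB; exact: measurable_en.
  - by move=> n p _ _; have /andP[? ?] := mass_bound n; apply: en_mass_diff.
  - move=> p _ _.
    have := @cvg_diff_quotient R (fun l => en c (l * e0) p) 1 _ mass (der_en_mass c e00 p) mass_cvg mn1.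
    by rewrite mul1r.
have {}L2 : \int[mu2]_q (f q.1 * ((kk (mass n) q - kk 1 q) / (mass n - 1)) *
    f ((mass n)^-1 * q.2)) @[n --> \oo] --> \int[mu2]_q (f q.1 * dkk q * f q.2).
  apply: L2.
  - by move=> n; apply: measurable_funM => //; apply: measurable_funB; exact: measurable_energy_kernel.
  - by move=> n q q1 q2; exact: diff_kk_le.
  - exact: diff_kk_cvg.
have {}L3 : \int[mu]_p (f p * 1 * f ((mass n)^-1 * p)) @[n --> \oo] -->
    \int[mu]_p (f p * 1 * f p).
  by apply: L3 => // [n p _ _|p _ _]; [rewrite normr1|exact: cvg_cst].
pose lhs n := \int[mu]_p (f p * ((en c (mass n * e0) p - en c e0 p) / (mass n - 1)) *
    f ((mass n)^-1 * p)) -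
  K * \int[mu2]_q (f q.1 * ((kk (mass n) q - kk 1 q) / (mass n - 1)) * f ((mass n)^-1 * q.2)).
have L12 : lhs n @[n --> \oo] --> \int[mu]_p (f p * (e0 ^+ 2 / en c e0 p) * f p) -
    K * \int[mu2]_q (f q.1 * dkk q * f q.2).
  by apply: cvgB => //; apply: cvgM => //; exact: cvg_cst.
have L4 : lhs n @[n --> \oo] --> E * \int[mu]_p (f p * 1 * f p).
  rewrite (_ : lhs = fun n => E * \int[mu]_p (f p * 1 * f ((mass n)^-1 * p))).
    by apply: cvgM => //; exact: cvg_cst.
  by apply/funext => n; exact: virial_difference.
by rewrite -(cvg_lim _ L12)// -(cvg_lim _ L4).
Qed.

Let I1 (r : R -> R) := \int[mu]_p (f p * r p * f p).
Let I2 (r : R * R -> R) := \int[mu2]_q (f q.1 * r q * f q.2).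

(** Conditions on the weights under which I1 and I2 converge; they are stable
    under linear combinations. *)
Let good1 (r : R -> R) := measurable_fun setT r /\ exists C, forall p, `|r p| <= C.
Let good2 (r : R * R -> R) := measurable_fun setT r /\
  exists C, forall q, `|r q| <= C * S q.

Let good1_int r : good1 r -> mu.-integrable setT (EFin \o (fun p => f p * r p * f p)).
Proof.
move=> [mr [C rC]]; apply: (@integrable_form1 C) => // p.
have C0 : 0 <= C by exact: le_trans (normr_ge0 _) (rC p).
by apply: (le_trans (rC p)); rewrite ler_peMr// lerDl.
Qed.

Let good2_int r : good2 r -> mu2.-integrable setT (EFin \o (fun q => f q.1 * r q * f q.2)).
Proof. by move=> [mr [C rC]]; exact: (@integrable_form2 C). Qed.

Let I1_lin (x y : R) r s : good1 r -> good1 s ->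
  good1 (fun p => x * r p + y * s p) /\
  I1 (fun p => x * r p + y * s p) = x * I1 r + y * I1 s.
Proof.
move=> gr gs; have [mr [C rC]] := gr; have [ms [D sD]] := gs; split.
  split; first by apply: measurable_funD; exact: measurable_funM.
  exists (`|x| * C + `|y| * D) => p; apply: (le_trans (ler_normD _ _)).
  by rewrite !normrM; apply: lerD; rewrite ler_wpM2l.
have ir := good1_int gr; have is_ := good1_int gs.
rewrite /I1 -!RintegralZl// -RintegralD//.
- by apply: eq_Rintegral => p _; ring.
- by have := integrableZl measurableT x ir; apply: eq_integrable => // p _.
- by have := integrableZl measurableT y is_; apply: eq_integrable => // p _.
Qed.

Let I2_lin (x y : R) r s : good2 r -> good2 s ->
  good2 (fun q => x * r q + y * s q) /\
  I2 (fun q => x * r q + y * s q) = x * I2 r + y * I2 s.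
Proof.
move=> gr gs; have [mr [C rC]] := gr; have [ms [D sD]] := gs; split.
  split; first by apply: measurable_funD; exact: measurable_funM.
  exists (`|x| * C + `|y| * D) => p; apply: (le_trans (ler_normD _ _)).
  by rewrite !normrM mulrDl -!mulrA; apply: lerD; rewrite ler_wpM2l.
have ir := good2_int gr; have is_ := good2_int gs.
rewrite /I2 -!RintegralZl// -RintegralD//.
- by apply: eq_Rintegral => p _; ring.
- by have := integrableZl measurableT x ir; apply: eq_integrable => // p _.
- by have := integrableZl measurableT y is_; apply: eq_integrable => // p _.
Qed.

Let mX : measurable_fun setT (X 1). Proof. exact: measurable_restx. Qed.

Let X_le1 p : `|X 1 p| <= 1.
Proof. by rewrite ger0_norm ?restx_le1// ltW// restx_gt0. Qed.

Let good1_X n : good1 (fun p => X 1 p ^+ n).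
Proof.
by split; [exact: measurable_funX|exists 1 => p; rewrite normrX exprn_ile1].
Qed.

Let good2_Xkk n : good2 (fun q => X 1 q.1 ^+ n * kk 1 q) /\
  good2 (fun q => X 1 q.2 ^+ n * kk 1 q).
Proof.
split; split.
- apply: measurable_funM; last exact: measurable_energy_kernel.
  by apply: measurable_funX; exact: measurableT_comp mX mfst.
- exists 1 => q; rewrite normrM mul1r -[leRHS]mul1r.
  by apply: ler_pM => //; rewrite ?energy_kernel_le// normrX exprn_ile1.
- apply: measurable_funM; last exact: measurable_energy_kernel.
  by apply: measurable_funX; exact: measurableT_comp mX msnd.
- exists 1 => q; rewrite normrM mul1r -[leRHS]mul1r.
  by apply: ler_pM => //; rewrite ?energy_kernel_le// normrX exprn_ile1.
Qed.

Let I2_swap n : I2 (fun q => X 1 q.2 ^+ n * kk 1 q) = I2 (fun q => X 1 q.1 ^+ n * kk 1 q).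
Proof.
rewrite /I2 -(Rintegral_swap (good2_int (good2_Xkk n).1)).
by apply: eq_Rintegral => q _ /=; rewrite energy_kernel_sym; ring.
Qed.

Let X_en p : X 1 p * en c e0 p = e0.
Proof. by rewrite /restx mul1r divfK// gt_eqF// en_gt0. Qed.

(** The eigenvalue equation tested with x^(n+1) f; the kinetic energy is lowered
    to x^n since x e = e0. *)
Let eigen_weighted n : e0 * I1 (fun p => X 1 p ^+ n) -
    K * I2 (fun q => X 1 q.1 ^+ n.+1 * kk 1 q) = E * I1 (fun p => X 1 p ^+ n.+1).
Proof.
have tw : test_function (fun p => X 1 p ^+ n.+1 * f p).
  apply: test_weight => //; first exact: measurable_funX.
  by move=> p; rewrite normrX exprn_ile1.
have := eigen tw.
have -> : \int[mu]_p (X 1 p ^+ n.+1 * f p * en c e0 p * f p) = e0 * I1 (fun p => X 1 p ^+ n).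
  rewrite -RintegralZl//; last exact: good1_int.
  apply: eq_Rintegral => p _; rewrite exprS.
  transitivity ((X 1 p * en c e0 p) * (f p * X 1 p ^+ n * f p)); first ring.
  by rewrite X_en.
have -> : \int[mu2]_q (X 1 q.1 ^+ n.+1 * f q.1 * kk 1 q * f q.2) =
  I2 (fun q => X 1 q.1 ^+ n.+1 * kk 1 q).
  by apply: eq_Rintegral => q _; ring.
have -> : \int[mu]_p (X 1 p ^+ n.+1 * f p * 1 * f p) = I1 (fun p => X 1 p ^+ n.+1).
  by apply: eq_Rintegral => p _; ring.
by [].
Qed.

(** The virial identity plus the equation tested with x^2 f minus the equation
    tested with x f. On the large-component term a G G' the virial weight
    x (1 - x) + x' (1 - x') is exactly compensated by the weights x and x^2, so
    the term disappears; on the small-component term the weights add up to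
    x + x'. *)
Lemma virial_combined :
  E * \int[mu]_p (f p * (1 - X 1 p + X 1 p ^+ 2) * f p) -
    \int[mu]_p (f p * (e0 * (2 * X 1 p - 1)) * f p) =
  K * \int[mu2]_q (f q.1 *
        ((X 1 q.1 + X 1 q.2) * (b (q.2 / q.1) * (H 1 q.1 * H 1 q.2))) * f q.2).
Proof.
have V : e0 * I1 (fun p => X 1 p ^+ 1) - K * I2 dkk = E * I1 (fun p => X 1 p ^+ 0).
  move: virial; have -> : \int[mu]_p (f p * (e0 ^+ 2 / en c e0 p) * f p) = e0 * I1 (fun p => X 1 p ^+ 1).
    rewrite -RintegralZl//; last exact: good1_int.
    by apply: eq_Rintegral => p _; rewrite /restx expr1 mul1r expr2; ring.
  by [].
have T1 := eigen_weighted 0; have T2 := eigen_weighted 1.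
have gd : good2 dkk.
  split.
    have md1 : measurable_fun setT (fun q : R * R => dG q.1).
      apply: (measurableT_comp (f := dG)) mfst; apply: measurable_funM; last exact: measurable_mixG.
      by apply: measurable_funM; [exact: measurable_funM|exact: measurable_funB].
    have md2 : measurable_fun setT (fun q : R * R => dG q.2).
      apply: (measurableT_comp (f := dG)) msnd; apply: measurable_funM; last exact: measurable_mixG.
      by apply: measurable_funM; [exact: measurable_funM|exact: measurable_funB].
    have mdH : measurable_fun setT dH.
      apply: measurableT_comp => //; apply: measurable_funM; last exact: measurable_mixH.
      by apply: measurable_funM; [exact: measurable_funM|exact: measurable_funD].
    have md3 : measurable_fun setT (fun q : R * R => dH q.1) by exact: measurableT_comp mdH mfst.
    have md4 : measurable_fun setT (fun q : R * R => dH q.2) by exact: measurableT_comp mdH msnd.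
    by apply: measurable_funD; apply: measurable_funM => //; apply: measurable_funD; exact: measurable_funM.
  have gb p : `|G 1 p| <= 1.
    by have /andP[g0 g1] := mixG_bound c e00 p ltr01; rewrite ger0_norm// (le_trans _ g0)// invr_ge0.
  have hb p : `|H 1 p| <= 1.
    by have /andP[h0 h1] := mixH_bound c e00 p ltr01; rewrite ger0_norm.
  have dgb p : `|dG p| <= 1.
    rewrite /dG normrM mulr_ile1//; have x0 := restx_gt0 c e00 p ltr01; have x1 := restx_le1 c e00 p ltr01.
    by rewrite ger0_norm; nra.
  have dhb p : `|dH p| <= 1.
    rewrite /dH normrN normrM mulr_ile1//; have x0 := restx_gt0 c e00 p ltr01; have x1 := restx_le1 c e00 p ltr01.
    by rewrite ger0_norm; nra.
  have two (x y z t : R) : `|x| <= 1 -> `|y| <= 1 -> `|z| <= 1 -> `|t| <= 1 -> `|x * y + z * t| <= 2.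
    move=> *; apply: (le_trans (ler_normD _ _)); rewrite !normrM.
    have -> : 2 = 1 + 1 :> R by lra.
    by apply: lerD; exact: mulr_ile1.
  exists 2 => q; apply: (le_trans (ler_normD _ _)).
  by rewrite /S [leRHS]mulrDr !normrM; apply: lerD; rewrite mulrC ler_wpM2r// two.
(* the weights x and x^2 are first symmetrised in the two momenta *)
have [g1 _] := good2_Xkk 1; have [_ g1'] := good2_Xkk 1.
have [g2 _] := good2_Xkk 2; have [_ g2'] := good2_Xkk 2.
have [h1 L1] := I1_lin (-1) 1 (good1_X 1) (good1_X 2).
have [_ L2] := I1_lin 1 1 (good1_X 0) h1.
have [_ L3] := I1_lin (2 * e0) (- e0) (good1_X 1) (good1_X 0).
have -> : \int[mu]_p (f p * (1 - X 1 p + X 1 p ^+ 2) * f p) =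
   I1 (fun p => X 1 p ^+ 0) - I1 (fun p => X 1 p ^+ 1) + I1 (fun p => X 1 p ^+ 2).
  transitivity (I1 (fun p => 1 * X 1 p ^+ 0 + 1 * ((-1) * X 1 p ^+ 1 + 1 * X 1 p ^+ 2))).
    by apply: eq_Rintegral => p _; rewrite expr0 expr1; ring.
  by rewrite L2 L1; ring.
have -> : \int[mu]_p (f p * (e0 * (2 * X 1 p - 1)) * f p) =
   2 * e0 * I1 (fun p => X 1 p ^+ 1) - e0 * I1 (fun p => X 1 p ^+ 0).
  transitivity (I1 (fun p => 2 * e0 * X 1 p ^+ 1 + (- e0) * X 1 p ^+ 0)).
    by apply: eq_Rintegral => p _; rewrite expr0 expr1; ring.
  by rewrite L3; ring.
have -> : \int[mu2]_q (f q.1 *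
        ((X 1 q.1 + X 1 q.2) * (b (q.2 / q.1) * (H 1 q.1 * H 1 q.2))) * f q.2) =
   - I2 dkk - I2 (fun q => X 1 q.1 ^+ 2 * kk 1 q) + I2 (fun q => X 1 q.1 ^+ 1 * kk 1 q).
  have [k1 M1] := I2_lin (2^-1) (2^-1) g1 g1'.
  have [k2 M2] := I2_lin (- 2^-1) (- 2^-1) g2 g2'.
  have [k3 M3] := I2_lin 1 1 k1 k2.
  have [k4 M4] := I2_lin (-1) 1 gd k3.
  transitivity (I2 (fun q => -1 * dkk q + 1 * (1 * (2^-1 * (X 1 q.1 ^+ 1 * kk 1 q) + 2^-1 * (X 1 q.2 ^+ 1 * kk 1 q)) +
     1 * (- 2^-1 * (X 1 q.1 ^+ 2 * kk 1 q) + - 2^-1 * (X 1 q.2 ^+ 2 * kk 1 q))))).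
    apply: eq_Rintegral => q _; congr (_ * _); congr (_ * _).
    by rewrite /dkk /dG /dH /energy_kernel !expr1; field.
  by rewrite M4 M3 M1 M2 !I2_swap; field.
have -> : E * (I1 (fun p => X 1 p ^+ 0) - I1 (fun p => X 1 p ^+ 1) + I1 (fun p => X 1 p ^+ 2)) =
  E * I1 (fun p => X 1 p ^+ 0) - E * I1 (fun p => X 1 p ^+ 1) + E * I1 (fun p => X 1 p ^+ 2) by ring.
by rewrite -V -T1 -T2; ring.
Qed.

(** The energy-weighted Schur test, applied to H f, bounds the remaining potential
    term by the integral of K e0 kb / c sqrt (1 - x^2) (1 - x) f^2, because
    c p / e = sqrt (1 - x^2) and 2 H^2 = 1 - x. If this weight is pointwise
    smaller than the weight on the other side, then f vanishes. *)
Lemma eigenfunction_ae0 : 0 <= K ->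
  (forall x, 0 < x -> x < 1 ->
    K * e0 * kb / c * Num.sqrt (1 - x ^+ 2) * (1 - x) <
    E * (1 - x + x ^+ 2) - e0 * (2 * x - 1)) ->
  {ae mu, forall p, f p = 0}.
Proof.
move=> K0 pos.
have [[mf f0 if2] _] := tf.
have [mb bV bn kb0 bm] := Hb.
pose Hf p := H 1 p * f p.
have mHf : measurable_fun setT Hf by apply: measurable_funM => //; exact: measurable_mixH.
have Hf0 p : p <= 0 -> Hf p = 0 by move=> p0; rewrite /Hf f0// mulr0.
pose w1 p : R := E * (1 - X 1 p + X 1 p ^+ 2) - e0 * (2 * X 1 p - 1).
pose w2 p : R := K * e0 * (`|p| * (2 / en c e0 p) * kb * H 1 p ^+ 2).
have w12 p : 0 < p -> w2 p < w1 p.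
  move=> p0; have x0 := restx_gt0 c e00 p ltr01; have x1 := restx_lt1 e00 c0 ltr01 p0.
  apply: le_lt_trans (pos _ x0 x1); rewrite /w2 mixH_sqr// gtr0_norm//.
  have -> : Num.sqrt (1 - X 1 p ^+ 2) = c * p / en c e0 p.
    have e1 := en_gt0 c e00 p.
    rewrite -[RHS]ger0_norm; last by rewrite divr_ge0 ?(ltW e1)// mulr_ge0 ?ltW.
    rewrite -sqrtr_sqr; congr (Num.sqrt _); rewrite /restx mul1r !expr_div_n.
    have s1 := en_sqr c e0 p.
    rewrite exprMn; have -> : c ^+ 2 * p ^+ 2 = en c e0 p ^+ 2 - e0 ^+ 2 by rewrite s1; ring.
    by rewrite mulrBl divff// gt_eqF// exprn_gt0.
  rewrite le_eqVlt; apply/orP; left; apply/eqP.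
  by field; rewrite !gt_eqF// en_gt0.
have mw1 : measurable_fun setT w1.
  apply: measurable_funB; apply: measurable_funM => //.
    by apply: measurable_funD; [exact: measurable_funB|exact: measurable_funX].
  by apply: measurable_funB => //; exact: measurable_funM.
have mw2 : measurable_fun setT w2.
  apply: measurable_funM => //; apply: measurable_funM; last first.
    by apply: measurable_funX; exact: measurable_mixH.
  apply: (measurable_funM (f := fun p : R => `|p| * (2 / en c e0 p)) (g := cst kb)) => //.
  apply: (measurable_funM (f := fun p : R => `|p|)); first exact: measurableT_comp.
  exact: measurable_funM.
have g1X := good1_X 0; have g2X := good1_X 1; have g3X := good1_X 2.
have gA : good1 (fun p => 1 - X 1 p + X 1 p ^+ 2).
  have [h1 _] := I1_lin (-1) 1 g2X g3X; have [[m [C hC]] _] := I1_lin 1 1 g1X h1.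
  split; first by apply: measurable_funD; [exact: measurable_funB|exact: measurable_funX].
  by exists C => p; apply: le_trans (hC p); rewrite expr0 expr1 le_eqVlt; apply/orP; left; apply/eqP; congr (`|_|); ring.
have gB : good1 (fun p => e0 * (2 * X 1 p - 1)).
  have [[m [C hC]] _] := I1_lin (2 * e0) (- e0) g2X g1X.
  split; first by apply: measurable_funM => //; apply: measurable_funB => //; exact: measurable_funM.
  by exists C => p; apply: le_trans (hC p); rewrite expr0 expr1 le_eqVlt; apply/orP; left; apply/eqP; congr (`|_|); ring.
have iw1 : mu.-integrable setT (EFin \o (fun p => f p * w1 p * f p)).
  have [gw _] := I1_lin E (-1) gA gB; have := good1_int gw.
  by apply: eq_integrable => // p _ /=; rewrite /w1; congr (_%:E); ring.
have V := virial_combined.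
have LHS : E * \int[mu]_p (f p * (1 - X 1 p + X 1 p ^+ 2) * f p) -
    \int[mu]_p (f p * (e0 * (2 * X 1 p - 1)) * f p) = \int[mu]_p (f p * w1 p * f p).
  have [_ L] := I1_lin E (-1) gA gB.
  transitivity (E * I1 (fun p => 1 - X 1 p + X 1 p ^+ 2) +
    (-1) * I1 (fun p => e0 * (2 * X 1 p - 1))); first by rewrite mulN1r.
  by rewrite -L; apply: eq_Rintegral => p _; rewrite /w1; ring.
rewrite LHS in V.
have w2b p : 0 <= w2 p.
  by rewrite /w2 mulr_ge0 ?(mulr_ge0 K0) ?(ltW e00)// !mulr_ge0 ?invr_ge0 ?sqrtr_ge0 ?(ltW (en_gt0 _ _ _)).
have iw2 : mu.-integrable setT (EFin \o (fun p => f p * w2 p * f p)).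
  apply: le_integrable iw1 => //.
    by apply/measurable_EFinP; apply: measurable_funM => //; exact: measurable_funM.
  move=> p _; rewrite /= lee_fin.
  have nm (y : R) : `|f p * y * f p| = f p ^+ 2 * `|y|.
    by rewrite !normrM -[in RHS]real_normK ?num_real// expr2; ring.
  rewrite !nm; have [p0|p0] := leP p 0; first by rewrite f0// expr0n/= !mul0r.
  apply: ler_wpM2l; first exact: sqr_ge0.
  rewrite (ger0_norm (w2b p)).
  by apply: (le_trans (ltW (w12 p p0))); exact: ler_norm.
have bnd : \int[mu]_p (f p * w1 p * f p) <= \int[mu]_p (f p * w2 p * f p).
  rewrite V.
  have sc := schur_energy c e00 mb bV bn bm kb0 mHf mHf Hf0 Hf0.
  pose Q (q : R * R) := (X 1 q.1 + X 1 q.2) * (b (q.2 / q.1) * (H 1 q.1 * H 1 q.2)).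
  have gQ : good2 Q.
    split.
      apply: measurable_funM; first by apply: measurable_funD; [exact: measurableT_comp mX mfst|exact: measurableT_comp mX msnd].
      by apply: measurable_funM => //; exact: measurable_funM.
    have hb p : `|H 1 p| <= 1.
      by have /andP[h0 h1] := mixH_bound c e00 p ltr01; rewrite ger0_norm.
    exists 2 => q; rewrite /Q normrM; apply: ler_pM => //.
      by apply: (le_trans (ler_normD _ _)); rewrite (_ : 2 = 1 + 1 :> R) ?lerD//; lra.
    apply: (@le_trans _ _ `|b (q.2 / q.1)|); last by rewrite /S lerDr.
    by rewrite normrM ler_piMr// normrM mulr_ile1.
  have iQ := good2_int gQ.
  have k1 : ((`|\int[mu2]_q (f q.1 * Q q * f q.2)|%R)%:E <= e0%:E *
     \int[mu2]_q (((en c e0 q.1)^-1 + (en c e0 q.2)^-1) * `|b (q.2 / q.1)| * `|Hf q.1| * `|Hf q.2|)%:E)%E.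
    rewrite EFin_normr_Rintegral//.
    apply: (le_trans (le_abse_integral _ measurableT _)); first by have /integrableP[] := iQ.
    have mi : measurable_fun setT (fun q : R * R => (((en c e0 q.1)^-1 + (en c e0 q.2)^-1) *
        `|b (q.2 / q.1)| * `|Hf q.1| * `|Hf q.2|)).
      have mU : measurable_fun setT (fun q : R * R => Hf q.1) by exact: measurableT_comp.
      have mV : measurable_fun setT (fun q : R * R => Hf q.2) by exact: measurableT_comp.
      apply: measurable_funM; last exact: measurableT_comp.
      apply: measurable_funM; last exact: measurableT_comp.
      by apply: measurable_funM => //; exact: measurableT_comp.
    rewrite -ge0_integralZl//; last 3 first.
    - exact/measurable_EFinP.
    - by move=> q _; rewrite lee_fin !mulr_ge0.
    - by rewrite lee_fin ltW.
    apply: ge0_le_integral => //.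
    - by have /integrableP[mq _] := iQ; exact: measurableT_comp.
    - by apply: emeasurable_funM => //; exact/measurable_EFinP.
    - move=> q _; rewrite /= -EFinM lee_fin le_eqVlt; apply/orP; left; apply/eqP.
      have hh p : 0 <= H 1 p by exact: sqrtr_ge0.
      rewrite /Q /Hf !normrM (ger0_norm (hh q.1)) (ger0_norm (hh q.2)).
      have -> : `|X 1 q.1 + X 1 q.2| = e0 * ((en c e0 q.1)^-1 + (en c e0 q.2)^-1).
        rewrite ger0_norm; last by rewrite addr_ge0// ltW// restx_gt0.
        by rewrite /restx mul1r mulrDr.
      by ring.
  have i2E : (\int[mu]_p (`|p| * (2 / en c e0 p) * kb * Hf p ^+ 2)%:E * (K * e0)%:E =
     (\int[mu]_p (f p * w2 p * f p))%:E)%E.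
    rewrite muleC -ge0_integralZl//; last 3 first.
    - apply/measurable_EFinP; apply: measurable_funM; last exact: measurable_funX.
      apply: (measurable_funM (f := fun p : R => `|p| * (2 / en c e0 p)) (g := cst kb)) => //.
      apply: (measurable_funM (f := fun p : R => `|p|)); first exact: measurableT_comp.
      exact: measurable_funM.
    - move=> p _; rewrite lee_fin; apply: mulr_ge0; last exact: sqr_ge0.
      by rewrite !mulr_ge0// invr_ge0 ltW// en_gt0.
    - by rewrite lee_fin mulr_ge0// ltW.
    rewrite /Rintegral fineK; last by exact: integrable_fin_num.
    by apply: eq_integral => p _; rewrite -EFinM /Hf /w2; congr (_%:E); ring.
  have : ((K * `|\int[mu2]_q (f q.1 * Q q * f q.2)|)%R%:E <= (\int[mu]_p (f p * w2 p * f p))%:E)%E.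
    rewrite -i2E EFinM.
    have K0' : (0 <= K%:E)%E by rewrite lee_fin.
    apply: (le_trans (lee_wpmul2l K0' k1)).
    rewrite muleA -EFinM muleC; apply: lee_wpmul2r; first by rewrite lee_fin mulr_ge0// ltW.
    apply: (le_trans sc); rewrite -mule2n -(mule_natl _ 2) muleA -EFinM mulVf// mul1e//.
  by rewrite lee_fin; apply: le_trans; rewrite ler_wpM2l// ler_norm.
pose W p := f p * (w1 p - w2 p) * f p.
have W0 p : 0 <= W p.
  have [p0|p0] := leP p 0; first by rewrite /W f0// mulr0.
  rewrite /W mulrAC -expr2 mulr_ge0 ?sqr_ge0// subr_ge0 ltW// w12//.
have iW : mu.-integrable setT (EFin \o W).
  have := integrableB measurableT iw1 iw2; apply: eq_integrable => // p _ /=.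
  by rewrite -EFinB /W; congr (_%:E); ring.
have W00 : (\int[mu]_p `|(W p)%:E| = 0)%E.
  have RW : \int[mu]_p W p <= 0.
    have -> : \int[mu]_p W p =
        (\int[mu]_p (f p * w1 p * f p)) - (\int[mu]_p (f p * w2 p * f p)).
      by rewrite -RintegralB//; apply: eq_Rintegral => p _; rewrite /W; ring.
    by rewrite subr_le0.
  apply/eqP; rewrite eq_le; apply/andP; split; last exact: integral_ge0.
  under eq_integral => p _ do rewrite gee0_abs ?lee_fin ?W0//.
  rewrite -(fineK (integrable_fin_num measurableT iW)) lee_fin.
  exact: RW.
have mW : measurable_fun setT (EFin \o W) by have /integrableP[] := iW.
have := (ae_eq_integral_abs mu measurableT mW).1 W00.
apply: filterS => p /(_ I) /= [Wp].
have [p0|p0] := leP p 0; first exact: f0.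
apply/eqP; move/eqP: Wp; rewrite /W mulf_eq0 mulf_eq0 subr_eq0 (gt_eqF (w12 p p0)) orbF.
by rewrite orbb.
Qed.

End virial.

(** * From the partial-wave operators to real functions *)
Section reduction.
Context {R : realType}.
Local Open Scope complex_scope.
Notation mu := (@lebesgue_measure R).
Notation mu2 := (mu \x mu)%E.
Variables (m c alpha Z : R) (l : nat) (s : spin).
Hypotheses (m0 : 0 < m) (c0 : 0 < c).

Let e0 := m * c ^+ 2.
Let K := alpha * c * Z / pi.
Let e00 : 0 < e0. Proof. by rewrite mulr_gt0 ?exprn_gt0. Qed.

Lemma energyE p : energy m c p = en c e0 p.
Proof. by rewrite /energy /en /e0; congr (Num.sqrt _); ring. Qed.

Lemma energy0 : energy m c 0 = e0.
Proof.
by rewrite energyE /en expr0n/= mulr0 add0r sqrtr_sqr gtr0_norm.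
Qed.

Lemma nfactor_gt0 p : 0 < nfactor m c p.
Proof.
have e1 := en_gt0 c e00 p.
by rewrite sqrtr_gt0 energy0 energyE !mulr_gt0// addr_gt0.
Qed.

Lemma mixG_nfactor p : (energy m c p + energy m c 0) / nfactor m c p = mixG c e0 1 p.
Proof.
have e1 := en_gt0 c e00 p; have n0 := nfactor_gt0 p.
have ee : 0 < en c e0 p + e0 by rewrite addr_gt0.
rewrite -[LHS]ger0_norm; last by rewrite divr_ge0// ?(ltW n0)// energy0 energyE ltW.
rewrite -sqrtr_sqr /mixG; congr (Num.sqrt _).
rewrite expr_div_n sqr_sqrtr; last by rewrite energy0 energyE !mulr_ge0// ltW.
rewrite energy0 energyE /restx mul1r.
by field; rewrite !gt_eqF.
Qed.

Lemma mixH_nfactor p : 0 < p -> c * p / nfactor m c p = mixH c e0 1 p.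
Proof.
move=> p0; have e1 := en_gt0 c e00 p; have n0 := nfactor_gt0 p.
have ee : 0 < en c e0 p + e0 by rewrite addr_gt0.
rewrite -[LHS]ger0_norm; last by rewrite divr_ge0// ?(ltW n0)// mulr_ge0// ltW.
rewrite -sqrtr_sqr /mixH; congr (Num.sqrt _).
rewrite expr_div_n sqr_sqrtr; last by rewrite energy0 energyE !mulr_ge0// ltW.
rewrite energy0 energyE /restx mul1r.
have -> : (c * p) ^+ 2 = (en c e0 p - e0) * (en c e0 p + e0).
  by rewrite -subr_sqr en_sqr; ring.
by field; rewrite !gt_eqF.
Qed.

Lemma kernel_lsE q : 0 < q.1 -> 0 < q.2 ->
  kernel_ls m c l s q.1 q.2 =
  energy_kernel c e0 (ratioQ l) (ratioQ (add_2s l s)) 1 q.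
Proof.
move=> q1 q2; have n1 := nfactor_gt0 q.1; have n2 := nfactor_gt0 q.2.
rewrite /energy_kernel /ratioQ divr_gt0// invf_div.
rewrite -(mixG_nfactor q.1) -(mixG_nfactor q.2) -(mixH_nfactor q1) -(mixH_nfactor q2).
rewrite /kernel_ls [q.1 / q.2 + _]addrC.
by field; rewrite !gt_eqF.
Qed.

Lemma ratioQ_kernel l' : ratio_kernel (momentQ l') (@ratioQ R l').
Proof.
split.
- exact: measurable_ratioQ.
- exact: ratioQV.
- by move=> u u0; rewrite /ratioQ ltNge u0.
- exact: ltW (momentQ_gt0 l').
move=> e e1; apply: le_trans (ratioQ_moment_le l' e1).
pose g (u : R) := (`|ratioQ l' u| * ((u + 1 + e * (u - 1)) / (2 * u * Num.sqrt u)))%:E.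
have mg : measurable_fun setT g.
  apply/measurable_EFinP; apply: measurable_funM.
    by apply: measurableT_comp => //; exact: measurable_ratioQ.
  apply: measurable_funM.
    apply: measurable_funD; first exact: measurable_funD.
    by apply: measurable_funM => //; exact: measurable_funB.
  apply: measurable_funV; apply: measurable_funM; first exact: measurable_funM.
  exact: measurable_sqrt.
pose D : set R := `]0, +oo[%classic.
have mD : measurable D by exact: measurable_itv.
have mD1 : measurable (D `\ 1) by exact: measurableD.
have -> : (\int[mu]_u g u = \int[mu]_(u in D) g u)%E.
  rewrite [RHS]integral_mkcond; apply: eq_integral => u _; rewrite patchE.
  case: ifPn => // uD; rewrite /g /ratioQ ifF ?normr0 ?mul0r//.
  by apply: contraNF uD => u0; rewrite inE /D/= in_itv/= u0.
rewrite le_eqVlt; apply/orP; left; apply/eqP.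
rewrite -(@integral_setD1 _ _ 1)//; last exact: measurable_funTS.
rewrite -[RHS](@integral_setD1 _ _ 1)//; last first.
  apply/measurable_EFinP/measurable_funTS; apply: measurable_funM.
    exact: measurable_ratioQ.
  apply: measurable_funM.
    apply: measurable_funD; first exact: measurable_funD.
    by apply: measurable_funM => //; exact: measurable_funB.
  apply: measurable_funV; apply: measurable_funM; first exact: measurable_funM.
  exact: measurable_sqrt.
apply: eq_integral => u /set_mem[_ /= /eqP u1].
by rewrite /g ger0_norm// ratioQ_ge0.
Qed.

(** The kernel is real, so the real and the imaginary part of an eigenfunction
    satisfy the same weak equation; the flag selects one of them. *)
Definition part (im : bool) (z : R[i]) : R := if im then complex.Im z else complex.Re z.

Lemma part_scale im (x : R) (z : R[i]) : part im (x%:C * z) = x * part im z.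
Proof. by case: im z => -[z1 z2] /=; ring. Qed.

Lemma part_sub im (z w : R[i]) : part im (z - w) = part im z - part im w.
Proof. by case: im z w => -[z1 z2] [w1 w2]. Qed.

Lemma part_cintegral im d (T : measurableType d) (nu : {measure set T -> \bar R}) (D : set T) (F : T -> R[i]) :
  part im (cintegral nu D F) = Rintegral nu D (fun x => part im (F x)).
Proof. by case: im. Qed.

Lemma part_sqr_le im (z : R[i]) : part im z ^+ 2 <= Normc.normc z ^+ 2.
Proof.
case: z => x y; rewrite /= sqr_sqrtr ?addr_ge0 ?sqr_ge0//.
by case: im => /=; rewrite ?lerDl ?lerDr sqr_ge0.
Qed.

Let D : set R := `]0, +oo[%classic.
Let mD : measurable D. Proof. exact: measurable_itv. Qed.
Let inD p : (p \in D) = (0 < p).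
Proof. by apply/idP/idP; rewrite inE /D/= in_itv/= andbT. Qed.

Definition extend_part im (psi : R -> R[i]) : R -> R := (fun p => part im (psi p)) \_ D.

Lemma extend_partE im psi p : extend_part im psi p = if 0 < p then part im (psi p) else 0.
Proof. by rewrite /extend_part patchE inD. Qed.

Lemma form_domain_test im psi : form_domain psi -> test_function (extend_part im psi).
Proof.
move=> [[mRe mIm] fin].
have mpart b : measurable_fun D (fun p => part b (psi p)) by case: b.
have mext b : measurable_fun setT (extend_part b psi).
  by apply/(measurable_restrictT _ _).1.
pose wgt p : R := Num.sqrt (1 + p ^+ 2) * Normc.normc (psi p) ^+ 2.
have mwgt : measurable_fun D wgt.
  apply: measurable_funM.
    by apply: measurable_sqrt; apply: measurable_funD => //; exact: measurable_funX.
  have -> : (fun p => Normc.normc (psi p) ^+ 2) =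
      (fun p => part false (psi p) ^+ 2 + part true (psi p) ^+ 2).
    apply/funext => p; case: (psi p) => x y /=.
    by rewrite sqr_sqrtr// addr_ge0 ?sqr_ge0.
  by apply: measurable_funD; apply: measurable_funX; exact: mpart.
have w0 p : 0 <= wgt p by rewrite mulr_ge0 ?sqrtr_ge0 ?sqr_ge0.
have iw : mu.-integrable setT (EFin \o (wgt \_ D)).
  rewrite -restrict_EFin; apply/integrable_restrict => //; rewrite setTI.
  apply/integrableP; split; first exact/measurable_EFinP.
  rewrite [ltLHS](_ : _ = \int[mu]_(p in D) (wgt p)%:E)%E//.
  by apply: eq_integral => p _; rewrite /= ger0_norm.
have dom (g : R -> R) : measurable_fun setT g -> (forall p, 0 <= g p <= Num.sqrt (1 + p ^+ 2)) ->
    mu.-integrable setT (EFin \o (fun p => g p * extend_part im psi p ^+ 2)).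
  move=> mg g1; apply: le_integrable iw => //.
    by apply/measurable_EFinP; apply: measurable_funM => //; apply: measurable_funX; exact: mext.
  move=> p _; rewrite /= lee_fin extend_partE patchE inD.
  have /andP[gp0 gp1] := g1 p.
  case: ifP => p0; last by rewrite expr0n/= mulr0.
  have gf0 : 0 <= g p * part im (psi p) ^+ 2 by apply: mulr_ge0 => //; exact: sqr_ge0.
  rewrite (ger0_norm (w0 p)) (ger0_norm gf0) /wgt; apply: ler_pM => //.
    exact: sqr_ge0.
  exact: part_sqr_le.
split; first split.
- exact: mext.
- by move=> p p0; rewrite extend_partE ltNge p0.
- have := dom (cst 1) (measurable_cst _); have H (p : R) : 0 <= (cst 1 p : R) <= Num.sqrt (1 + p ^+ 2).
    by rewrite ler01/= -[leLHS]sqrtr1 ler_wsqrtr// lerDl sqr_ge0.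
  by move=> /(_ H); apply: eq_integrable => // p _ /=; rewrite mul1r.
- apply: (dom (fun p : R => `|p|)); first exact: measurableT_comp.
  by move=> p; rewrite normr_ge0/= -sqrtr_sqr ler_wsqrtr// lerDr.
Qed.

Lemma test_form_domain (phi : R -> R) :
  test_function phi -> form_domain (fun p : R => (phi p)%:C).
Proof.
move=> [[mphi phi0 i1] i2]; split.
  by split => /=; [exact: measurable_funTS|exact: measurable_cst].
have ii : mu.-integrable D (EFin \o (fun p => (1 + `|p|) * phi p ^+ 2)).
  have ii := integrableD measurableT i1 i2.
  suff : mu.-integrable setT (EFin \o (fun p => (1 + `|p|) * phi p ^+ 2)).
    by apply: integrableS => //; exact: measurable_itv.
  move: ii; apply: eq_integrable => // p _ /=; rewrite -EFinD; congr (_%:E); ring.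
have /integrableP[_ fin] := ii; apply: le_lt_trans fin.
have nE p : Normc.normc (phi p)%:C ^+ 2 = phi p ^+ 2.
  by rewrite /= expr0n/= addr0 sqr_sqrtr// sqr_ge0.
apply: ge0_le_integral => //.
- by move=> p _; rewrite lee_fin mulr_ge0 ?sqrtr_ge0 ?sqr_ge0.
- apply/measurable_EFinP.
  have -> : (fun p => Num.sqrt (1 + p ^+ 2) * Normc.normc (phi p)%:C ^+ 2) =
    (fun p => Num.sqrt (1 + p ^+ 2) * phi p ^+ 2) by apply/funext => p; rewrite nE.
  apply: measurable_funTS; apply: measurable_funM; last exact: measurable_funX.
  by apply: measurable_sqrt; apply: measurable_funD => //; exact: measurable_funX.
- apply: measurableT_comp => //; apply/measurable_EFinP; apply: measurable_funTS.
  apply: measurable_funM; last exact: measurable_funX.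
  by apply: measurable_funD => //; exact: measurableT_comp.
- move=> p _; rewrite nE /= lee_fin ger0_norm; last first.
    by apply: mulr_ge0; [rewrite addr_ge0|exact: sqr_ge0].
  apply: ler_wpM2r; first exact: sqr_ge0.
  rewrite -[leRHS]ger0_norm ?addr_ge0// -sqrtr_sqr ler_wsqrtr//.
  rewrite -[p ^+ 2]real_normK ?num_real//; have := normr_ge0 p; rewrite !expr2; nra.
Qed.

(** Real test functions are enough: both parts of the complex equation are then
    real equations for the corresponding part of the eigenfunction. *)
Lemma eigen_part im psi eta E :
  b_ls m c alpha Z l s psi eta -> ae_eq_halfline eta (fun p => E%:C * psi p) ->
  forall phi, test_function phi ->
  \int[mu]_p (phi p * en c e0 p * extend_part im psi p) -
    K * \int[mu2]_q (phi q.1 * energy_kernel c e0 (ratioQ l) (ratioQ (add_2s l s)) 1 q *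
                     extend_part im psi q.2) =
  E * \int[mu]_p (phi p * 1 * extend_part im psi p).
Proof.
move=> [Vpsi L2eta form] aeE phi tphi.
have tf := form_domain_test im Vpsi.
have [[mphi phi0 _] _] := tphi.
have := form _ (test_form_domain tphi).
move=> /(congr1 (part im)).
rewrite /inner /beta_form part_sub part_scale !part_cintegral.
have conjC (x : R) : Num.conj x%:C = x%:C by apply/eqP; rewrite eq_complex /= oppr0 !eqxx.
have -> : Rintegral mu (@halfline R) (fun p => part im (Num.conj (phi p)%:C * eta p)) =
    E * \int[mu]_p (phi p * 1 * extend_part im psi p).
  rewrite -RintegralZl//; last first.
    by apply: (integrable_form1 (C := 1)) => // p; rewrite normr1 mul1r lerDl.
  rewrite [RHS](_ : _ = \int[mu]_(p in D) (E * (phi p * 1 * extend_part im psi p))); last first.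
    rewrite [RHS]Rintegral_mkcond; apply: eq_Rintegral => p _; rewrite patchE inD extend_partE.
    by case: ifP => //; rewrite !mulr0.
  have [[mRe mIm] _] := L2eta.
  have [[mf _ _] _] := tf.
  rewrite /Rintegral; congr fine; apply: ae_eq_integral => //.
  - apply/measurable_EFinP.
    have -> : (fun p => part im (Num.conj (phi p)%:C * eta p)) = (fun p => phi p * part im (eta p)).
      by apply/funext => p; rewrite conjC part_scale.
    apply: measurable_funM; first exact: measurable_funTS.
    by case: (im); [exact: mIm|exact: mRe].
  - apply/measurable_EFinP; apply: measurable_funTS; apply: measurable_funM => //.
    by apply: measurable_funM => //; exact: measurable_funM.
  - move: aeE; apply: (@filterS _ _ (ae_filter_ringOfSetsType mu)) => p H Dp; congr (_%:E).
    rewrite conjC part_scale H// part_scale extend_partE.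
    have -> : 0 < p by rewrite -inD inE.
    by ring.
move=> ->; apply: esym; congr (_ - _ * _).
- rewrite Rintegral_mkcond; apply: eq_Rintegral => p _; rewrite patchE inD extend_partE.
  case: ifP => p0; last by rewrite mulr0.
  by rewrite conjC -mulrA !part_scale energyE; ring.
- rewrite Rintegral_mkcond; apply: eq_Rintegral => q _; rewrite patchE extend_partE.
  have inDD : (q \in (@halfline R `*` @halfline R)) = (0 < q.1) && (0 < q.2).
    rewrite -!inD; apply/idP/andP => [/set_mem[/= ? ?]|[/set_mem ? /set_mem ?]].
      by split; rewrite inE.
    by rewrite inE.
  rewrite inDD; case: (ltP 0 q.1) => q1 /=; last by rewrite phi0// !mul0r.
  case: ifP => q2; last by rewrite mulr0.
  by rewrite conjC -mulrA !part_scale kernel_lsE//; ring.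
Qed.

Lemma no_eigenvalue (E : R) : 0 <= alpha * Z ->
  (forall x, 0 < x -> x < 1 ->
    K * e0 * momentQ (add_2s l s) / c * Num.sqrt (1 - x ^+ 2) * (1 - x) <
    E * (1 - x + x ^+ 2) - e0 * (2 * x - 1)) ->
  ~ eigenvalue_of (b_ls m c alpha Z l s) E%:C.
Proof.
move=> aZ pos [psi [eta [form psi0 aeE]]]; apply: psi0.
have [Vpsi _ _] := form.
have K0 : 0 <= K.
  have -> : K = alpha * Z * (c / pi) by rewrite /K; ring.
  by rewrite mulr_ge0// divr_ge0 ?pi_ge0// ltW.
have ae0 im : {ae mu, forall p, extend_part im psi p = 0}.
  exact: (eigenfunction_ae0 c0 e00 (ratioQ_kernel l) (ratioQ_kernel (add_2s l s))
    (form_domain_test im Vpsi) (eigen_part im form aeE) K0 pos).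
have := ae0 true; have := ae0 false.
apply: (@filterS2 _ _ (ae_filter_ringOfSetsType mu)) => p.
rewrite !extend_partE => r0 i0 hp; have p0 : 0 < p by move: hp; rewrite /halfline/= in_itv/= andbT.
by move: r0 i0; rewrite p0; case: (psi p) => x y /= -> ->.
Qed.

End reduction.

(** * Positivity of the virial weight *)
Section coupling.
Context {R : realType}.
Implicit Types (A x y : R).

(** The critical charge satisfies alpha Z_c <= 1, since pi / 2 + 2 / pi is at least
    2 by the inequality of arithmetic and geometric means. *)
Lemma coupling_lt1 (alpha Z : R) : 0 < alpha -> 0 < Z -> Z < Z_crit alpha -> alpha * Z < 1.
Proof.
move=> a0 Z0; rewrite /Z_crit; have p0 : 0 < (pi : R) by exact: pi_gt0.
have ge2 : 2 <= pi / 2 + 2 / pi :> R.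
  move: p0; move: (pi : R) => x x0; rewrite -subr_ge0.
  rewrite (_ : _ - _ = (x - 2) ^+ 2 / (2 * x)); last by field; rewrite gt_eqF.
  by apply: divr_ge0; [exact: sqr_ge0|rewrite mulr_ge0// ltW].
have q0 : 0 < (pi / 2 + 2 / pi) * alpha by rewrite mulr_gt0// (lt_le_trans _ ge2).
rewrite ltr_pdivlMr// => h.
have : 2 * (alpha * Z) <= Z * ((pi / 2 + 2 / pi) * alpha).
  rewrite [leRHS](_ : _ = (pi / 2 + 2 / pi) * (alpha * Z)); last by ring.
  by rewrite ler_wpM2r// mulr_ge0// ltW.
by lra.
Qed.

Lemma sqrt1_le x : 0 < x -> x < 1 ->
  0 <= Num.sqrt (1 - x ^+ 2) /\ Num.sqrt (1 - x ^+ 2) <= 1 - x ^+ 2 / 2.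
Proof.
move=> x0 x1; split; first exact: sqrtr_ge0.
have h : 0 <= 1 - x ^+ 2 / 2 by rewrite expr2; nra.
rewrite -[leRHS]ger0_norm// -sqrtr_sqr ler_wsqrtr// -subr_ge0.
by rewrite (_ : _ - _ = (x ^+ 2) ^+ 2 / 4); [rewrite divr_ge0 ?sqr_ge0|field].
Qed.

(** After squaring: 9 / 4 (1 - x^2) < (2 - x)^2 because the difference
    13 / 4 x^2 - 4 x + 7 / 4 has negative discriminant. *)
Lemma virial_gap_le32 (a x : R) : 0 < x -> x < 1 -> a <= 3 / 2 ->
  a * Num.sqrt (1 - x ^+ 2) < 2 - x.
Proof.
move=> x0 x1 a32; have [y0 y1] := sqrt1_le x0 x1.
apply: (@le_lt_trans _ _ (3 / 2 * Num.sqrt (1 - x ^+ 2))); first by rewrite ler_wpM2r.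
have h : 0 <= 2 - x by lra.
have h' : 0 <= 3 / 2 * Num.sqrt (1 - x ^+ 2) by apply: mulr_ge0 => //; lra.
rewrite -(ltr_pXn2r (n := 2))// ?nnegrE//.
rewrite exprMn sqr_sqrtr; first by rewrite !expr2; nra.
by rewrite expr2; nra.
Qed.

(** At E = e0 the left-hand weight of the virial identity is e0 (1 - x) (2 - x),
    so a factor 1 - x cancels. *)
Lemma virial_gap_energy (e0 E a x : R) : 0 < e0 -> e0 <= E -> a <= 3 / 2 ->
  0 < x -> x < 1 ->
  a * e0 * Num.sqrt (1 - x ^+ 2) * (1 - x) < E * (1 - x + x ^+ 2) - e0 * (2 * x - 1).
Proof.
move=> e00 eE a32 x0 x1.
have gap := virial_gap_le32 x0 x1 a32.
apply: (@lt_le_trans _ _ (e0 * ((1 - x) * (2 - x)))).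
  rewrite [ltLHS](_ : _ = e0 * ((1 - x) * (a * Num.sqrt (1 - x ^+ 2)))); last by ring.
  by rewrite !ltr_pM2l// subr_gt0.
have : e0 * (1 - x + x ^+ 2) <= E * (1 - x + x ^+ 2).
  by rewrite ler_wpM2r// expr2; nra.
by rewrite -subr_ge0 => h; rewrite -subr_ge0; apply: le_trans h _; rewrite le_eqVlt; apply/orP; left; apply/eqP; ring.
Qed.

(** With sqrt (1 - x^2) <= 1 - x^2 / 2 the gap becomes affine and increasing in A;
    at A = 3 / 4 it is (1 - x) (1 / 2 - x + 3 / 4 x^2), which is positive. The
    threshold 2 A - 1 / 2 equals 1 at A = 3 / 4. *)
Lemma virial_gap_strong (e0 E A x : R) : 0 < e0 -> 3 / 4 <= A ->
  (2 * A - 1 / 2) * e0 <= E -> 0 < x -> x < 1 ->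
  2 * A * e0 * Num.sqrt (1 - x ^+ 2) * (1 - x) < E * (1 - x + x ^+ 2) - e0 * (2 * x - 1).
Proof.
move=> e00 A34 EA x0 x1; have [y0 y1] := sqrt1_le x0 x1.
have x11 : 0 < 1 - x by lra.
apply: (@le_lt_trans _ _ (e0 * (2 * A * ((1 - x ^+ 2 / 2) * (1 - x))))).
  rewrite [leLHS](_ : _ = e0 * (2 * A * (Num.sqrt (1 - x ^+ 2) * (1 - x)))); last by ring.
  rewrite (ler_pM2l e00) ler_wpM2l//; first by lra.
  by rewrite ler_wpM2r// ltW.
apply: (@lt_le_trans _ _ (e0 * ((2 * A - 1 / 2) * (1 - x + x ^+ 2) - (2 * x - 1)))).
  rewrite (ltr_pM2l e00) -subr_gt0.
  have -> : (2 * A - 1 / 2) * (1 - x + x ^+ 2) - (2 * x - 1) -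
      2 * A * ((1 - x ^+ 2 / 2) * (1 - x)) =
    (1 - x) * (3 / 4 * (x - 2 / 3) ^+ 2 + 1 / 6) + (A - 3 / 4) * (x ^+ 2 * (3 - x)).
    by field.
  apply: ltr_wpDr; last by apply: mulr_gt0 => //; apply: ltr_wpDl; [apply: mulr_ge0|]; rewrite ?sqr_ge0.
  by apply: mulr_ge0; [lra|apply: mulr_ge0; [exact: sqr_ge0|lra]].
rewrite -subr_ge0 [leRHS](_ : _ = (E - (2 * A - 1 / 2) * e0) * (1 - x + x ^+ 2)); last by ring.
by rewrite mulr_ge0 ?subr_ge0// expr2; nra.
Qed.
End coupling.

(** * Absence of embedded eigenvalues *)

Local Open Scope complex_scope.

Theorem theorem3p2 (R : realType) (m c alpha Z : R)
    (hm : 0 < m) (hc : 0 < c) (halpha : 0 < alpha)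
    (hZ : 0 < Z) (hZc : Z < Z_crit alpha) :
  (forall (l : nat) (s : spin),
      (l, s) <> (0%N, spin_down) -> (l, s) <> (1%N, spin_down) ->
      forall E : R, m * c ^+ 2 <= E ->
        ~ eigenvalue_of (b_ls m c alpha Z l s) E%:C) /\
  ((forall E : R, Num.max 1 (2 * alpha * Z - 1 / 2) * (m * c ^+ 2) <= E ->
        ~ eigenvalue_of (b_ls m c alpha Z 1 spin_down) E%:C) /\
   (Z <= 3 / (4 * alpha) ->
      forall E : R, m * c ^+ 2 <= E ->
        ~ eigenvalue_of (b_ls m c alpha Z 1 spin_down) E%:C)).
Proof.
have e00 : 0 < m * c ^+ 2 by rewrite mulr_gt0 ?exprn_gt0.
have aZ1 := coupling_lt1 halpha hZ hZc.
have aZ0 : 0 <= alpha * Z by rewrite mulr_ge0// ltW.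
have p0 : pi != 0 :> R by rewrite gt_eqF ?pi_gt0.
have coupling kappa : alpha * c * Z / pi * (m * c ^+ 2) * (kappa * pi) / c =
    kappa * (alpha * Z) * (m * c ^+ 2) :> R.
  by move: p0; move: (pi : R) => w w0; field; rewrite w0 gt_eqF.
have down E : Num.max 1 (2 * alpha * Z - 1 / 2) * (m * c ^+ 2) <= E ->
    ~ eigenvalue_of (b_ls m c alpha Z 1 spin_down) E%:C.
  move=> hE; apply: no_eigenvalue => // x x0 x1.
  rewrite [momentQ _](_ : _ = 2 * pi)// coupling.
  have [A34|/ltW A34] := leP (alpha * Z) (3 / 4).
    apply: virial_gap_energy => //; last by lra.
    by apply: le_trans hE; rewrite ler_peMl ?(ltW e00)// le_max lexx.
  apply: virial_gap_strong => //; apply: le_trans hE.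
  by rewrite (ler_pM2r e00) le_max mulrA lexx orbT.
split; last split=> //.
- move=> l s ls0 ls1 E hE; apply: no_eigenvalue => // x x0 x1.
  rewrite [momentQ _](_ : _ = 4 / 3 * pi); last first.
    case: s ls0 ls1 => //; case: l => [|[|l]]//= ls0 ls1; by [case: ls0|case: ls1].
  by rewrite coupling; apply: virial_gap_energy => //; lra.
- rewrite ler_pdivlMr ?mulr_gt0// => hZ4 E hE; apply: down.
  rewrite max_l ?mul1r// -mulrA; lra.
Qed.
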